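(* The $\mathbb C(q)$-linear monoidal categories $\mathbf{Web}^{\bullet\prime}$ and $\mathbf{Web}^{\bullet}$ (the latter taken over $\Bbbk=\mathbb C(q)$) are isomorphic; likewise, the $\mathbb C(q)$-linear monoidal categories $\mathbf{Schur}^{\bullet\prime}$ and $\mathbf{Schur}^{\bullet}$ (the latter taken over $\Bbbk=\mathbb C(q)$) are isomorphic.
   Context: **Notation.** $\Bbbk$ is a commutative ring containing $q^{\pm1}$; here $\Bbbk=\mathbb C(q)$. $[n]=\frac{q^n-q^{-n}}{q-q^{-1}}$, $[a]!=[1][2]\cdots[a]$, $\begin{bmatrix}n\\ a\end{bmatrix}=\frac{[n][n-1]\cdots[n-a+1]}{[a]!}$. In a strict monoidal category, $fg=f\circ g$ (diagrammatically $f$ on top of $g$), $\otimes$ is horizontal juxtaposition, and $1_X$ is the identity of $X$. Strands of thickness $0$ are deleted: $0$ is the unit object, and merges, splits, crossings and dots involving a $0$ are read as identities. Iterated merges and splits (well defined by (W1)) are written $\mathsf m_{a_1,\dots,a_k}$, $\mathsf s_{a_1,\dots,a_k}$; $1^a=(1,\dots,1)$. **$\mathbf{Web}^\bullet$** is the strict $\Bbbk$-linear monoidal category with generating objects $a\in\mathbb Z_{\ge1}$ and generating morphisms $\mathsf m_{a,b}:a\otimes b\to a+b$ (merge), $\mathsf s_{a,b}:a+b\to a\otimes b$ (split), $\mathsf c_{a,b}:a\otimes b\to b\otimes a$ (positive crossing), $\mathsf x_a:a\to a$ (dot), where $\mathsf c_{a,b}$ and $\mathsf x_a$ are invertible, subject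 to, for all $a,b,c,d\ge1$: (W1) $\mathsf m_{a+b,c}(\mathsf m_{a,b}\otimes1_c)=\mathsf m_{a,b+c}(1_a\otimes\mathsf m_{b,c})$, $(\mathsf s_{a,b}\otimes1_c)\mathsf s_{a+b,c}=(1_a\otimes\mathsf s_{b,c})\mathsf s_{a,b+c}$; (W2) if $a+c=b+d$: $\mathsf s_{b,d}\mathsf m_{a,c}=\sum q^{st}(\mathsf m_{s,b-s}\otimes\mathsf m_{a-s,t})(1_s\otimes\mathsf c_{a-s,c-t}\otimes1_t)(\mathsf s_{s,a-s}\otimes\mathsf s_{c-t,t})$, the sum over $0\le s\le\min(a,b)$, $0\le t\le\min(c,d)$, $t-s=d-a$; (W3) $\mathsf m_{a,b}\mathsf s_{a,b}=\begin{bmatrix}a+b\\ a\end{bmatrix}1_{a+b}$; (W4) $\mathsf c_{a,b}(\mathsf x_a\otimes1_b)=(1_b\otimes\mathsf x_a)\mathsf c_{b,a}^{-1}$, $(\mathsf x_b\otimes1_a)\mathsf c_{a,b}=\mathsf c_{b,a}^{-1}(1_a\otimes\mathsf x_b)$; (W5) $\mathsf s_{a,b}\mathsf x_{a+b}=(\mathsf x_a\otimes\mathsf x_b)\mathsf s_{a,b}$, $\mathsf x_{a+b}\mathsf m_{a,b}=\mathsf m_{a,b}(\mathsf x_a\otimes\mathsf x_b)$; (W6) $\mathsf m_{1^a}\,\mathsf x_1^{\otimes a}\,\mathsf s_{1^a}=[a]!\,\mathsf x_a$, $\mathsf m_{1^a}(\mathsf x_1^{-1})^{\otimes a}\mathsf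 s_{1^a}=[a]!\,\mathsf x_a^{-1}$. For $0\le r\le a$ put $\omega_{a,r}=\mathsf m_{r,a-r}(\mathsf x_r\otimes1_{a-r})\mathsf s_{r,a-r}$ (so $\omega_{a,0}=1_a$). **$\mathbf{Schur}^\bullet$** is the strict $\Bbbk$-linear monoidal category with generating objects $a\in\mathbb Z_{\ge1}$ (black strands) and $u\in\Bbbk$ (red strands; distinct in nature from the integers $a$), generating morphisms $\mathsf m_{a,b},\mathsf s_{a,b},\mathsf c_{a,b},\mathsf x_a$ ($\mathsf c_{a,b}$ and $\mathsf x_a$ invertible) and $\mathsf r_{a,u}:a\otimes u\to u\otimes a$ (traverse-up), $\mathsf l_{u,a}:u\otimes a\to a\otimes u$ (traverse-down), subject to (W1)–(W6) and: (S1) $(1_u\otimes\mathsf s_{b,a})\mathsf r_{a+b,u}=(\mathsf r_{b,u}\otimes1_a)(1_b\otimes\mathsf r_{a,u})(\mathsf s_{b,a}\otimes1_u)$, $(\mathsf s_{a,b}\otimes1_u)\mathsf l_{u,a+b}=(1_a\otimes\mathsf l_{u,b})(\mathsf l_{u,a}\otimes1_b)(1_u\otimes\mathsf s_{a,b})$, $\mathsf l_{u,a+b}(1_u\otimes\mathsf m_{a,b})=(\mathsf m_{a,b}\otimes1_u)(1_a\otimes\mathsf l_{u,b})(\mathsf l_{u,a}\otimes1_b)$, $\mathsf r_{a+b,u}(\mathsf m_{a,b}\otimes1_u)=(1_u\otimes\mathsf m_{a,b})(\mathsf r_{a,u}\otimes1_b)(1_a\otimes\mathsf r_{b,u})$;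 (S2) $\mathsf l_{u,a}\mathsf r_{a,u}=\sum_{t=0}^a(-1)^tq^{-t(a-t)}u^t\,\omega_{a,a-t}\otimes1_u$, $\mathsf r_{a,u}\mathsf l_{u,a}=\sum_{t=0}^a(-1)^tq^{-t(a-t)}u^t\,1_u\otimes\omega_{a,a-t}$; (S3) $(\mathsf l_{u,b}\otimes1_a)(1_u\otimes\mathsf c_{a,b})(\mathsf r_{a,u}\otimes1_b)=\sum_{s=0}^{\min(a,b)}(-1)^sq^{s(s-1)/2}(q^{-1}-q)^s[s]!\,(\mathsf m_{s,b-s}\otimes1_u\otimes\mathsf m_{a-s,s})(1_s\otimes B_s\otimes\mathsf x_s)(\mathsf s_{s,a-s}\otimes1_u\otimes\mathsf s_{b-s,s})$, where $B_s=(1_{b-s}\otimes\mathsf r_{a-s,u})(\mathsf c_{a-s,b-s}\otimes1_u)(1_{a-s}\otimes\mathsf l_{u,b-s})$. **$\mathbf{Web}^{\bullet\prime}$** is the strict $\mathbb C(q)$-linear monoidal category with generating objects $a\in\mathbb Z_{\ge1}$, generating morphisms $\mathsf m_{a,b},\mathsf s_{a,b},\mathsf c_{a,b}$ ($a,b\ge1$) and $\mathsf x_1:1\to1$, with $\mathsf c_{a,b}$ and $\mathsf x_1$ invertible, subject to (W1), (W2), (W3), and (W4) only for $a=b=1$. **$\mathbf{Schur}^{\bullet\prime}$** is the strict $\mathbb C(q)$-linear monoidal category with generating objects $a\in\mathbb Z_{\ge1}$ and $u\in\mathbb C(q)$, generating morphisms those of $\mathbf{Web}^{\bullet\prime}$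 together with $\mathsf r_{a,u},\mathsf l_{u,a}$ ($a\ge 1$), subject to the relations of $\mathbf{Web}^{\bullet\prime}$, (S1), and the cases $a=1$ of (S2) and $a=b=1$ of (S3), i.e. $\mathsf l_{u,1}\mathsf r_{1,u}=\mathsf x_1\otimes1_u-u\,1_{1\otimes u}$, $\mathsf r_{1,u}\mathsf l_{u,1}=1_u\otimes\mathsf x_1-u\,1_{u\otimes1}$, $(\mathsf l_{u,1}\otimes1_1)(1_u\otimes\mathsf c_{1,1})(\mathsf r_{1,u}\otimes1_1)=(1_1\otimes\mathsf r_{1,u})(\mathsf c_{1,1}\otimes1_u)(1_1\otimes\mathsf l_{u,1})-(q^{-1}-q)\,1_1\otimes1_u\otimes\mathsf x_1$. *)

(* Defs.v *)
From HB Require Import structures.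
From Stdlib Require Import Setoid Morphisms.
From mathcomp Require Import all_boot all_algebra.
From mathcomp Require Import generic_quotient fraction complex zify.
From mathcomp Require Import boolp reals.

Set Implicit Arguments.
Unset Strict Implicit.
Unset Printing Implicit Defensive.
Import GRing.Theory.
Local Open Scope ring_scope.
Local Open Scope quotient_scope.

Definition transport2 (O : Type) (H : O -> O -> Type) A A' B B'
    (eA : A = A') (eB : B = B') (f : H A B) : H A' B' :=
  eq_rect B (H A') (eq_rect A (fun X => H X B) f A' eA) B' eB.

(* Associativity and unitality of the tensor product are Leibniz equalities of
   objects; the corresponding laws for morphisms hold up to transport. *)
Record linmoncat (k : comNzRingType) := LinMonCat {
  ob : Type;
  hom : ob -> ob -> lmodType k;
  idm : forall A, hom A A;
  comp : forall A B C, hom B C -> hom A B -> hom A C;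
  unitob : ob;
  otimes : ob -> ob -> ob;
  tens : forall A B C D, hom A B -> hom C D -> hom (otimes A C) (otimes B D);
  otimesA : forall A B C, otimes A (otimes B C) = otimes (otimes A B) C;
  otimes1o : forall A, otimes unitob A = A;
  otimeso1 : forall A, otimes A unitob = A;
  compA : forall A B C D (f : hom C D) (g : hom B C) (h : hom A B),
    comp f (comp g h) = comp (comp f g) h;
  comp1m : forall A B (f : hom A B), comp (idm B) f = f;
  compm1 : forall A B (f : hom A B), comp f (idm A) = f;
  comp_linl : forall A B C (g : hom A B), linear (fun f : hom B C => comp f g);
  comp_linr : forall A B C (f : hom B C), linear (fun g : hom A B => comp f g);
  tens_linl : forall A B C D (g : hom C D), linear (fun f : hom A B => tens f g);
  tens_linr : forall A B C D (f : hom A B), linear (fun g : hom C D => tens f g);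
  tens_id : forall A B, tens (idm A) (idm B) = idm (otimes A B);
  tens_comp : forall A B C A' B' C' (f : hom B C) (g : hom A B)
    (f' : hom B' C') (g' : hom A' B'),
    tens (comp f g) (comp f' g') = comp (tens f f') (tens g g');
  tensA : forall A B C A' B' C' (f : hom A A') (g : hom B B') (h : hom C C'),
    @transport2 _ (fun X Y => hom X Y) _ _ _ _ (otimesA A B C) (otimesA A' B' C') (tens f (tens g h))
    = tens (tens f g) h;
  tens1m : forall A B (f : hom A B),
    @transport2 _ (fun X Y => hom X Y) _ _ _ _ (otimes1o A) (otimes1o B) (tens (idm unitob) f) = f;
  tensm1 : forall A B (f : hom A B),
    @transport2 _ (fun X Y => hom X Y) _ _ _ _ (otimeso1 A) (otimeso1 B) (tens f (idm unitob)) = f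
}.
Arguments idm {k l} A.
Arguments comp {k l A B C} f g.
Arguments unitob {k l}.
Arguments otimes {k l} A B.
Arguments tens {k l A B C D} f g.

Definition cast_hom (k : comNzRingType) (C : linmoncat k) (A A' B B' : ob C)
    (eA : A = A') (eB : B = B') (f : hom A B) : hom A' B' :=
  transport2 (H := fun X Y => hom X Y) eA eB f.

Record linmonfunctor (k : comNzRingType) (C D : linmoncat k) := LinMonFunctor {
  fob :> ob C -> ob D;
  fhom : forall A B, {linear hom A B -> hom (fob A) (fob B)};
  fhom_id : forall A, fhom A A (idm A) = idm (fob A);
  fhom_comp : forall A B E (f : hom B E) (g : hom A B),
    fhom A E (comp f g) = comp (fhom B E f) (fhom A B g);
  fob_unit : fob unitob = unitob;
  fob_otimes : forall A B, fob (otimes A B) = otimes (fob A) (fob B);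
  fhom_tens : forall A B A' B' (f : hom A A') (g : hom B B'),
    cast_hom (fob_otimes A B) (fob_otimes A' B') (fhom _ _ (tens f g))
    = tens (fhom _ _ f) (fhom _ _ g)
}.

Definition is_left_inverse (k : comNzRingType) (C D : linmoncat k)
    (G : linmonfunctor D C) (F : linmonfunctor C D) : Prop :=
  exists e : forall A : ob C, G (F A) = A,
  forall (A B : ob C) (f : hom A B),
    cast_hom (e A) (e B) (fhom G (F A) (F B) (fhom F A B f)) = f.

Definition isomorphic (k : comNzRingType) (C D : linmoncat k) : Prop :=
  exists (F : linmonfunctor C D) (G : linmonfunctor D C),
    is_left_inverse G F /\ is_left_inverse F G.

Record signature := Signature {
  gob : eqType;
  gmor : Type;
  gsrc : gmor -> seq gob;
  gtgt : gmor -> seq gob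
}.

Declare Scope expr_scope.
Delimit Scope expr_scope with E.
Reserved Notation "f ⊚ g" (at level 50, left associativity).
Reserved Notation "f ⊗ g" (at level 40, left associativity).

(* Expressions are not typed intrinsically, so that relations between them need
   no transport along equalities of words; typing is the boolean [wf]. *)
Inductive expr (k : Type) (S : signature) : Type :=
| Gen of gmor S
| Id of seq (gob S)
| Comp of expr k S & expr k S
| Tens of expr k S & expr k S
| Zero of seq (gob S) & seq (gob S)
| Add of expr k S & expr k S
| Scale of k & expr k S.
Arguments Gen {k S} g.
Arguments Id {k S} A.
Arguments Zero {k S} A B.
Bind Scope expr_scope with expr.
Notation "f ⊚ g" := (Comp f g) : expr_scope.
Notation "f ⊗ g" := (Tens f g) : expr_scope.

HB.instance Definition _ (k : Type) (S : signature) := gen_eqMixin (expr k S).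
HB.instance Definition _ (k : Type) (S : signature) := gen_choiceMixin (expr k S).

Section Typing.
Variables (k : Type) (S : signature).
Implicit Types t : expr k S.

Fixpoint src t : seq (gob S) :=
  match t with
  | Gen g => gsrc g
  | Id A => A
  | Comp _ g => src g
  | Tens f g => src f ++ src g
  | Zero A _ => A
  | Add f _ => src f
  | Scale _ f => src f
  end.

Fixpoint tgt t : seq (gob S) :=
  match t with
  | Gen g => gtgt g
  | Id A => A
  | Comp f _ => tgt f
  | Tens f g => tgt f ++ tgt g
  | Zero _ B => B
  | Add f _ => tgt f
  | Scale _ f => tgt f
  end.

Fixpoint wf t : bool :=
  match t with
  | Comp f g => [&& wf f, wf g & src f == tgt g]
  | Tens f g => wf f && wf g
  | Add f g => [&& wf f, wf g, src f == src g & tgt f == tgt g]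
  | Scale _ f => wf f
  | _ => true
  end.

Definition oftype (A B : seq (gob S)) t : bool :=
  [&& wf t, src t == A & tgt t == B].

Definition parallel t t' : Prop := [/\ wf t = wf t', src t = src t' & tgt t = tgt t'].
End Typing.

Record presentation (k : Type) := Presentation {
  psig :> signature;
  prel : expr k psig -> expr k psig -> Prop;
  prel_wf : forall t t', prel t t' -> wf t /\ parallel t t'
}.

Section Congruence.
Variables (k : comNzRingType) (P : presentation k).
Local Notation expr := (expr k P).
Local Open Scope expr_scope.

(* The congruence generated by the relations of P and by the axioms of strict
   k-linear monoidal categories.  Each rule preserves source, target and [wf]
   (in both directions), which is the only purpose of the side conditions. *)
Inductive eqm : expr -> expr -> Prop :=
| eqm_rel t t' : prel t t' -> eqm t t'
| eqm_refl t : eqm t t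
| eqm_sym t t' : eqm t t' -> eqm t' t
| eqm_trans t t' t'' : eqm t t' -> eqm t' t'' -> eqm t t''
| eqm_Comp f f' g g' : eqm f f' -> eqm g g' -> eqm (f ⊚ g) (f' ⊚ g')
| eqm_Tens f f' g g' : eqm f f' -> eqm g g' -> eqm (f ⊗ g) (f' ⊗ g')
| eqm_Add f f' g g' : eqm f f' -> eqm g g' -> eqm (Add f g) (Add f' g')
| eqm_Scale a f f' : eqm f f' -> eqm (Scale a f) (Scale a f')
| eqm_compA f g h : eqm (f ⊚ (g ⊚ h)) (f ⊚ g ⊚ h)
| eqm_comp1m f : eqm (Id (tgt f) ⊚ f) f
| eqm_compm1 f : eqm (f ⊚ Id (src f)) f
| eqm_tensA f g h : eqm (f ⊗ (g ⊗ h)) (f ⊗ g ⊗ h)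
| eqm_tens1m f : eqm (Id [::] ⊗ f) f
| eqm_tensm1 f : eqm (f ⊗ Id [::]) f
| eqm_tens_id A B : eqm (Id A ⊗ Id B) (Id (A ++ B))
| eqm_interchange f g f' g' : src f = tgt g -> src f' = tgt g' ->
    eqm ((f ⊚ g) ⊗ (f' ⊚ g')) ((f ⊗ f') ⊚ (g ⊗ g'))
| eqm_addA f g h : eqm (Add f (Add g h)) (Add (Add f g) h)
| eqm_addC f g : src f = src g -> tgt f = tgt g -> eqm (Add f g) (Add g f)
| eqm_add0 f : eqm (Add (Zero (src f) (tgt f)) f) f
| eqm_scaleA a b f : eqm (Scale a (Scale b f)) (Scale (a * b) f)
| eqm_scale1 f : eqm (Scale 1 f) f
| eqm_scale0 f : wf f -> eqm (Scale 0 f) (Zero (src f) (tgt f))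
| eqm_scaleDl a b f : eqm (Scale (a + b) f) (Add (Scale a f) (Scale b f))
| eqm_scaleDr a f g : eqm (Scale a (Add f g)) (Add (Scale a f) (Scale a g))
| eqm_compDl f f' g : eqm (Add f f' ⊚ g) (Add (f ⊚ g) (f' ⊚ g))
| eqm_compDr f g g' : eqm (f ⊚ Add g g') (Add (f ⊚ g) (f ⊚ g'))
| eqm_compZl a f g : eqm (Scale a f ⊚ g) (Scale a (f ⊚ g))
| eqm_compZr a f g : eqm (f ⊚ Scale a g) (Scale a (f ⊚ g))
| eqm_tensDl f f' g : eqm (Add f f' ⊗ g) (Add (f ⊗ g) (f' ⊗ g))
| eqm_tensDr f g g' : eqm (f ⊗ Add g g') (Add (f ⊗ g) (f ⊗ g'))
| eqm_tensZl a f g : eqm (Scale a f ⊗ g) (Scale a (f ⊗ g))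
| eqm_tensZr a f g : eqm (f ⊗ Scale a g) (Scale a (f ⊗ g)).

#[global] Instance eqm_equivalence : Equivalence eqm.
Proof. split; [exact: eqm_refl | exact: eqm_sym | exact: eqm_trans]. Qed.
#[global] Instance Comp_proper : Proper (eqm ==> eqm ==> eqm) (@Comp k P).
Proof. by move=> f f' ff' g g' gg'; apply: eqm_Comp. Qed.
#[global] Instance Tens_proper : Proper (eqm ==> eqm ==> eqm) (@Tens k P).
Proof. by move=> f f' ff' g g' gg'; apply: eqm_Tens. Qed.
#[global] Instance Add_proper : Proper (eqm ==> eqm ==> eqm) (@Add k P).
Proof. by move=> f f' ff' g g' gg'; apply: eqm_Add. Qed.
#[global] Instance Scale_proper a : Proper (eqm ==> eqm) (@Scale k P a).
Proof. by move=> f f' ff'; apply: eqm_Scale. Qed.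

Lemma eqm_parallel t t' : eqm t t' -> parallel t t'.
Proof.
elim=> {t t'}.
- by move=> t t' /prel_wf[_].
- by [].
- by move=> t t' _ [? ? ?]; split.
- by move=> f g h _ [wf_ sf tf] _ [wg sg tg]; split; rewrite ?wf_ ?sf ?tf.
- by move=> f f' g g' _ [wf_ sf tf] _ [wg sg tg]; split => //=; rewrite wf_ wg sf tg.
- by move=> f f' g g' _ [wf_ sf tf] _ [wg sg tg]; split => /=; rewrite ?wf_ ?wg ?sf ?sg ?tf ?tg.
- by move=> f f' g g' _ [wf_ sf tf] _ [wg sg tg]; split => //=; rewrite wf_ wg sf sg tf tg.
- by move=> a f f' _ [wf_ sf tf]; split.
- by move=> f g h; split => //=; rewrite -!andbA; do !bool_congr.
- by move=> f; split => //=; rewrite eqxx andbT.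
- by move=> f; split => //=; rewrite eqxx andbT.
- by move=> f g h; split => /=; rewrite ?andbA ?catA.
- by move=> f; split.
- by move=> f; split => /=; rewrite ?cats0 ?andbT.
- by move=> A B; split.
- move=> f g f' g' fg f'g'; split => //=.
  by rewrite fg f'g' !eqxx !andbT -!andbA; do !bool_congr.
- move=> f g h; split => //=.
  case: (wf f) (wf g) (wf h) => [] [] [] //=; rewrite ?andbF //.
  case: (src f =P src g) => [->|] /=; last by rewrite ?andbF.
  case: (tgt f =P tgt g) => [->|] /=; last by rewrite ?andbF.
  by rewrite !andbT.
- by move=> f g sfg tfg; split => //=; rewrite sfg tfg !eqxx andbCA.
- by move=> f; split => //=; rewrite !eqxx !andbT.
- by [].
- by [].
- by move=> f wff; split.
- by move=> a b f; split => //=; rewrite !eqxx; case: (wf f).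
- by move=> a f g; split.
- move=> f f' g; split => //=; rewrite eqxx /=.
  case: (src f =P tgt g) => [->|_]; last by rewrite ?andbF.
  rewrite (eq_sym (tgt g)).
  by case: (wf f) (wf f') (wf g) (src f' == _) => [] [] [] [] //=; rewrite ?andbF ?andbT.
- move=> f g g'; split => //=; rewrite eqxx.
  case: (src f =P tgt g) => [->|_]; last by rewrite ?andbF.
  by case: (wf f) (wf g) (wf g') (src g == _) (tgt g == _) => [] [] [] [] [].
- by [].
- by [].
- move=> f f' g; split => //=.
  have catr (u v : seq (gob P)) w : (u ++ w == v ++ w) = (u == v).
    by apply/eqP/eqP => [/(congr1 rev)|-> //]; rewrite !rev_cat => /eqP;
      rewrite eqseq_cat // eqxx /= => /eqP/(congr1 rev); rewrite !revK.
  by rewrite !catr; case: (wf f) (wf f') (wf g) => [] [] []; rewrite ?andbF ?andbT.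
- move=> f g g'; split => //=; rewrite !eqseq_cat // !eqxx /=.
  by case: (wf f) (wf g) (wf g') => [] [] [].
- by [].
- by [].
Qed.

End Congruence.

Section PresentedCategory.
Variables (k : comNzRingType) (P : presentation k).
Local Notation word := (seq (gob P)).
Local Notation expr := (expr k P).
Local Notation eqm := (@eqm k P).
Local Open Scope expr_scope.

Definition texpr (A B : word) := {t : expr | oftype A B t}.

Definition eqmb A B : rel (texpr A B) := fun t t' => `[< eqm (val t) (val t') >].

Lemma eqmb_refl A B : reflexive (@eqmb A B).
Proof. by move=> t; apply/asboolP/eqm_refl. Qed.
Lemma eqmb_sym A B : symmetric (@eqmb A B).
Proof. by move=> t t'; apply/asboolP/asboolP; apply: eqm_sym. Qed.
Lemma eqmb_trans A B : transitive (@eqmb A B).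
Proof. by move=> t t' t'' /asboolP e /asboolP e'; apply/asboolP; rewrite e. Qed.

Canonical eqmb_equiv A B : equiv_rel (texpr A B) :=
  EquivRel (@eqmb A B) (@eqmb_refl A B) (@eqmb_sym A B) (@eqmb_trans A B).

Definition phom (A B : word) := {eq_quot (eqmb_equiv A B)}.
HB.instance Definition _ A B := Choice.on (phom A B).

Definition cls A B t (tP : oftype A B t) : phom A B := \pi_(phom A B) (Sub t tP : texpr A B).
Definition ex A B (f : phom A B) : expr := val (repr f : texpr A B).

Lemma exP A B (f : phom A B) : oftype A B (ex f).
Proof. exact: valP. Qed.
Lemma clsK A B t (tP : oftype A B t) : eqm (ex (cls tP)) t.
Proof.
have : repr (cls tP) = (Sub t tP : texpr A B) %[mod phom A B] by rewrite reprK.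
by move/eqmodP/asboolP.
Qed.
Lemma ex_eqm A B (f g : phom A B) : eqm (ex f) (ex g) -> f = g.
Proof. by move=> e; rewrite -[f]reprK -[g]reprK; apply/eqmodP/asboolP. Qed.
Lemma cls_eqm A B t t' (tP : oftype A B t) (t'P : oftype A B t') :
  cls tP = cls t'P <-> eqm t t'.
Proof.
split=> [e|e]; first by rewrite -(clsK tP) e clsK; reflexivity.
by apply: ex_eqm; rewrite !clsK.
Qed.

Lemma wf_ex A B (f : phom A B) : wf (ex f).
Proof. by case/and3P: (exP f). Qed.
Lemma src_ex A B (f : phom A B) : src (ex f) = A.
Proof. by case/and3P: (exP f) => _ /eqP. Qed.
Lemma tgt_ex A B (f : phom A B) : tgt (ex f) = B.
Proof. by case/and3P: (exP f) => _ _ /eqP. Qed.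

Lemma oftype_Id A : oftype A A (Id A : expr).
Proof. by rewrite /oftype /= !eqxx. Qed.
Lemma oftype_Zero A B : oftype A B (Zero A B : expr).
Proof. by rewrite /oftype /= !eqxx. Qed.
Lemma oftype_Comp A B C (f : phom B C) (g : phom A B) : oftype A C (ex f ⊚ ex g).
Proof. by rewrite /oftype /= !wf_ex src_ex src_ex !tgt_ex !eqxx. Qed.
Lemma oftype_Tens A B C D (f : phom A B) (g : phom C D) :
  oftype (A ++ C) (B ++ D) (ex f ⊗ ex g).
Proof. by rewrite /oftype /= !wf_ex !src_ex !tgt_ex !eqxx. Qed.
Lemma oftype_Add A B (f g : phom A B) : oftype A B (Add (ex f) (ex g)).
Proof. by rewrite /oftype /= !wf_ex !src_ex !tgt_ex !eqxx. Qed.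
Lemma oftype_Scale a A B (f : phom A B) : oftype A B (Scale a (ex f)).
Proof. by rewrite /oftype /= !wf_ex !src_ex !tgt_ex !eqxx. Qed.

Definition phom_id A : phom A A := cls (oftype_Id A).
Definition phom_zero A B : phom A B := cls (oftype_Zero A B).
Definition phom_comp A B C (f : phom B C) (g : phom A B) : phom A C :=
  cls (oftype_Comp f g).
Definition phom_tens A B C D (f : phom A B) (g : phom C D) : phom (A ++ C) (B ++ D) :=
  cls (oftype_Tens f g).
Definition phom_add A B (f g : phom A B) : phom A B := cls (oftype_Add f g).
Definition phom_scale a A B (f : phom A B) : phom A B := cls (oftype_Scale a f).

Section Lmodule.
Variables A B : word.
Implicit Types f g h : phom A B.

Fact phom_addA : associative (@phom_add A B).
Proof. by move=> f g h; apply: ex_eqm; rewrite !clsK; apply: eqm_addA. Qed.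
Fact phom_addC : commutative (@phom_add A B).
Proof.
move=> f g; apply: ex_eqm; rewrite !clsK.
by apply: eqm_addC; rewrite ?src_ex ?tgt_ex.
Qed.
Fact phom_add0 : left_id (phom_zero A B) (@phom_add A B).
Proof.
move=> f; apply: ex_eqm; rewrite !clsK.
by have := eqm_add0 (ex f); rewrite src_ex tgt_ex.
Qed.
Fact phom_addN : left_inverse (phom_zero A B) (@phom_scale (-1) A B) (@phom_add A B).
Proof.
move=> f; apply: ex_eqm; rewrite !clsK -{2}(eqm_scale1 (ex f)) -eqm_scaleDl addNr.
by have := eqm_scale0 (wf_ex f); rewrite src_ex tgt_ex.
Qed.
HB.instance Definition _ :=
  GRing.isZmodule.Build (phom A B) phom_addA phom_addC phom_add0 phom_addN.

Fact phom_scaleA a b f : phom_scale a (phom_scale b f) = phom_scale (a * b) f.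
Proof. by apply: ex_eqm; rewrite !clsK; apply: eqm_scaleA. Qed.
Fact phom_scale1 : left_id 1 (fun a => @phom_scale a A B).
Proof. by move=> f; apply: ex_eqm; rewrite !clsK; apply: eqm_scale1. Qed.
Fact phom_scaleDr : right_distributive (fun a => @phom_scale a A B) +%R.
Proof. by move=> a f g; apply: ex_eqm; rewrite !clsK; apply: eqm_scaleDr. Qed.
Fact phom_scaleDl f : {morph (fun a => phom_scale a f) : a b / a + b}.
Proof. by move=> a b; apply: ex_eqm; rewrite !clsK; apply: eqm_scaleDl. Qed.
HB.instance Definition _ := GRing.Zmodule_isLmodule.Build k (phom A B)
  phom_scaleA phom_scale1 phom_scaleDr phom_scaleDl.
End Lmodule.

Lemma ex_add A B (f g : phom A B) : eqm (ex (f + g)) (Add (ex f) (ex g)).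
Proof. exact: clsK. Qed.
Lemma ex_scale A B a (f : phom A B) : eqm (ex (a *: f)) (Scale a (ex f)).
Proof. exact: clsK. Qed.
Lemma ex_transport A A' B B' (eA : A = A') (eB : B = B') (f : phom A B) :
  ex (transport2 (H := phom) eA eB f) = ex f.
Proof. by case: _ / eA; case: _ / eB. Qed.

Fact phom_compA A B C D (f : phom C D) (g : phom B C) (h : phom A B) :
  phom_comp f (phom_comp g h) = phom_comp (phom_comp f g) h.
Proof. by apply: ex_eqm; rewrite !clsK; apply: eqm_compA. Qed.
Fact phom_comp1m A B (f : phom A B) : phom_comp (phom_id B) f = f.
Proof. by apply: ex_eqm; rewrite !clsK -{1}(tgt_ex f); apply: eqm_comp1m. Qed.
Fact phom_compm1 A B (f : phom A B) : phom_comp f (phom_id A) = f.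
Proof. by apply: ex_eqm; rewrite !clsK -{2}(src_ex f); apply: eqm_compm1. Qed.
Fact phom_comp_linl A B C (g : phom A B) : linear (fun f : phom B C => phom_comp f g).
Proof.
by move=> a f f'; apply: ex_eqm; rewrite !(clsK, ex_add, ex_scale) eqm_compDl eqm_compZl; reflexivity.
Qed.
Fact phom_comp_linr A B C (f : phom B C) : linear (fun g : phom A B => phom_comp f g).
Proof.
by move=> a g g'; apply: ex_eqm; rewrite !(clsK, ex_add, ex_scale) eqm_compDr eqm_compZr; reflexivity.
Qed.
Fact phom_tens_linl A B C D (g : phom C D) : linear (fun f : phom A B => phom_tens f g).
Proof.
by move=> a f f'; apply: ex_eqm; rewrite !(clsK, ex_add, ex_scale) eqm_tensDl eqm_tensZl; reflexivity.
Qed.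
Fact phom_tens_linr A B C D (f : phom A B) : linear (fun g : phom C D => phom_tens f g).
Proof.
by move=> a g g'; apply: ex_eqm; rewrite !(clsK, ex_add, ex_scale) eqm_tensDr eqm_tensZr; reflexivity.
Qed.
Fact phom_tens_id A B : phom_tens (phom_id A) (phom_id B) = phom_id (A ++ B).
Proof. by apply: ex_eqm; rewrite !clsK; apply: eqm_tens_id. Qed.
Fact phom_tens_comp A B C A' B' C' (f : phom B C) (g : phom A B)
    (f' : phom B' C') (g' : phom A' B') :
  phom_tens (phom_comp f g) (phom_comp f' g') = phom_comp (phom_tens f f') (phom_tens g g').
Proof.
apply: ex_eqm; rewrite !clsK.
by apply: eqm_interchange; rewrite src_ex tgt_ex.
Qed.
Fact phom_tensA A B C A' B' C' (f : phom A A') (g : phom B B') (h : phom C C') :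
  transport2 (H := phom) (catA A B C) (catA A' B' C') (phom_tens f (phom_tens g h))
  = phom_tens (phom_tens f g) h.
Proof. by apply: ex_eqm; rewrite ex_transport !clsK; apply: eqm_tensA. Qed.
Fact phom_tens1m A B (f : phom A B) :
  transport2 (H := phom) (cat0s A) (cat0s B) (phom_tens (phom_id [::]) f) = f.
Proof. by apply: ex_eqm; rewrite ex_transport !clsK; apply: eqm_tens1m. Qed.
Fact phom_tensm1 A B (f : phom A B) :
  transport2 (H := phom) (cats0 A) (cats0 B) (phom_tens f (phom_id [::])) = f.
Proof. by apply: ex_eqm; rewrite ex_transport !clsK; apply: eqm_tensm1. Qed.

Definition presented : linmoncat k := @LinMonCat k word (fun A B => phom A B)
  phom_id phom_comp [::] cat phom_tens (@catA _) (@cat0s _) (@cats0 _)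
  phom_compA phom_comp1m phom_compm1 phom_comp_linl phom_comp_linr
  phom_tens_linl phom_tens_linr phom_tens_id phom_tens_comp
  phom_tensA phom_tens1m phom_tensm1.

End PresentedCategory.

Section QuantumNumbers.
Variables (k : fieldType) (q : k).
Definition qint (n : nat) : k := (q ^+ n - q ^- n) / (q - q^-1).
Definition qfact (a : nat) : k := \prod_(1 <= i < a.+1) qint i.
Definition qbinom (n a : nat) : k := (\prod_(i < a) qint (n - i)) / qfact a.
End QuantumNumbers.

Definition thickness := {a : nat | (0 < a)%N}.
Definition thick (a' : nat) : thickness := exist _ a'.+1 isT.

(* U is the type of labels of red strands; for U = void the words over [obj U]
   are exactly the words in black strands. *)
Inductive obj (U : Type) := Black of thickness | Red of U.
Arguments Black {U} a.
Arguments Red {U} u.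

Definition sum_of_obj U (x : obj U) : thickness + U :=
  match x with Black a => inl a | Red u => inr u end.
Definition obj_of_sum U (x : thickness + U) : obj U :=
  match x with inl a => Black a | inr u => Red u end.
Lemma sum_of_objK U : cancel (@sum_of_obj U) (@obj_of_sum U).
Proof. by case. Qed.
HB.instance Definition _ (U : eqType) :=
  Equality.copy (obj U) (can_type (@sum_of_objK U)).

(* Strands of thickness 0 are deleted. *)
Definition strand (U : Type) (a : nat) : seq (obj U) :=
  if a is a'.+1 then [:: Black (thick a')] else [::].
Arguments strand {U} a.

(* D indexes the dot generators, so that all thicknesses (D = thickness) and
   thickness 1 only (D = unit) can be treated together. GCrossV and GDotV are the formal inverses of
   GCross and GDot. *)
Inductive gen (U D : Type) : Type :=
| GMerge (a b : thickness)
| GSplit (a b : thickness)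
| GCross (a b : thickness)
| GCrossV (a b : thickness)
| GDot (d : D)
| GDotV (d : D)
| GUp (a : thickness) (u : U)
| GDown (u : U) (a : thickness).
Arguments GMerge {U D} a b.
Arguments GSplit {U D} a b.
Arguments GCross {U D} a b.
Arguments GCrossV {U D} a b.
Arguments GDot {U D} d.
Arguments GDotV {U D} d.
Arguments GUp {U D} a u.
Arguments GDown {U D} u a.

Section WebSignature.
Variables (U : eqType) (D : Type) (dth : D -> thickness).

Definition web_src (g : gen U D) : seq (obj U) :=
  match g with
  | GMerge a b => [:: Black a; Black b]
  | GSplit a b => strand (val a + val b)
  | GCross a b => [:: Black a; Black b]
  | GCrossV a b => [:: Black b; Black a]
  | GDot d | GDotV d => [:: Black (dth d)]
  | GUp a u => [:: Black a; Red u]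
  | GDown u a => [:: Red u; Black a]
  end.

Definition web_tgt (g : gen U D) : seq (obj U) :=
  match g with
  | GMerge a b => strand (val a + val b)
  | GSplit a b => [:: Black a; Black b]
  | GCross a b => [:: Black b; Black a]
  | GCrossV a b => [:: Black a; Black b]
  | GDot d | GDotV d => [:: Black (dth d)]
  | GUp a u => [:: Red u; Black a]
  | GDown u a => [:: Black a; Red u]
  end.

Definition web_sig : signature := Signature web_src web_tgt.
End WebSignature.

(* The generating morphisms for arbitrary thicknesses in nat, being identities
   when a thickness is 0. *)
Section Diagrams.
Variables (k : fieldType) (U : eqType) (D : Type) (dth : D -> thickness).
Local Notation expr := (expr k (web_sig U dth)).
Implicit Types a b : nat.

Definition idb a : expr := @Id k (web_sig U dth) (strand a).
Definition idr (u : U) : expr := @Id k (web_sig U dth) [:: Red u].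

Definition merge a b : expr :=
  match a, b with
  | a'.+1, b'.+1 => @Gen k (web_sig U dth) (GMerge (thick a') (thick b'))
  | _, _ => idb (a + b)
  end.
Definition split a b : expr :=
  match a, b with
  | a'.+1, b'.+1 => @Gen k (web_sig U dth) (GSplit (thick a') (thick b'))
  | _, _ => idb (a + b)
  end.
Definition cross a b : expr :=
  match a, b with
  | a'.+1, b'.+1 => @Gen k (web_sig U dth) (GCross (thick a') (thick b'))
  | _, _ => idb (a + b)
  end.
Definition crossV a b : expr :=
  match a, b with
  | a'.+1, b'.+1 => @Gen k (web_sig U dth) (GCrossV (thick a') (thick b'))
  | _, _ => idb (a + b)
  end.
Definition up a (u : U) : expr :=
  if a is a'.+1 then @Gen k (web_sig U dth) (GUp (thick a') u) else idr u.
Definition down (u : U) a : expr :=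
  if a is a'.+1 then @Gen k (web_sig U dth) (GDown u (thick a')) else idr u.

(* the iterated merge and split between a and 1^a *)
Fixpoint merge1s a : expr :=
  if a is a'.+1 then Comp (merge a' 1) (Tens (merge1s a') (idb 1)) else idb 0.
Fixpoint split1s a : expr :=
  if a is a'.+1 then Comp (Tens (split1s a') (idb 1)) (split a' 1) else idb 0.

Fixpoint tens_pow (f : expr) (n : nat) : expr :=
  if n is n'.+1 then Tens (tens_pow f n') f else idb 0.

Lemma wf_merge a b : wf (merge a b). Proof. by case: a b => [|a] []. Qed.
Lemma src_merge a b : src (merge a b) = strand a ++ strand b.
Proof. by case: a b => [|a] [|b] //=; rewrite addn0. Qed.
Lemma tgt_merge a b : tgt (merge a b) = strand (a + b).
Proof. by case: a b => [|a] []. Qed.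
Lemma wf_split a b : wf (split a b). Proof. by case: a b => [|a] []. Qed.
Lemma src_split a b : src (split a b) = strand (a + b).
Proof. by case: a b => [|a] []. Qed.
Lemma tgt_split a b : tgt (split a b) = strand a ++ strand b.
Proof. by case: a b => [|a] [|b] //=; rewrite addn0. Qed.
Lemma wf_cross a b : wf (cross a b). Proof. by case: a b => [|a] []. Qed.
Lemma src_cross a b : src (cross a b) = strand a ++ strand b.
Proof. by case: a b => [|a] [|b] //=; rewrite addn0. Qed.
Lemma tgt_cross a b : tgt (cross a b) = strand b ++ strand a.
Proof. by case: a b => [|a] [|b] //=; rewrite addn0. Qed.
Lemma wf_crossV a b : wf (crossV a b). Proof. by case: a b => [|a] []. Qed.
Lemma src_crossV a b : src (crossV a b) = strand b ++ strand a.
Proof. by case: a b => [|a] [|b] //=; rewrite addn0. Qed.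
Lemma tgt_crossV a b : tgt (crossV a b) = strand a ++ strand b.
Proof. by case: a b => [|a] [|b] //=; rewrite addn0. Qed.
Lemma wf_up a u : wf (up a u). Proof. by case: a. Qed.
Lemma src_up a u : src (up a u) = strand a ++ [:: Red u]. Proof. by case: a. Qed.
Lemma tgt_up a u : tgt (up a u) = [:: Red u] ++ strand a. Proof. by case: a. Qed.
Lemma wf_down u a : wf (down u a). Proof. by case: a. Qed.
Lemma src_down u a : src (down u a) = [:: Red u] ++ strand a. Proof. by case: a. Qed.
Lemma tgt_down u a : tgt (down u a) = strand a ++ [:: Red u]. Proof. by case: a. Qed.

Definition diagE := (wf_merge, src_merge, tgt_merge, wf_split, src_split, tgt_split,
  (wf_cross, src_cross, tgt_cross, wf_crossV, src_crossV, tgt_crossV),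
  (wf_up, src_up, tgt_up, wf_down, src_down, tgt_down)).

Fixpoint ones n : seq (gob (web_sig U dth)) :=
  if n is n'.+1 then ones n' ++ strand 1 else [::].

Lemma oftype_merge1s a : oftype (ones a) (@strand U a : seq (gob (web_sig U dth))) (merge1s a).
Proof.
elim: a => [|a /and3P[w /eqP s /eqP t]] //; rewrite /oftype /= !diagE w s t.
by rewrite addn1 !eqxx.
Qed.
Lemma oftype_split1s a : oftype (@strand U a : seq (gob (web_sig U dth))) (ones a) (split1s a).
Proof.
elim: a => [|a /and3P[w /eqP s /eqP t]] //; rewrite /oftype /= !diagE w s t.
by rewrite addn1 !eqxx.
Qed.
Lemma oftype_tens_pow f a : oftype (@strand U 1 : seq (gob (web_sig U dth)))
  (@strand U 1 : seq (gob (web_sig U dth))) f -> oftype (ones a) (ones a) (tens_pow f a).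
Proof.
case/and3P=> wf_ /eqP sf /eqP tf.
elim: a => [|a /and3P[w /eqP s /eqP t]]; rewrite /oftype //=.
by rewrite w s t wf_ sf tf !eqxx.
Qed.
Lemma oftype_Comp3 (A B C E : seq (gob (web_sig U dth))) (f g h : expr) :
  oftype C E f -> oftype B C g -> oftype A B h -> oftype A E (Comp (Comp f g) h).
Proof.
case/and3P=> wf_ /eqP sf /eqP tf; case/and3P=> wg /eqP sg /eqP tg.
by case/and3P=> wh /eqP sh /eqP th; rewrite /oftype /= wf_ wg wh sf tf sg tg sh th !eqxx.
Qed.

Lemma oftype_big (A B : seq (gob (web_sig U dth))) I (r : seq I) (p : pred I) (F : I -> expr) :
    (forall i, p i -> oftype A B (F i)) ->
  oftype A B (\big[@Add k _/Zero A B]_(i <- r | p i) F i).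
Proof.
move=> FP; elim/big_rec: _ => [|i t pi /and3P[wt /eqP st /eqP tt]].
  by rewrite /oftype /= !eqxx.
have /and3P[wF /eqP sF /eqP tF] := FP i pi.
by rewrite /oftype /= wt wF st tt sF tF !eqxx.
Qed.

Lemma oftype_parallel (A B : seq (gob (web_sig U dth))) (t t' : expr) : oftype A B t -> oftype A B t' ->
  wf t /\ parallel t t'.
Proof.
by case/and3P=> w /eqP s /eqP e; case/and3P=> w' /eqP s' /eqP e'; split=> //; split; congruence.
Qed.
End Diagrams.

Arguments idb {k U D dth} a.
Arguments idr {k U D dth} u.
Arguments merge {k U D dth} a b.
Arguments split {k U D dth} a b.
Arguments cross {k U D dth} a b.
Arguments crossV {k U D dth} a b.
Arguments up {k U D dth} a u.
Arguments down {k U D dth} u a.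
Arguments merge1s {k U D dth} a.
Arguments split1s {k U D dth} a.

Section Relations.
Variables (k : fieldType) (q : k) (U : eqType) (coef : U -> k).
Local Open Scope expr_scope.

Section Common.
Variables (D : Type) (dth : D -> thickness).
Local Notation expr := (expr k (web_sig U dth)).
Local Notation gen g := (@Gen k (web_sig U dth) g).
Local Notation ezero A B := (@Zero k (web_sig U dth) A B).
Local Notation red u := [:: Red u].

Inductive common_rel : expr -> expr -> Prop :=
| rel_crossVr a b : (0 < a)%N -> (0 < b)%N ->
    common_rel (cross a b ⊚ crossV a b) (idb b ⊗ idb a)
| rel_crossVl a b : (0 < a)%N -> (0 < b)%N ->
    common_rel (crossV a b ⊚ cross a b) (idb a ⊗ idb b)
| rel_dotVr d :
    common_rel (gen (GDot d) ⊚ gen (GDotV d)) (idb (val (dth d)))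
| rel_dotVl d :
    common_rel (gen (GDotV d) ⊚ gen (GDot d)) (idb (val (dth d)))
| rel_W1m a b c : (0 < a)%N -> (0 < b)%N -> (0 < c)%N ->
    common_rel (merge (a + b) c ⊚ (merge a b ⊗ idb c))
               (merge a (b + c) ⊚ (idb a ⊗ merge b c))
| rel_W1s a b c : (0 < a)%N -> (0 < b)%N -> (0 < c)%N ->
    common_rel ((split a b ⊗ idb c) ⊚ split (a + b) c)
               ((idb a ⊗ split b c) ⊚ split a (b + c))
| rel_W2 a b c d : (0 < a)%N -> (0 < b)%N -> (0 < c)%N -> (0 < d)%N ->
    (a + c = b + d)%N ->
    common_rel (split b d ⊚ merge a c)
      (* t + a == s + d stands for t - s = d - a in the integers *)
      (\big[@Add _ _/ezero (strand a ++ strand c) (strand b ++ strand d)]_(s < (minn a b).+1)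
       \big[@Add _ _/ezero (strand a ++ strand c) (strand b ++ strand d)]_(t < (minn c d).+1
                                                              | (t + a == s + d)%N)
         Scale (q ^+ (s * t))
           ((merge s (b - s) ⊗ merge (a - s) t)
            ⊚ (idb s ⊗ cross (a - s) (c - t) ⊗ idb t)
            ⊚ (split s (a - s) ⊗ split (c - t) t)))
| rel_W3 a b : (0 < a)%N -> (0 < b)%N ->
    common_rel (merge a b ⊚ split a b) (Scale (qbinom q (a + b) a) (idb (a + b)))
| rel_S1rs a b u : (0 < a)%N -> (0 < b)%N ->
    common_rel ((idr u ⊗ split b a) ⊚ up (a + b) u)
               ((up b u ⊗ idb a) ⊚ (idb b ⊗ up a u) ⊚ (split b a ⊗ idr u))
| rel_S1ls a b u : (0 < a)%N -> (0 < b)%N ->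
    common_rel ((split a b ⊗ idr u) ⊚ down u (a + b))
               ((idb a ⊗ down u b) ⊚ (down u a ⊗ idb b) ⊚ (idr u ⊗ split a b))
| rel_S1lm a b u : (0 < a)%N -> (0 < b)%N ->
    common_rel (down u (a + b) ⊚ (idr u ⊗ merge a b))
               ((merge a b ⊗ idr u) ⊚ (idb a ⊗ down u b) ⊚ (down u a ⊗ idb b))
| rel_S1rm a b u : (0 < a)%N -> (0 < b)%N ->
    common_rel (up (a + b) u ⊚ (merge a b ⊗ idr u))
               ((idr u ⊗ merge a b) ⊚ (up a u ⊗ idb b) ⊚ (idb a ⊗ up b u)).

Lemma strand_val (a : thickness) : strand (val a) = [:: Black a] :> seq (obj U).
Proof. by case: a => -[] // a p; congr [:: Black _]; apply: val_inj. Qed.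

Ltac strands := rewrite -?catA /=; repeat first [done | lia | f_equal].
Ltac typing := rewrite /oftype /= ?diagE /= ?strand_val ?andbT;
  repeat match goal with
    | |- is_true (andb _ _) => apply/andP; constructor end; apply/eqP; strands.

Lemma common_rel_wf t t' : common_rel t t' -> wf t /\ parallel t t'.
Proof.
case=> {t t'}.
- by move=> a b _ _; apply: (@oftype_parallel _ _ _ _ (strand b ++ strand a) (strand b ++ strand a)); typing.
- by move=> a b _ _; apply: (@oftype_parallel _ _ _ _ (strand a ++ strand b) (strand a ++ strand b)); typing.
- by move=> d; apply: (@oftype_parallel _ _ _ _ (strand (val (dth d))) (strand (val (dth d)))); typing.
- by move=> d; apply: (@oftype_parallel _ _ _ _ (strand (val (dth d))) (strand (val (dth d)))); typing.
- move=> a b c _ _ _.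
  by apply: (@oftype_parallel _ _ _ _ (strand a ++ strand b ++ strand c) (strand (a + b + c))); typing.
- move=> a b c _ _ _.
  by apply: (@oftype_parallel _ _ _ _ (strand (a + b + c)) (strand a ++ strand b ++ strand c)); typing.
- move=> a b c d _ _ _ _ e.
  apply: (@oftype_parallel _ _ _ _ (strand a ++ strand c) (strand b ++ strand d)); first typing.
  apply: oftype_big => s _; apply: oftype_big => t ts.
  have := ltn_ord s; have := ltn_ord t; move: ts e.
  move: (nat_of_ord s) (nat_of_ord t) => {}s {}t /eqP st e tl sl.
  typing.
- by move=> a b _ _; apply: (@oftype_parallel _ _ _ _ (strand (a + b)) (strand (a + b))); typing.
- move=> a b u _ _.
  by apply: (@oftype_parallel _ _ _ _ (strand (a + b) ++ red u) (red u ++ strand b ++ strand a)); typing.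
- move=> a b u _ _.
  by apply: (@oftype_parallel _ _ _ _ (red u ++ strand (a + b)) (strand a ++ strand b ++ red u)); typing.
- move=> a b u _ _.
  by apply: (@oftype_parallel _ _ _ _ (red u ++ strand a ++ strand b) (strand (a + b) ++ red u)); typing.
- move=> a b u _ _.
  by apply: (@oftype_parallel _ _ _ _ (strand a ++ strand b ++ red u) (red u ++ strand (a + b))); typing.
Qed.
End Common.

Ltac strands := rewrite -?catA /=; repeat first [done | lia | f_equal].
Ltac typing := rewrite /oftype /= ?diagE /= ?strand_val ?andbT;
  repeat match goal with
    | |- is_true (andb _ _) => apply/andP; constructor end; apply/eqP; strands.

Section Full.
Local Notation S := (web_sig U (@id thickness)).
Local Notation expr := (expr k S).
Local Notation ezero A B := (@Zero k S A B).
Local Notation red u := [:: Red u].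

Definition dot (a : nat) : expr :=
  if a is a'.+1 then @Gen k S (GDot (thick a')) else idb 0.
Definition dotV (a : nat) : expr :=
  if a is a'.+1 then @Gen k S (GDotV (thick a')) else idb 0.

Definition omega (a r : nat) : expr :=
  merge r (a - r) ⊚ (dot r ⊗ idb (a - r)) ⊚ split r (a - r).

Definition S3_middle (a b s : nat) (u : U) : expr :=
  (idb (b - s) ⊗ up (a - s) u) ⊚ (cross (a - s) (b - s) ⊗ idr u)
  ⊚ (idb (a - s) ⊗ down u (b - s)).

Inductive full_rel : expr -> expr -> Prop :=
| full_common t t' : common_rel t t' -> full_rel t t'
| full_W4l a b : (0 < a)%N -> (0 < b)%N ->
    full_rel (cross a b ⊚ (dot a ⊗ idb b)) ((idb b ⊗ dot a) ⊚ crossV b a)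
| full_W4r a b : (0 < a)%N -> (0 < b)%N ->
    full_rel ((dot b ⊗ idb a) ⊚ cross a b) (crossV b a ⊚ (idb a ⊗ dot b))
| full_W5s a b : (0 < a)%N -> (0 < b)%N ->
    full_rel (split a b ⊚ dot (a + b)) ((dot a ⊗ dot b) ⊚ split a b)
| full_W5m a b : (0 < a)%N -> (0 < b)%N ->
    full_rel (dot (a + b) ⊚ merge a b) (merge a b ⊚ (dot a ⊗ dot b))
| full_W6 a : (0 < a)%N ->
    full_rel (merge1s a ⊚ tens_pow (dot 1) a ⊚ split1s a) (Scale (qfact q a) (dot a))
| full_W6V a : (0 < a)%N ->
    full_rel (merge1s a ⊚ tens_pow (dotV 1) a ⊚ split1s a) (Scale (qfact q a) (dotV a))
| full_S2l a u : (0 < a)%N ->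
    full_rel (down u a ⊚ up a u)
      (\big[@Add _ _/ezero (strand a ++ red u) (strand a ++ red u)]_(t < a.+1)
         Scale ((-1) ^+ t * q ^- (t * (a - t)) * coef u ^+ t) (omega a (a - t) ⊗ idr u))
| full_S2r a u : (0 < a)%N ->
    full_rel (up a u ⊚ down u a)
      (\big[@Add _ _/ezero (red u ++ strand a) (red u ++ strand a)]_(t < a.+1)
         Scale ((-1) ^+ t * q ^- (t * (a - t)) * coef u ^+ t) (idr u ⊗ omega a (a - t)))
| full_S3 a b u : (0 < a)%N -> (0 < b)%N ->
    full_rel ((down u b ⊗ idb a) ⊚ (idr u ⊗ cross a b) ⊚ (up a u ⊗ idb b))
      (\big[@Add _ _/ezero (strand a ++ red u ++ strand b) (strand b ++ red u ++ strand a)]_(s <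
                                                                      (minn a b).+1)
         Scale ((-1) ^+ s * q ^+ (s * s.-1)./2 * (q^-1 - q) ^+ s * qfact q s)
           ((merge s (b - s) ⊗ idr u ⊗ merge (a - s) s)
            ⊚ (idb s ⊗ S3_middle a b s u ⊗ dot s)
            ⊚ (split s (a - s) ⊗ idr u ⊗ split (b - s) s))).


Lemma dotE a : ((wf (dot a) = true) * (src (dot a) = strand a) * (tgt (dot a) = strand a))
  * ((wf (dotV a) = true) * (src (dotV a) = strand a) * (tgt (dotV a) = strand a)).
Proof. by case: a. Qed.

Lemma full_rel_wf t t' : full_rel t t' -> wf t /\ parallel t t'.
Proof.
case=> {t t'}.
- exact: common_rel_wf.
- move=> a b _ _.
  by apply: (@oftype_parallel _ _ _ _ (strand a ++ strand b) (strand b ++ strand a));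
    rewrite /oftype /= ?dotE; typing.
- move=> a b _ _.
  by apply: (@oftype_parallel _ _ _ _ (strand a ++ strand b) (strand b ++ strand a));
    rewrite /oftype /= ?dotE; typing.
- move=> a b _ _.
  by apply: (@oftype_parallel _ _ _ _ (strand (a + b)) (strand a ++ strand b));
    rewrite /oftype /= ?dotE; typing.
- move=> a b _ _.
  by apply: (@oftype_parallel _ _ _ _ (strand a ++ strand b) (strand (a + b)));
    rewrite /oftype /= ?dotE; typing.
- move=> a _; apply: (@oftype_parallel _ _ _ _ (strand a) (strand a)).
    apply: oftype_Comp3; [exact: oftype_merge1s | | exact: oftype_split1s].
    by apply: oftype_tens_pow.
  by rewrite /oftype /= ?dotE !eqxx.
- move=> a _; apply: (@oftype_parallel _ _ _ _ (strand a) (strand a)).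
    apply: oftype_Comp3; [exact: oftype_merge1s | | exact: oftype_split1s].
    by apply: oftype_tens_pow.
  by rewrite /oftype /= ?dotE !eqxx.
- move=> a u _; apply: (@oftype_parallel _ _ _ _ (strand a ++ red u) (strand a ++ red u)).
    by typing.
  apply: oftype_big => t _; have := ltn_ord t; move: (nat_of_ord t) => {}t lt.
  by rewrite /oftype /= ?dotE; typing.
- move=> a u _; apply: (@oftype_parallel _ _ _ _ (red u ++ strand a) (red u ++ strand a)).
    by typing.
  apply: oftype_big => t _; have := ltn_ord t; move: (nat_of_ord t) => {}t lt.
  by rewrite /oftype /= ?dotE; typing.
- move=> a b u _ _; apply: (@oftype_parallel _ _ _ _
    (strand a ++ red u ++ strand b) (strand b ++ red u ++ strand a)).
    by typing.
  apply: oftype_big => s _; have := ltn_ord s; move: (nat_of_ord s) => {}s ls.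
  by rewrite /oftype /= ?dotE; typing.
Qed.
End Full.

Section Reduced.
Local Notation S := (web_sig U (fun _ : unit => thick 0)).
Local Notation expr := (expr k S).

Definition dot1 : expr := @Gen k S (GDot tt).

Inductive reduced_rel : expr -> expr -> Prop :=
| reduced_common t t' : common_rel t t' -> reduced_rel t t'
| reduced_W4l :
    reduced_rel (cross 1 1 ⊚ (dot1 ⊗ idb 1)) ((idb 1 ⊗ dot1) ⊚ crossV 1 1)
| reduced_W4r :
    reduced_rel ((dot1 ⊗ idb 1) ⊚ cross 1 1) (crossV 1 1 ⊚ (idb 1 ⊗ dot1))
| reduced_S2l u :
    reduced_rel (down u 1 ⊚ up 1 u)
      (Add (dot1 ⊗ idr u) (Scale (- coef u) (idb 1 ⊗ idr u)))
| reduced_S2r u :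
    reduced_rel (up 1 u ⊚ down u 1)
      (Add (idr u ⊗ dot1) (Scale (- coef u) (idr u ⊗ idb 1)))
| reduced_S3 u :
    reduced_rel ((down u 1 ⊗ idb 1) ⊚ (idr u ⊗ cross 1 1) ⊚ (up 1 u ⊗ idb 1))
      (Add ((idb 1 ⊗ up 1 u) ⊚ (cross 1 1 ⊗ idr u) ⊚ (idb 1 ⊗ down u 1))
           (Scale (- (q^-1 - q)) (idb 1 ⊗ idr u ⊗ dot1))).

Lemma reduced_rel_wf t t' : reduced_rel t t' -> wf t /\ parallel t t'.
Proof.
by case=> {t t'} [? ? /common_rel_wf // | | | u | u | u]; rewrite /parallel /= !eqxx.
Qed.
End Reduced.

Definition schur_presentation := Presentation full_rel_wf.
Definition schur_presentation' := Presentation reduced_rel_wf.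
End Relations.

(* With U = void there are no traverses, and the relations that involve a red
   strand are vacuous: what is left are the generators and relations of the web
   categories. *)
Definition Web (k : fieldType) (q : k) : linmoncat k :=
  presented (schur_presentation q (of_void k)).
Definition Web' (k : fieldType) (q : k) : linmoncat k :=
  presented (schur_presentation' q (of_void k)).
Definition Schur (k : fieldType) (q : k) : linmoncat k :=
  presented (schur_presentation q (@id k)).
Definition Schur' (k : fieldType) (q : k) : linmoncat k :=
  presented (schur_presentation' q (@id k)).

Definition Cq (R : realType) : fieldType := {fraction {poly R[i]}}.
Definition qvar (R : realType) : Cq R := tofrac 'X.

(* Main.v *)
(* Over C(q) the quantum integers are invertible, so by W3 a merge n (x) 1 -> n+1 composed with
   the split back is an invertible scalar.  Every thick strand is thereby a direct summand of
   thin ones, and W6 can be solved for the thick dots: this defines them in the reduced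
   categories.  What has to be derived there are the relations for thick strands.  W2 first
   yields that crossings slide through merges and splits, and that these absorb crossings up
   to powers of q; after that each relation is proved by induction on a thickness, by composing
   with a merge n (x) 1 -> n+1, which is an epimorphism. *)

(* The two presentations differ only in their dots, so both functors are the identity on objects and
   fix every other generator; that they are mutually inverse has to be checked on dots alone, where
   it is W6 divided by [n]!. The type of red labels stays a parameter, which makes the two
   isomorphisms one argument. W2 controls the slides because the term s = t = 0 of its expansion of
   s_{c,a} m_{a,c} is the crossing itself, while all other terms contain smaller crossings.
   Reversing composition or the tensor product then turns one slide into the others. The obstacle in
   the relations with dots is that a dot changes the sign of each crossing it passes, whereas W2
   speaks of positive crossings only. For S2 this is harmless: crossings are absorbed by
   neighbouring merges and splits at the cost of powers of q. For S3 a negative crossing survives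
   and is traded for a positive one by a skein relation with one thick strand. The coefficients of
   S2 and S3 then match by [m+n] = q^n [m] + q^-m [n] and (q - q^-1)[n] + q^-n = q^n. *)
From HB Require Import structures.
From Stdlib Require Import Setoid Morphisms.
From mathcomp Require Import all_boot all_algebra.
From mathcomp Require Import generic_quotient fraction complex zify ring.
From mathcomp Require Import boolp reals.
Require Import Defs.
Set Implicit Arguments.
Unset Strict Implicit.
Unset Printing Implicit Defensive.
Import GRing.Theory.
Local Open Scope ring_scope.

(** * Coherence for strict monoidal categories *)

Declare Scope calc_scope.
Delimit Scope calc_scope with calc.

(* Diagrams as elements of one untyped carrier [car], [ty f A B] telling that f is a
   morphism from A to B: equalities between objects never have to be transported along.
   Only parallel diagrams can be added, so the linear structure lives on the typed sets
   of morphisms [ho A B], where [br A B] sends the diagrams of type (A, B); [st a] is the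
   strand of thickness a. *)
Record calc (k : fieldType) := Calc {
  cob : Type;
  mul : cob -> cob -> cob;
  one : cob;
  mulA : forall A B C, mul A (mul B C) = mul (mul A B) C;
  mul1o : forall A, mul one A = A;
  mulo1 : forall A, mul A one = A;
  st : nat -> cob;
  st0 : st 0 = one;
  car : Type;
  ho : cob -> cob -> lmodType k;
  ty : car -> cob -> cob -> Prop;
  cid : cob -> car;
  cmp : car -> car -> car;
  tns : car -> car -> car;
  br : forall A B, car -> ho A B;
  ty_id : forall A, ty (cid A) A A;
  ty_cmp : forall f g A B C, ty f B C -> ty g A B -> ty (cmp f g) A C;
  ty_tns : forall f g A B C D, ty f A B -> ty g C D -> ty (tns f g) (mul A C) (mul B D);
  br_inj : forall f g A B, ty f A B -> ty g A B -> br A B f = br A B g -> f = g;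
  cmpA : forall f g h, cmp f (cmp g h) = cmp (cmp f g) h;
  cmp1c : forall f A B, ty f A B -> cmp (cid B) f = f;
  cmpc1 : forall f A B, ty f A B -> cmp f (cid A) = f;
  tnsA : forall f g h, tns f (tns g h) = tns (tns f g) h;
  tns1c : forall f, tns (cid one) f = f;
  tnsc1 : forall f, tns f (cid one) = f;
  tns_id : forall A B, tns (cid A) (cid B) = cid (mul A B);
  interchange : forall f g f' g' A B C A' B' C',
    ty f B C -> ty g A B -> ty f' B' C' -> ty g' A' B' ->
    tns (cmp f g) (cmp f' g') = cmp (tns f f') (tns g g');
  lin_cmpl : forall A B C g, ty g A B ->
    exists phi : {linear ho B C -> ho A C},
      forall f, ty f B C -> phi (br B C f) = br A C (cmp f g);
  lin_cmpr : forall A B C f, ty f B C ->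
    exists phi : {linear ho A B -> ho A C},
      forall g, ty g A B -> phi (br A B g) = br A C (cmp f g);
  lin_tnsl : forall A B W, exists phi : {linear ho A B -> ho (mul W A) (mul W B)},
    forall f, ty f A B -> phi (br A B f) = br _ _ (tns (cid W) f);
  lin_tnsr : forall A B W, exists phi : {linear ho A B -> ho (mul A W) (mul B W)},
    forall f, ty f A B -> phi (br A B f) = br _ _ (tns f (cid W))
}.
Arguments one {k c}.
Arguments st {k c} n.
Arguments mul {k c} A B.
Arguments ty {k c} f A B.
Arguments cid {k c} A.
Arguments cmp {k c} f g.
Arguments tns {k c} f g.
Arguments br {k c} A B f.

Bind Scope calc_scope with car.
Notation "f ⊚ g" := (cmp f g) : calc_scope.
Notation "f ⊗ g" := (tns f g) : calc_scope.
Notation "A ⋅ B" := (mul A B) (at level 39, left associativity) : calc_scope.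
Local Open Scope calc_scope.

(** The opposite category. What is proved for every calculus holds here too, so each fact about
    merges has a twin about splits. *)
Definition vflip (k : fieldType) (M : calc k) : calc k := @Calc k (cob M) mul one
  (@mulA _ M) (@mul1o _ M) (@mulo1 _ M) st (@st0 _ M) (car M) (fun A B => ho B A)
  (fun f A B => ty f B A) cid (fun f g => cmp g f) tns (fun A B => br B A)
  (@ty_id _ M) (fun f g A B C F G => ty_cmp G F) (fun f g A B C D => @ty_tns _ M f g _ _ _ _)
  (fun f g A B => @br_inj _ M f g B A) (fun f g h => esym (cmpA h g f))
  (fun f A B => @cmpc1 _ M f B A) (fun f A B => @cmp1c _ M f B A)
  (@tnsA _ M) (@tns1c _ M) (@tnsc1 _ M) (@tns_id _ M)
  (fun f g f' g' A B C A' B' C' F G F' G' => interchange G F G' F')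
  (fun A B C g => @lin_cmpr _ M C B A g) (fun A B C f => @lin_cmpl _ M C B A f)
  (fun A B => @lin_tnsl _ M B A) (fun A B => @lin_tnsr _ M B A).

(** Reversal of the tensor product: facts proved here are mirror images, left and right exchanged,
    of facts in [M]. *)
Definition hflip (k : fieldType) (M : calc k) : calc k := @Calc k (cob M) (fun A B => mul B A) one
  (fun A B C => esym (mulA C B A)) (@mulo1 _ M) (@mul1o _ M) st (@st0 _ M) (car M) (@ho _ M)
  ty cid cmp (fun f g => tns g f) br
  (@ty_id _ M) (@ty_cmp _ M) (fun f g A B C D F G => ty_tns G F)
  (@br_inj _ M) (@cmpA _ M) (@cmp1c _ M) (@cmpc1 _ M)
  (fun f g h => esym (tnsA h g f)) (@tnsc1 _ M) (@tns1c _ M) (fun A B => @tns_id _ M B A)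
  (fun f g f' g' A B C A' B' C' F G F' G' => interchange F' G' F G)
  (@lin_cmpl _ M) (@lin_cmpr _ M) (@lin_tnsr _ M) (@lin_tnsl _ M).

(* Equality of diagrams up to the axioms of strict monoidal categories and arithmetic in
   the thicknesses is decided by reflection: a diagram is turned into a list of layers,
   which are then sorted by the interchange law. *)
Class typed (k : fieldType) (M : calc k) (f : car M) (A B : cob M) := typedP : ty f A B.

Inductive nexp := NVar of nat | NAdd of nexp & nexp | NSucc of nexp | NZero.
Inductive oexp := OStrand of nexp | OVar of nat | OMul of oexp & oexp | OOne.
Inductive diagram :=
  Leaf of nat | DId of oexp | DComp of diagram & diagram | DTens of diagram & diagram.

(** [inl] is a strand whose thickness is a list of summands, kept sorted to absorb commutativity of
    addition; [inr] is an opaque object. *)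
Definition atom := (seq nat + nat)%type.
Definition oword := seq atom.

Section Coherence.
Variables (k : fieldType) (M : calc k) (V : seq nat) (E : seq (cob M)).

Fixpoint evalN e := match e with
  NVar i => nth 0%N V i | NAdd a b => (evalN a + evalN b)%N | NSucc a => (evalN a).+1 | NZero =>
    0%N end.
Fixpoint evalO e : cob M := match e with
  OStrand n => st (evalN n) | OVar i => nth one E i | OMul A B => evalO A ⋅ evalO B | OOne =>
    one end.

(* In flattened sums the index 0 stands for the constant 1. *)
Fixpoint flatN e : seq nat := match e with
  NVar i => [:: i.+1] | NAdd a b => flatN a ++ flatN b | NSucc a => 0%N :: flatN a | NZero =>
    [::] end.
(** An empty list of summands is thickness 0, and such a strand is deleted. *)
Fixpoint flatO e : oword := match e with
  | OStrand n => let v := sort leq (flatN n) in if v is [::] then [::] else [:: inl v]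
  | OVar i => [:: inr i] | OMul A B => flatO A ++ flatO B | OOne => [::] end.

Definition atom_of (a : atom) : cob M :=
  match a with inl v => st (sumn (map (nth 0%N (1%N :: V)) v)) | inr i => nth one E i end.
Definition word_of (w : oword) : cob M := foldr (fun a A => atom_of a ⋅ A) one w.

Lemma word_of_cat u v : word_of (u ++ v) = word_of u ⋅ word_of v.
Proof. by elim: u => [|i u IH] /=; rewrite ?mul1o // IH mulA. Qed.

Lemma flatNP e : sumn (map (nth 0%N (1%N :: V)) (flatN e)) = evalN e.
Proof.
by elim: e => [i|a IHa b IHb|a /= ->|] //=; rewrite ?addn0 // map_cat sumn_cat IHa IHb.
Qed.

Lemma flatOP e : word_of (flatO e) = evalO e.
Proof.
elim: e => [n|i|A IHA B IHB|] //=; rewrite ?mulo1 // ?word_of_cat ?IHA ?IHB //.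
have e : sumn (map (nth 0%N (1%N :: V)) (sort leq (flatN n))) = evalN n.
  rewrite -flatNP; apply: perm_sumn; apply: perm_map.
  by rewrite perm_sort.
case: (sort leq (flatN n)) e => [|i v] /= e; first by rewrite -e st0.
by rewrite mulo1 -e.
Qed.

Lemma same_obj (A B : oexp) : (flatO A == flatO B) = true -> evalO A = evalO B.
Proof. by move=> /eqP e; rewrite -!flatOP e. Qed.

Variables (G : seq (car M)) (T : seq (oexp * oexp * nat)).

Definition leaf i : car M := nth (cid one) G i.
Definition entry i := nth (OOne, OOne, i) T i.
Definition lsrc i := flatO (entry i).1.1.
Definition ltgt i := flatO (entry i).1.2.

Fixpoint evalD t : car M :=
  match t with
  | Leaf i => leaf i
  | DId A => cid (evalO A)
  | DComp f g => evalD f ⊚ evalD g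
  | DTens f g => evalD f ⊗ evalD g
  end.

(* The last component of an entry is the index of an equal leaf of the same type. *)
Fixpoint table_ok (G' : seq (car M)) (T' : seq (oexp * oexp * nat)) : Prop :=
  match G', T' with
  | f :: G', (s, t, j) :: T' => [/\ ty f (evalO s) (evalO t), f = leaf j & table_ok G' T']
  | [::], [::] => True
  | _, _ => False
  end.

Hypothesis GT : table_ok G T.

(** Indices beyond the table are harmless: they read as the identity of the unit object and are
    their own alias. *)
Lemma leafP i :
  ty (leaf i) (word_of (lsrc i)) (word_of (ltgt i)) /\ leaf i = leaf (entry i).2.
Proof.
rewrite /lsrc /ltgt !flatOP {1 2}/leaf /entry.
have: (i < size G)%N -> let e := nth (OOne, OOne, i) T i in
    ty (nth (cid one) G i) (evalO e.1.1) (evalO e.1.2) /\ nth (cid one) G i = leaf e.2.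
  move: (OOne, OOne, i) => d.
  elim: (G) (T) GT i => [|f G' IH] [|[[s t] l] T'] //= [fP fl okT] [|i] //=.
  exact: IH.
have sGT : size G = size T.
  elim: (G) (T) GT => [|f G' IH] [|[[s t] l] T'] //= [_ _ /IH].
  by move=> ->.
case: (ltnP i (size G)) => [_ /(_ isT)|le _] //=.
rewrite /leaf !(nth_default _ le) (nth_default _ (_ : size T <= i)%N) -?sGT //=.
by rewrite nth_default //; split; [exact: ty_id | ].
Qed.
Fixpoint dsrc t := match t with
  | Leaf i => lsrc i | DId A => flatO A | DComp _ g => dsrc g | DTens f g => dsrc f ++ dsrc g end.
Fixpoint dtgt t := match t with
  | Leaf i => ltgt i | DId A => flatO A | DComp f _ => dtgt f | DTens f g => dtgt f ++ dtgt g end.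
(** [layers] replaces each leaf by its alias, so the two must have the same flattened source and
    target; hence the test at a leaf. *)
Fixpoint dwf t := match t with
  | Leaf i => (lsrc (entry i).2 == lsrc i) && (ltgt (entry i).2 == ltgt i)
  | DId _ => true
  | DComp f g => [&& dwf f, dwf g & dsrc f == dtgt g]
  | DTens f g => dwf f && dwf g
  end.

Lemma leaf_ty i : ty (leaf i) (word_of (lsrc i)) (word_of (ltgt i)).
Proof. by have [] := leafP i. Qed.

Lemma evalD_ty t : dwf t -> ty (evalD t) (word_of (dsrc t)) (word_of (dtgt t)).
Proof.
elim: t => [i _|A _|f IHf g IHg /= /and3P[/IHf F /IHg + /eqP e]|f IHf g IHg /= /andP[/IHf F /IHg
  H]].
- exact: leaf_ty.
- by rewrite /= flatOP; apply: ty_id.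
- by rewrite -e; apply: ty_cmp.
- by rewrite !word_of_cat; apply: ty_tns.
Qed.

(* A layer (u, i, v) is the leaf i between the identities of u and v; a list of
   layers is a composite, its head on top. *)
Definition layer := (oword * nat * oword)%type.
Definition evalL (l : layer) : car M := cid (word_of l.1.1) ⊗ leaf l.1.2 ⊗ cid (word_of l.2).
Definition lsrcL (l : layer) := l.1.1 ++ lsrc l.1.2 ++ l.2.
Definition ltgtL (l : layer) := l.1.1 ++ ltgt l.1.2 ++ l.2.

Lemma evalL_ty l : ty (evalL l) (word_of (lsrcL l)) (word_of (ltgtL l)).
Proof.
by rewrite !word_of_cat !mulA; apply: ty_tns (ty_id _); apply: ty_tns (ty_id _) (leaf_ty _).
Qed.

Fixpoint evalS w (ls : seq layer) : car M :=
  if ls is l :: ls' then evalL l ⊚ evalS w ls' else cid (word_of w).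
Definition top w (ls : seq layer) := if ls is l :: _ then ltgtL l else w.
Fixpoint stack w (ls : seq layer) :=
  if ls is l :: ls' then (lsrcL l == top w ls') && stack w ls' else true.

Lemma evalS_ty w ls : stack w ls -> ty (evalS w ls) (word_of w) (word_of (top w ls)).
Proof.
elim: ls => [_|l ls IH /= /andP[/eqP e /IH {}IH]]; first exact: ty_id.
by apply: ty_cmp IH; rewrite -e; apply: evalL_ty.
Qed.

Definition whisker u v (l : layer) : layer := (u ++ l.1.1, l.1.2, l.2 ++ v).

Fixpoint layers t : seq layer := match t with
  | Leaf i => [:: ([::], (entry i).2, [::])]
  | DId A => [::]
  | DComp f g => layers f ++ layers g
  | DTens f g => map (whisker [::] (dtgt g)) (layers f) ++ map (whisker (dsrc f) [::]) (layers g)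
  end.

Lemma evalS_cat w ls ls' : stack w ls' -> stack (top w ls') ls ->
  [/\ evalS w (ls ++ ls') = evalS (top w ls') ls ⊚ evalS w ls',
      stack w (ls ++ ls') & top w (ls ++ ls') = top (top w ls') ls].
Proof.
move=> s'; elim: ls => [_|l ls IH /= /andP[/eqP e /IH[-> -> ->]]].
  by rewrite /= (cmp1c (evalS_ty s')).
by rewrite cmpA e eqxx.
Qed.

Lemma whisker_comp A B f g X Y Z : ty f Y Z -> ty g X Y ->
  cid A ⊗ (f ⊚ g) ⊗ cid B = (cid A ⊗ f ⊗ cid B) ⊚ (cid A ⊗ g ⊗ cid B) :> car M.
Proof.
move=> F H; have [tA tB] := (ty_id A, ty_id B).
rewrite -(interchange (ty_tns tA F) (ty_tns tA H) tB tB) -(interchange tA tA F H).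
by rewrite (cmp1c tA) (cmp1c tB).
Qed.

Lemma evalL_whisker u v l :
  evalL (whisker u v l) = cid (word_of u) ⊗ evalL l ⊗ cid (word_of v).
Proof. by rewrite /evalL /= !word_of_cat -!tns_id !tnsA. Qed.

Lemma evalS_whisker u v w ls : stack w ls ->
  [/\ evalS (u ++ w ++ v) (map (whisker u v) ls)
        = cid (word_of u) ⊗ evalS w ls ⊗ cid (word_of v),
      stack (u ++ w ++ v) (map (whisker u v) ls) &
      top (u ++ w ++ v) (map (whisker u v) ls) = u ++ top w ls ++ v].
Proof.
elim: ls => [_|l ls IH /= /andP[/eqP e sls]].
  by rewrite /= !word_of_cat -!tns_id tnsA.
have [-> -> ->] := IH sls; split; last by rewrite /ltgtL /= -!catA.
  have L := evalL_ty l; have S := evalS_ty sls; rewrite -e in S.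
  by rewrite evalL_whisker (whisker_comp _ _ L S).
by rewrite -e /lsrcL /= !catA eqxx.
Qed.

(** A tensor product becomes a stack through f ⊗ g = (f ⊗ 1)(1 ⊗ g), with the layers of f on top. *)
Lemma layersP t : dwf t -> [/\ evalD t = evalS (dsrc t) (layers t),
  stack (dsrc t) (layers t) & top (dsrc t) (layers t) = dtgt t].
Proof.
elim: t => [i|A _|f IHf g IHg|f IHf g IHg] /=.
- have [L e] := leafP i; case/andP=> /eqP es /eqP et.
  rewrite /evalL /lsrcL /ltgtL /= !cats0 es et eqxx /= tns1c tnsc1 -e.
  by rewrite (cmpc1 L).
- by rewrite flatOP.
- case/and3P=> /IHf[-> sf tf] /IHg[-> sg tg] /eqP e.
  have := @evalS_cat (dsrc g) (layers f) (layers g) sg.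
  by rewrite tg -e => /(_ sf)[-> -> ->].
- case/andP=> wf_ wg; have [-> sf tf] := IHf wf_; have [-> sg tg] := IHg wg.
  have [ef {}sf tf'] := evalS_whisker [::] (dtgt g) sf.
  have [eg {}sg tg'] := evalS_whisker (dsrc f) [::] sg.
  move: ef sf tf' eg sg tg'; rewrite !cats0 !cat0s tg tf => ef sf tf' eg sg tg'.
  have := evalS_cat sg; rewrite tg' => /(_ _ sf)[-> -> ->]; split=> //.
  rewrite ef eg /= tns1c tnsc1.
  have [F G'] := (evalD_ty wf_, evalD_ty wg); move: F G'.
  have [-> _ _] := IHf wf_; have [-> _ _] := IHg wg => F G'.
  by rewrite -(interchange F (ty_id _) (ty_id _) G') (cmpc1 F) (cmp1c G').
Qed.

(** The interchange law in one direction only: the lower layer [h] rises above [g] when it acts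
    entirely to the right of it, and [x] is the word between the two leaves. *)
Definition swap (g h : layer) : option (layer * layer) :=
  let: (u, i, v) := g in let: (u', j, v') := h in
  let x := drop (size u + size (lsrc i))%N u' in
  if (u' == u ++ lsrc i ++ x) && (v == x ++ ltgt j ++ v')
  then Some ((u ++ ltgt i ++ x, j, v'), (u, i, x ++ lsrc j ++ v')) else None.

Lemma swapP g h h' g' : swap g h = Some (h', g') ->
  [/\ evalL g ⊚ evalL h = evalL h' ⊚ evalL g', lsrcL g' = lsrcL h, lsrcL h' = ltgtL g'
    & ltgtL h' = ltgtL g].
Proof.
case: g h => [[u i] v] [[u' j] v'] /=; set x := drop _ _.
case: ifP => // /andP[/eqP -> /eqP ->] [<- <-].
split; rewrite /lsrcL /ltgtL /= -?catA //.
rewrite /evalL /= !word_of_cat -!tns_id.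
have [Li Lj] := (leaf_ty i, leaf_ty j).
set U := cid (word_of u); set X := cid (word_of x); set W := cid (word_of v').
have tU : ty U _ _ := ty_id _; have tX : ty X _ _ := ty_id _; have tW : ty W _ _ := ty_id _.
transitivity (U ⊗ leaf i ⊗ X ⊗ leaf j ⊗ W).
  rewrite !tnsA.
  rewrite -(interchange (ty_tns (ty_tns (ty_tns tU Li) tX) (ty_id _))
    (ty_tns (ty_tns (ty_tns tU (ty_id _)) tX) Lj) tW tW).
  rewrite -(interchange (ty_tns (ty_tns tU Li) tX) (ty_tns (ty_tns tU (ty_id _)) tX) (ty_id _) Lj).
  rewrite -(interchange (ty_tns tU Li) (ty_tns tU (ty_id _)) tX tX).
  rewrite -(interchange tU tU Li (ty_id _)).
  by rewrite (cmp1c tU) (cmp1c tX) (cmp1c tW) (cmpc1 Li) (cmp1c Lj).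
rewrite !tnsA.
rewrite -(interchange (ty_tns (ty_tns (ty_tns tU (ty_id _)) tX) Lj) (ty_tns (ty_tns (ty_tns tU Li)
  tX) (ty_id _)) tW tW).
rewrite -(interchange (ty_tns (ty_tns tU (ty_id _)) tX) (ty_tns (ty_tns tU Li) tX) Lj (ty_id _)).
rewrite -(interchange (ty_tns tU (ty_id _)) (ty_tns tU Li) tX tX).
rewrite -(interchange tU tU (ty_id _) Li).
by rewrite (cmp1c tU) (cmp1c tX) (cmp1c tW) (cmp1c Li) (cmpc1 Lj).
Qed.

Fixpoint insert (g : layer) ls :=
  if ls is h :: ls' then
    if swap g h is Some (h', g') then h' :: insert g' ls' else g :: ls
  else [:: g].
Definition nf ls := foldr insert [::] ls.

Lemma insertP w g ls : stack w ls -> lsrcL g = top w ls ->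
  [/\ evalS w (insert g ls) = evalL g ⊚ evalS w ls,
      stack w (insert g ls) & top w (insert g ls) = ltgtL g].
Proof.
elim: ls g => [|h ls IH] g /=; first by move=> _ ->; rewrite eqxx.
case/andP=> /eqP e sls gh; case E': (swap g h) => [[h' g']|] /=; last by rewrite gh e !eqxx.
have [e1 e2 e3 e4] := swapP E'.
have [-> -> ->] := IH g' sls (etrans e2 e); split=> //; last by rewrite e3 eqxx.
by rewrite !cmpA e1.
Qed.

Lemma nfP w ls : stack w ls ->
  [/\ evalS w (nf ls) = evalS w ls, stack w (nf ls) & top w (nf ls) = top w ls].
Proof.
elim: ls => [|l ls IH] //= /andP[/eqP e /IH[e1 e2 e3]].
by rewrite -e3 in e; have [-> -> ->] := insertP e2 e; rewrite e1.
Qed.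

Definition same_diagram t t' :=
  [&& dwf t, dwf t', dsrc t == dsrc t' & nf (layers t) == nf (layers t')].

Lemma same_diagramP t t' : same_diagram t t' -> evalD t = evalD t'.
Proof.
case/and4P=> /layersP[-> s _] /layersP[-> s' _] /eqP e /eqP e'.
by have [<- _ _] := nfP s; have [<- _ _] := nfP s'; rewrite e e'.
Qed.

Definition has_type t (A B : oexp) := [&& dwf t, dsrc t == flatO A & dtgt t == flatO B].

Lemma has_typeP t A B : has_type t A B -> ty (evalD t) (evalO A) (evalO B).
Proof.
by case/and3P=> /evalD_ty tT /eqP eA /eqP eB; rewrite -!flatOP -eA -eB.
Qed.
End Coherence.

(** * Reification of diagrams *)

Ltac mon_add x l :=
  lazymatch l with
  | context [cons x _] => l
  | _ => let T := type of x in
    let rec go l := lazymatch l with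
      | nil => constr:(@cons T x nil) | cons ?y ?l' => let r := go l' in constr:(@cons T y r) end in
        go l
  end.
Ltac mon_index x l :=
  lazymatch l with
  | cons x _ => constr:(0%N)
  | cons _ ?l' => let n := mon_index x l' in constr:(S n)
  end.
Ltac mon_vars e V :=
  lazymatch e with
  | addn ?a ?b => let V := mon_vars a V in mon_vars b V
  | S ?a => mon_vars a V
  | O => V
  | _ => mon_add e V
  end.
(** Local abbreviations of objects are unfolded first; what cannot be unfolded becomes a variable.
    Matching on [tt] serves only to backtrack between the two. *)
Ltac mon_objs A V E :=
  lazymatch A with
  | mul ?B ?C => lazymatch mon_objs B V E with (?V, ?E) => mon_objs C V E end
  | one => constr:((V, E))
  | st ?e => let V := mon_vars e V in constr:((V, E))
  | _ => match constr:(tt) with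
    | _ => let B := eval unfold A in A in mon_objs B V E
    | _ => let E := mon_add A E in constr:((V, E)) end
  end.
Ltac mon_leaves t V E G :=
  lazymatch t with
  | cmp ?f ?g => lazymatch mon_leaves f V E G with (?V, ?E, ?G) => mon_leaves g V E G end
  | tns ?f ?g => lazymatch mon_leaves f V E G with (?V, ?E, ?G) => mon_leaves g V E G end
  | cid ?A => lazymatch mon_objs A V E with (?V, ?E) => constr:((V, E, G)) end
  | _ =>
    let p := constr:(@typedP _ _ t _ _ _) in
    lazymatch type of p with
    | ty _ ?A ?B => lazymatch mon_objs A V E with (?V, ?E) =>
        lazymatch mon_objs B V E with (?V, ?E) => let G := mon_add t G in constr:((V, E, G)) end end
    end
  end.
Ltac mon_qN e V :=
  lazymatch e with
  | addn ?a ?b => let a := mon_qN a V in let b := mon_qN b V in constr:(NAdd a b)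
  | S ?a => let a := mon_qN a V in constr:(NSucc a)
  | O => constr:(NZero)
  | _ => let i := mon_index e V in constr:(NVar i)
  end.
Ltac mon_qO A V E :=
  lazymatch A with
  | mul ?B ?C => let B := mon_qO B V E in let C := mon_qO C V E in constr:(OMul B C)
  | one => constr:(OOne)
  | st ?e => let e := mon_qN e V in constr:(OStrand e)
  | _ => match constr:(tt) with
    | _ => let B := eval unfold A in A in mon_qO B V E
    | _ => let i := mon_index A E in constr:(OVar i) end
  end.
Ltac mon_qD t V E G :=
  lazymatch t with
  | cmp ?f ?g => let f := mon_qD f V E G in let g := mon_qD g V E G in constr:(DComp f g)
  | tns ?f ?g => let f := mon_qD f V E G in let g := mon_qD g V E G in constr:(DTens f g)
  | cid ?A => let A := mon_qO A V E in constr:(DId A)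
  | _ => let i := mon_index t G in constr:(Leaf i)
  end.
(* The first leaf of G that equals x up to the arithmetic of its thicknesses. *)
Ltac mon_alias x G :=
  lazymatch G with
  | cons x _ => constr:((0%N, @erefl _ x))
  | cons ?y ?G' =>
    match constr:((x, y)) with
    | (?f ?a ?b, ?f ?c ?d) => let e := constr:(ltac:(f_equal; lia) : x = y) in constr:((0%N, e))
    | (?f ?a, ?f ?c) => let e := constr:(ltac:(f_equal; lia) : x = y) in constr:((0%N, e))
    | _ => lazymatch mon_alias x G' with (?i, ?e) => constr:((S i, e)) end
    end
  end.
Ltac mon_table L V E G :=
  lazymatch L with
  | nil => constr:((@nil (oexp * oexp * nat), I))
  | cons ?x ?L' =>
    lazymatch mon_table L' V E G with (?T, ?P) =>
    let p := constr:(@typedP _ _ x _ _ _) in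
    lazymatch type of p with
    | ty _ ?A ?B => let s := mon_qO A V E in let t := mon_qO B V E in
      lazymatch mon_alias x G with (?i, ?e) =>
        constr:((cons (s, t, i) T, And3 p e P)) end
    end end
  end.
Ltac mon :=
  lazymatch goal with
  | |- @eq (@car ?k ?M) ?x ?y =>
    lazymatch mon_leaves x (@nil nat) (@nil (@cob k M)) (@nil (@car k M)) with (?V, ?E, ?G) =>
    lazymatch mon_leaves y V E G with (?V, ?E, ?G) =>
    lazymatch mon_table G V E G with (?T, ?P) =>
    let t := mon_qD x V E G in let t' := mon_qD y V E G in
    let b := eval vm_compute in (dwf T t, dwf T t', same_diagram T t t') in
    lazymatch b with
    | (true, true, true) => exact (@same_diagramP k M V E G T P t t' (@erefl bool true <:
      same_diagram T t t' = true))
    | _ => fail 0 "mon: " b T t t'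
    end
    end end end
  end.

Ltac typ :=
  lazymatch goal with
  | |- @ty ?k ?M ?x ?A ?B =>
    lazymatch mon_leaves x (@nil nat) (@nil (@cob k M)) (@nil (@car k M)) with (?V, ?E, ?G) =>
    lazymatch mon_objs A V E with (?V, ?E) =>
    lazymatch mon_objs B V E with (?V, ?E) =>
    lazymatch mon_table G V E G with (?T, ?P) =>
    let t := mon_qD x V E G in let A := mon_qO A V E in let B := mon_qO B V E in
    exact (@has_typeP k M V E G T P t A B (@erefl bool true <: has_type T t A B = true))
    end end end end
  end.

Ltac obj :=
  lazymatch goal with
  | |- @eq (@cob ?k ?M) ?A ?B =>
    lazymatch mon_objs A (@nil nat) (@nil (@cob k M)) with (?V, ?E) =>
    lazymatch mon_objs B V E with (?V, ?E) =>
    let A := mon_qO A V E in let B := mon_qO B V E in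
    exact (@same_obj k M V E A B (@erefl bool true <: (flatO A == flatO B) = true))
    end end
  end.

(** * Webs *)

Lemma eq_sum_bij (I J : eqType) (W : zmodType) (r : seq I) (s : seq J)
    (h : I -> J) (h' : J -> I) (F : I -> W) (F' : J -> W) :
  uniq r -> uniq s -> {in r, forall i, h i \in s /\ h' (h i) = i} ->
  {in s, forall j, h' j \in r /\ h (h' j) = j} -> {in r, forall i, F i = F' (h i)} ->
  \sum_(i <- r) F i = \sum_(j <- s) F' j.
Proof.
move=> ur us hr hs FF'; rewrite big_seq (eq_bigr (fun i => F' (h i))) -?big_seq; last exact: FF'.
rewrite -(big_map h xpredT F'); apply/perm_big/uniq_perm => //.
  by rewrite map_inj_in_uniq // => i j /hr[_ {2}<-] /hr[_ {2}<-] ->.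
move=> j; apply/mapP/idP => [[i /hr[hi _] -> //]|/hs[h'j e]].
by exists (h' j).
Qed.

(* The matrices [[s, x], [y, t]] of natural numbers with row sums a, c and column sums b, d *)
Definition mats (a c b d : nat) : seq (nat * nat * nat * nat) :=
  [seq (i, a - i, b - i, i + d - a)%N | i <- iota 0 (minn a b).+1 & (a <= i + d)%N].

Lemma mem_mats a c b d s x y t : (a + c = b + d)%N ->
  ((s, x, y, t) \in mats a c b d) =
  [&& a == s + x, b == s + y, c == y + t & d == x + t]%N.
Proof.
move=> e; apply/mapP/and4P => [[j] | [/eqP e1 /eqP e2 /eqP e3 /eqP e4]].
  rewrite mem_filter mem_iota /= => /andP[j1 j2] [-> -> -> ->].
  by split; apply/eqP; lia.
exists s; first by rewrite mem_filter mem_iota; lia.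
by congr (_, _, _, _); lia.
Qed.

Lemma mats_uniq a c b d : uniq (mats a c b d).
Proof.
by rewrite map_inj_in_uniq ?filter_uniq ?iota_uniq // => i j _ _ [].
Qed.

Section Linear.
Variables (k : fieldType) (M : calc k).

(** Whiskering by [u] and [v] and composing with [f] and [g] are linear one at a time; this is what
    allows a linear relation to be applied inside a larger diagram. *)
Lemma lin_context (f g : car M) A B X Y (u v : cob M) :
  ty f (u ⋅ B ⋅ v) Y -> ty g X (u ⋅ A ⋅ v) ->
  exists phi : {linear ho A B -> ho X Y}, forall x, ty x A B ->
    phi (br A B x) = br X Y (f ⊚ (cid u ⊗ x ⊗ cid v) ⊚ g).
Proof.
move=> fT gT; have [p1 p1E] := lin_tnsl A B u; have [p2 p2E] := lin_tnsr (u ⋅ A) (u ⋅ B) v.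
have [p3 p3E] := lin_cmpr (u ⋅ A ⋅ v) fT; have [p4 p4E] := lin_cmpl Y gT.
exists (p4 \o (p3 \o (p2 \o p1))) => x xT /=.
have uxT : ty (cid u ⊗ x) (u ⋅ A) (u ⋅ B) by apply: ty_tns => //; apply: ty_id.
have uxvT : ty (cid u ⊗ x ⊗ cid v) (u ⋅ A ⋅ v) (u ⋅ B ⋅ v) by apply: ty_tns => //; apply: ty_id.
by rewrite p1E // p2E // p3E // p4E //; apply: ty_cmp uxvT.
Qed.

Lemma br_context (I : eqType) (r : seq I) (c : I -> k) (y : I -> car M)
    (x f g : car M) A B X Y (u v : cob M) :
  br A B x = \sum_(i <- r) c i *: br A B (y i) ->
  ty x A B -> {in r, forall i, ty (y i) A B} ->
  ty f (u ⋅ B ⋅ v) Y -> ty g X (u ⋅ A ⋅ v) ->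
  br X Y (f ⊚ (cid u ⊗ x ⊗ cid v) ⊚ g)
    = \sum_(i <- r) c i *: br X Y (f ⊚ (cid u ⊗ y i ⊗ cid v) ⊚ g).
Proof.
move=> e xT yT fT gT; have [phi phiE] := lin_context fT gT.
rewrite -phiE // e linear_sum /= big_seq [RHS]big_seq; apply: eq_bigr => i ir.
by rewrite linearZ phiE //; apply: yT.
Qed.
End Linear.

(** W1, W2 and the deletion of strands of thickness 0 suffice for the slides and are stable under
    both flips. Allowing thickness 0 lets the degenerate terms of W2 be treated like all others. *)
Record webs (k : fieldType) (q : k) (M : calc k) := Webs {
  mg : nat -> nat -> car M;
  sp : nat -> nat -> car M;
  cr : nat -> nat -> car M;
  mg_ty : forall a b, ty (mg a b) (st a ⋅ st b) (st (a + b));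
  sp_ty : forall a b, ty (sp a b) (st (a + b)) (st a ⋅ st b);
  cr_ty : forall a b, ty (cr a b) (st a ⋅ st b) (st b ⋅ st a);
  mg0n : forall b, mg 0 b = cid (st b);
  mgn0 : forall a, mg a 0 = cid (st a);
  sp0n : forall b, sp 0 b = cid (st b);
  spn0 : forall a, sp a 0 = cid (st a);
  cr0n : forall b, cr 0 b = cid (st b);
  crn0 : forall a, cr a 0 = cid (st a);
  mgA : forall a b c, mg (a + b) c ⊚ (mg a b ⊗ cid (st c)) = mg a (b + c) ⊚ (cid (st a) ⊗ mg b c);
  spA : forall a b c, (sp a b ⊗ cid (st c)) ⊚ sp (a + b) c = (cid (st a) ⊗ sp b c) ⊚ sp a (b + c);
  spmg : forall a c b d, (a + c = b + d)%N ->
    br (st a ⋅ st c) (st b ⋅ st d) (sp b d ⊚ mg a c)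
    = \sum_(i <- mats a c b d) q ^+ (i.1.1.1 * i.2) *: br (st a ⋅ st c) (st b ⋅ st d)
        (let: (s, x, y, t) := i in
         (mg s y ⊗ mg x t) ⊚ (cid (st s) ⊗ cr x y ⊗ cid (st t)) ⊚ (sp s x ⊗ sp y t))
}.

Definition ladder k q M (W : @webs k q M) (i : nat * nat * nat * nat) : car M :=
  let: (s, x, y, t) := i in
  (mg W s y ⊗ mg W x t) ⊚ (cid (st s) ⊗ cr W x y ⊗ cid (st t)) ⊚ (sp W s x ⊗ sp W y t).

Section Duals.
Variables (k : fieldType) (q : k) (M : calc k) (W : webs q M).

(** Flipping a ladder transposes its matrix, which keeps the product s t and hence the coefficients
    of W2. *)
Definition vflip_webs : webs q (vflip M).
Proof.
refine (@Webs k q (vflip M) (sp W) (mg W) (fun a b => cr W b a)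
  (@sp_ty _ _ _ W) (@mg_ty _ _ _ W) (fun a b => cr_ty W b a)
  (@sp0n _ _ _ W) (@spn0 _ _ _ W) (@mg0n _ _ _ W) (@mgn0 _ _ _ W)
  (@crn0 _ _ _ W) (@cr0n _ _ _ W)
  (@spA _ _ _ W) (@mgA _ _ _ W) _).
move=> a c b d e; rewrite [LHS](spmg W (esym e)).
pose h (i : nat * nat * nat * nat) := let: (s, x, y, t) := i in (s, y, x, t).
apply: (@eq_sum_bij _ _ _ _ _ h h); rewrite ?mats_uniq //.
- by move=> [[[s x] y] t]; rewrite /h !mem_mats // => /and4P[-> -> -> ->].
- by move=> [[[s x] y] t]; rewrite /h !mem_mats // => /and4P[-> -> -> ->].
- by move=> [[[s x] y] t] _ /=; rewrite cmpA.
Defined.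

Definition hflip_webs : webs q (hflip M).
Proof.
refine (@Webs k q (hflip M) (fun a b => mg W b a) (fun a b => sp W b a) (fun a b => cr W b a)
  _ _ (fun a b => cr_ty W b a)
  (@mgn0 _ _ _ W) (@mg0n _ _ _ W) (@spn0 _ _ _ W) (@sp0n _ _ _ W)
  (@crn0 _ _ _ W) (@cr0n _ _ _ W) _ _ _).
- by move=> a b; rewrite addnC; apply: mg_ty.
- by move=> a b; rewrite addnC; apply: sp_ty.
- by move=> a b c; rewrite (addnC a b) (addnC b c); apply: esym (mgA W _ _ _).
- by move=> a b c; rewrite (addnC a b) (addnC b c); apply: esym (spA W _ _ _).
move=> a c b d e.
have e' : (c + a = d + b)%N by lia.
rewrite [LHS](spmg W e').
pose h (i : nat * nat * nat * nat) := let: (s, x, y, t) := i in (t, y, x, s).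
apply: (@eq_sum_bij _ _ _ _ _ h h); rewrite ?mats_uniq //.
- by move=> [[[s x] y] t]; rewrite /h !mem_mats // => H; split=> //; lia.
- by move=> [[[s x] y] t]; rewrite /h !mem_mats // => H; split=> //; lia.
by move=> [[[s x] y] t] _ /=; rewrite tnsA mulnC.
Defined.
End Duals.

#[export] Instance mg_typed k q M (W : @webs k q M) a b : typed (mg W a b) _ _ := mg_ty W a b.
#[export] Instance sp_typed k q M (W : @webs k q M) a b : typed (sp W a b) _ _ := sp_ty W a b.
#[export] Instance cr_typed k q M (W : @webs k q M) a b : typed (cr W a b) _ _ := cr_ty W a b.

(** * Sliding crossings through merges and splits *)

(** If two expansions of the same element agree in all matched terms but one, they agree in that
    term too. *)
Lemma eq_sum_cancel (I J : eqType) (W : zmodType) (r : seq I) (s : seq J)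
    (h : I -> J) (h' : J -> I) (F : I -> W) (F' : J -> W) i0 :
  uniq r -> uniq s -> {in r, forall i, h i \in s /\ h' (h i) = i} ->
  {in s, forall j, h' j \in r /\ h (h' j) = j} ->
  {in r, forall i, i != i0 -> F i = F' (h i)} -> i0 \in r ->
  \sum_(i <- r) F i = \sum_(j <- s) F' j -> F i0 = F' (h i0).
Proof.
move=> ur us hr hs FF' i0r.
rewrite -(eq_sum_bij ur us hr hs (fun i _ => erefl (F' (h i)))).
rewrite (bigD1_seq i0) //= [RHS](bigD1_seq i0) //=.
rewrite big_seq_cond [in RHS]big_seq_cond (eq_bigr (fun i => F' (h i))); first exact: addIr.
by move=> i /andP[ir ii0]; apply: FF'.
Qed.

Section Slide.
Variables (k : fieldType) (q : k).

Lemma ladder_ty M (W : webs q M) a c b d i : (a + c = b + d)%N -> i \in mats a c b d ->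
  ty (ladder W i) (st a ⋅ st c) (st b ⋅ st d).
Proof.
by case: i => [[[s x] y] t] e; rewrite mem_mats // => /and4P[/eqP-> /eqP-> /eqP-> /eqP->] /=; typ.
Qed.

Lemma spmg_context M (W : webs q M) a c b d (f g : car M) X Y (u v : cob M) : (a + c = b + d)%N ->
  ty f (u ⋅ (st b ⋅ st d) ⋅ v) Y -> ty g X (u ⋅ (st a ⋅ st c) ⋅ v) ->
  br X Y (f ⊚ (cid u ⊗ (sp W b d ⊚ mg W a c) ⊗ cid v) ⊚ g)
    = \sum_(i <- mats a c b d) q ^+ (i.1.1.1 * i.2) *: br X Y (f ⊚ (cid u ⊗ ladder W i ⊗ cid v)
      ⊚ g).
Proof.
move=> e fT gT.
have xT : ty (sp W b d ⊚ mg W a c) (st a ⋅ st c) (st b ⋅ st d).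
  by apply: ty_cmp (mg_ty W a c); rewrite e; apply: sp_ty.
by apply: (br_context (spmg W e) xT) => // i im; apply: ladder_ty.
Qed.

Definition slide_mgl M (W : webs q M) a b c :=
  cr W (a + b) c ⊚ (mg W a b ⊗ cid (st c)) =
  (cid (st c) ⊗ mg W a b) ⊚ (cr W a c ⊗ cid (st b)) ⊚ (cid (st a) ⊗ cr W b c).
Definition slide_mgr M (W : webs q M) a b c :=
  cr W a (b + c) ⊚ (cid (st a) ⊗ mg W b c) =
  (mg W b c ⊗ cid (st a)) ⊚ (cid (st b) ⊗ cr W a c) ⊚ (cr W a b ⊗ cid (st c)).

(* W2 and W1 expand
   s_{c,a+b} m_{a+b,c} (m_{a,b} (x) 1) = s_{c,a+b} m_{a,b+c} (1 (x) m_{b,c}) in two ways, and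
   the terms other than the wanted ones agree by the induction hypothesis. *)
Lemma slide_step M (W : webs q M) a b c :
    (forall a' b' c', (a' + b' + c' < a + b + c)%N ->
      slide_mgl W a' b' c' /\ slide_mgr W a' b' c') ->
  slide_mgl W a b c.
Proof.
move=> IH.
pose X := st a ⋅ st b ⋅ st c : cob M; pose Y := st c ⋅ st (a + b) : cob M.
pose I4 := (nat * nat * nat * nat)%type.
pose rL := [seq (i, j) | i <- mats (a + b) c c (a + b), j <- mats a b i.1.1.1 i.1.1.2].
pose rR := [seq (i, j) | i <- mats a (b + c) c (a + b), j <- mats b c i.1.2 i.2].
pose F (ij : I4 * I4) : ho X Y := let: ((r, x, y, t), (s, a1, p, b1)) := ij in
  (q ^+ (r * t) * q ^+ (s * b1)) *: br X Y ((mg W r y ⊗ mg W x t) ⊚ (cid (st r) ⊗ cr W x y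
    ⊗ cid (st t))
    ⊚ (cid (st r ⋅ st x) ⊗ sp W y t) ⊚ (cid one ⊗ ladder W (s, a1, p, b1) ⊗ cid (st c)) ⊚ cid X).
pose F' (ij : I4 * I4) : ho X Y := let: ((s, a1, y, t), (p, b1, c1, r)) := ij in
  (q ^+ (s * t) * q ^+ (p * r)) *: br X Y ((mg W s y ⊗ mg W a1 t) ⊚ (cid (st s) ⊗ cr W a1 y
    ⊗ cid (st t))
    ⊚ (sp W s a1 ⊗ cid (st y ⋅ st t)) ⊚ (cid (st a) ⊗ ladder W (p, b1, c1, r) ⊗ cid one) ⊚ cid X).
(* Both double sums run over the 3 by 2 matrices with rows (s, a1), (p, b1), (y, t), row sums a, b,
   c and column sums c, a + b. The left one adds up the first two rows at its outer level, the right
   one the last two; [h] and [h'] translate between the encodings. *)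
pose h (ij : I4 * I4) := let: ((r, x, y, t), (s, a1, p, b1)) := ij in
  ((s, a1, p + y, b1 + t)%N, (p, b1, y, t)).
pose h' (ij : I4 * I4) := let: ((s, a1, y, t), (p, b1, c1, r)) := ij in
  ((r, a1 + b1, c1, r)%N, (s, a1, p, b1)).
have sumL : br X Y (sp W c (a + b) ⊚ mg W (a + b) c ⊚ (mg W a b ⊗ cid (st c)))
  = \sum_(ij <- rL) F ij.
  rewrite big_allpairs_dep /=.
  transitivity (br X Y (cid Y ⊚ (cid one ⊗ (sp W c (a + b) ⊚ mg W (a + b) c) ⊗ cid one)
    ⊚ (mg W a b ⊗ cid (st c)))).
    by rewrite /X /Y; congr br; mon.
  rewrite spmg_context; [|lia|rewrite /Y; typ|rewrite /X; typ].
  rewrite big_seq [RHS]big_seq; apply: eq_bigr => -[[[r x] y] t]; rewrite mem_mats; last lia.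
  case/and4P=> /eqP e1 /eqP e2 /eqP e3 /eqP e4.
  have ? : t = r by lia.
  subst t c.
  have T1 : typed (sp W r x) (st (a + b)) (st r ⋅ st x) by rewrite /typed e1; apply: typedP.
  have T2 : typed (mg W x r) (st x ⋅ st r) (st (a + b)) by rewrite /typed e4; apply: typedP.
  transitivity (q ^+ (r * r) *: br X Y ((mg W r y ⊗ mg W x r) ⊚ (cid (st r) ⊗ cr W x y ⊗ cid (st r))
    ⊚ (cid (st r ⋅ st x) ⊗ sp W y r) ⊚ (cid one ⊗ (sp W r x ⊚ mg W a b) ⊗ cid (st (r + y)))
      ⊚ cid X)).
    by congr (_ *: br _ _ _); rewrite /= /X /Y; mon.
  rewrite spmg_context; [|lia|rewrite /Y; typ|rewrite /X; typ].
  rewrite scaler_sumr big_seq [RHS]big_seq; apply: eq_bigr => -[[[s a1] p] b1] _ /=.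
  by rewrite scalerA.
have sumR : br X Y (sp W c (a + b) ⊚ mg W a (b + c) ⊚ (cid (st a) ⊗ mg W b c)) = \sum_(ij <- rR) F'
  ij.
  rewrite big_allpairs_dep /=.
  transitivity (br X Y (cid Y ⊚ (cid one ⊗ (sp W c (a + b) ⊚ mg W a (b + c)) ⊗ cid one)
    ⊚ (cid (st a) ⊗ mg W b c))).
    by rewrite /X /Y; congr br; mon.
  rewrite spmg_context; [|lia|rewrite /Y; typ|rewrite /X; typ].
  rewrite big_seq [RHS]big_seq; apply: eq_bigr => -[[[s a1] y] t]; rewrite mem_mats; last lia.
  case/and4P=> /eqP e1 /eqP e2 /eqP e3 /eqP e4.
  subst c a.
  have T1 : typed (sp W y t) (st (b + (s + y))) (st y ⋅ st t) by rewrite /typed e3; apply: typedP.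
  have T2 : typed (mg W a1 t) (st a1 ⋅ st t) (st (s + a1 + b)) by rewrite /typed e4; apply: typedP.
  transitivity (q ^+ (s * t) *: br X Y ((mg W s y ⊗ mg W a1 t) ⊚ (cid (st s) ⊗ cr W a1 y
    ⊗ cid (st t))
    ⊚ (sp W s a1 ⊗ cid (st y ⋅ st t)) ⊚ (cid (st (s + a1)) ⊗ (sp W y t ⊚ mg W b (s + y)) ⊗ cid one)
      ⊚ cid X)).
    by congr (_ *: br _ _ _); rewrite /= /X /Y; mon.
  rewrite spmg_context; [|lia|rewrite /Y; typ|rewrite /X; typ].
  rewrite scaler_sumr big_seq [RHS]big_seq; apply: eq_bigr => -[[[p b1] c1] r] _ /=.
  by rewrite scalerA.
have memL ij : (ij \in rL) = let: ((r, x, y, t), (s, a1, p, b1)) := ij in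
  [&& a == s + a1, b == p + b1, c == r + y, r == s + p, x == a1 + b1 & t == r]%N.
  case: ij => [[[[r x] y] t] [[[s a1] p] b1]].
  apply/allpairsPdep/idP => [[i [j [ii jj [ei ej]]]]|H].
    move: ii jj; rewrite -ei -ej /=.
    rewrite mem_mats; last lia.
    by move=> H; rewrite mem_mats; lia.
  exists (r, x, y, t), (s, a1, p, b1); split=> //; rewrite mem_mats /=; lia.
have memR ij : (ij \in rR) = let: ((s, a1, y, t), (p, b1, c1, r)) := ij in
  [&& a == s + a1, b == p + b1, c == r + c1, r == s + p, y == p + c1 & t == b1 + r]%N.
  case: ij => [[[[s a1] y] t] [[[p b1] c1] r]].
  apply/allpairsPdep/idP => [[i [j [ii jj [ei ej]]]]|H].
    move: ii jj; rewrite -ei -ej /=.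
    rewrite mem_mats; last lia.
    by move=> H; rewrite mem_mats; lia.
  exists (s, a1, y, t), (p, b1, c1, r); split=> //; rewrite mem_mats /=; lia.
have pair_uniq (u : seq I4) (v : I4 -> seq I4) : uniq u -> (forall i, uniq (v i)) ->
  uniq [seq (i, j) | i <- u, j <- v i].
  by move=> uu uv; apply: allpairs_uniq_dep => // [[i j] [i' j'] _ _ /= [-> ->]].
(* The matrix with s = p = 0: its two terms are the two sides of the slide. *)
have : F ((0, a + b, c, 0), (0, a, 0, b))%N = F' (h ((0, a + b, c, 0), (0, a, 0, b))%N).
  apply: (@eq_sum_cancel _ _ _ rL rR h h' F F' ((0, a + b, c, 0), (0, a, 0, b))%N).
  - by apply: pair_uniq => *; apply: mats_uniq.
  - by apply: pair_uniq => *; apply: mats_uniq.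
  - case=> [[[[r x] y] t] [[[s a1] p] b1]]; rewrite memL memR /=.
    case/and5P=> /eqP-> /eqP-> /eqP-> /eqP-> /andP[/eqP-> /eqP->].
    by split; [lia|repeat congr pair; lia].
  - case=> [[[[s a1] y] t] [[[p b1] c1] r]]; rewrite memL memR /=.
    case/and5P=> /eqP-> /eqP-> /eqP-> /eqP-> /andP[/eqP-> /eqP->].
    by split; [lia|repeat congr pair; lia].
  - case=> [[[[r x] y] t] [[[s a1] p] b1]]; rewrite memL.
    case/and5P=> /eqP ea /eqP eb /eqP ec /eqP er /andP[/eqP ex /eqP et] ne /=.
    subst t x r.
    (* For every other matrix s + p > 0, which makes both slides needed to match its two terms
       strictly smaller. *)
    have lt : (0 < s + p)%N.
      by case: posnP ne => // /eqP; rewrite addn_eq0 => /andP[/eqP s0 /eqP p0]; subst s p;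
        rewrite ea eb ec eqxx.
    congr (_ *: br _ _ _).
      by rewrite -!exprD; congr (_ ^+ _); lia.
    have [L _] : slide_mgl W a1 b1 y /\ slide_mgr W a1 b1 y by apply: IH; lia.
    have [_ R] : slide_mgl W a1 p y /\ slide_mgr W a1 p y by apply: IH; lia.
    subst a b c; rewrite /slide_mgl in L; rewrite /slide_mgr in R; rewrite /X.
    transitivity (((mg W (s + p) y ⊚ (mg W s p ⊗ cid (st y))) ⊗ (mg W (a1 + b1) (s + p)
      ⊚ (mg W a1 b1 ⊗ cid (st (s + p)))))
      ⊚ (cid (st s ⋅ st p) ⊗ ((cr W a1 y ⊗ cid (st b1)) ⊚ (cid (st a1) ⊗ cr W b1 y))
        ⊗ cid (st (s + p)))
      ⊚ (cid (st s) ⊗ cr W a1 p ⊗ cid (st b1 ⋅ st y ⋅ st (s + p)))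
      ⊚ (sp W s a1 ⊗ sp W p b1 ⊗ sp W y (s + p))).
      transitivity ((mg W (s + p) y ⊗ mg W (a1 + b1) (s + p))
        ⊚ (mg W s p ⊗ (cr W (a1 + b1) y ⊚ (mg W a1 b1 ⊗ cid (st y))) ⊗ cid (st (s + p)))
        ⊚ (cid (st s) ⊗ cr W a1 p ⊗ cid (st b1 ⋅ st y ⋅ st (s + p)))
        ⊚ (sp W s a1 ⊗ sp W p b1 ⊗ sp W y (s + p))); first mon.
      rewrite L; mon.
    rewrite !mgA.
    transitivity ((mg W s (p + y) ⊗ mg W a1 (b1 + (s + p)))
      ⊚ (cid (st s) ⊗ (cr W a1 (p + y) ⊚ (cid (st a1) ⊗ mg W p y)) ⊗ mg W b1 (s + p))
      ⊚ (cid (st s ⋅ st a1 ⋅ st p) ⊗ cr W b1 y ⊗ cid (st (s + p)))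
      ⊚ (sp W s a1 ⊗ sp W p b1 ⊗ sp W y (s + p))); last mon.
    rewrite R; mon.
  - by rewrite memL; lia.
  - rewrite -sumL -sumR; congr br.
    by rewrite -!cmpA mgA.
rewrite /= ?add0n ?addn0 ?muln0 ?mul0n !expr0 mul1r !scale1r.
rewrite /X /Y !mg0n !mgn0 !sp0n !spn0 /slide_mgl => /br_inj e.
have {}e := e ltac:(typ) ltac:(typ); rewrite crn0 in e.
by etransitivity; [etransitivity; [|exact: e]; mon | mon].
Qed.

(** The second slide is the first one in [hflip_webs W], so the induction on total thickness has to
    range over all calculi at once. *)
Lemma slide_mg M (W : webs q M) a b c : slide_mgl W a b c /\ slide_mgr W a b c.
Proof.
have [n] := ubnP (a + b + c); elim: n M W a b c => // n IH M W a b c le.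
split; first by apply: slide_step => a' b' c' lt; apply: IH; lia.
have: slide_mgl (hflip_webs W) c b a by apply: slide_step => a' b' c' lt; apply: IH; lia.
by rewrite /slide_mgl /slide_mgr /= (addnC c b).
Qed.

Lemma slide_sp M (W : webs q M) a b c :
  (sp W a b ⊗ cid (st c)) ⊚ cr W c (a + b) =
    (cid (st a) ⊗ cr W c b) ⊚ (cr W c a ⊗ cid (st b)) ⊚ (cid (st c) ⊗ sp W a b) /\
  (cid (st a) ⊗ sp W b c) ⊚ cr W (b + c) a =
    (cr W b a ⊗ cid (st c)) ⊚ (cid (st b) ⊗ cr W c a) ⊚ (sp W b c ⊗ cid (st a)).
Proof.
have [L R] := slide_mg (vflip_webs W) a b c.
by split; [move: L | move: R]; rewrite /slide_mgl /slide_mgr /= -!cmpA.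
Qed.

End Slide.

(** * Thick dots *)

Section QuantumIntegers.
Variables (k : fieldType) (q : k) (q0 : q != 0) (q1 : qint q 1 != 0).

(** As [0^-1 = 0], a vanishing q - q^-1 would make every [qint] zero. *)
Lemma subqV_neq0 : q - q^-1 != 0.
Proof. by apply: contraNneq q1 => e; rewrite /qint e invr0 mulr0. Qed.

Lemma qint0 : qint q 0 = 0.
Proof. by rewrite /qint expr0 invr1 subrr mul0r. Qed.

Lemma qint1 : qint q 1 = 1.
Proof. by rewrite /qint expr1 divff // subqV_neq0. Qed.

Lemma qintS n : qint q n.+1 = q * qint q n + q ^- n.
Proof.
have d := subqV_neq0; rewrite /qint exprS.
have : q ^+ n != 0 by rewrite expf_neq0.
move: (q ^+ n) => z z0.
have d' : q ^+ 2 - 1 != 0.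
  apply: contraNneq d => e; suff -> : q - q^-1 = q^-1 * (q ^+ 2 - 1) by rewrite e mulr0.
  by field.
by field; rewrite q0 z0 d'.
Qed.

Lemma qintD m n : qint q (m + n) = q ^+ n * qint q m + q ^- m * qint q n.
Proof.
elim: n => [|n IH]; first by rewrite addn0 expr0 mul1r qint0 mulr0 addr0.
rewrite addnS qintS IH qintS exprD exprS.
have : q ^+ n != 0 by rewrite expf_neq0.
have : q ^+ m != 0 by rewrite expf_neq0.
move: (q ^+ n) (q ^+ m) => z y y0 z0.
by field; rewrite y0 z0.
Qed.

Lemma qbinom_n1 a : qbinom q (a + 1) 1 = qint q a.+1.
Proof.
by rewrite /qbinom big_ord1 /qfact big_nat1 qint1 divr1 subn0 addn1.
Qed.

Hypothesis qn0 : forall n, qint q n.+1 != 0.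

Lemma qfact_neq0 a : qfact q a != 0.
Proof. by rewrite /qfact big_add1 big_mkord; apply/prodf_neq0 => i _. Qed.

Lemma qbinom_nn a : qbinom q (a + 1) a = qint q a.+1.
Proof.
rewrite /qbinom; apply: (canLR (mulfK (qfact_neq0 _))).
rewrite /qfact big_add1 big_mkord /= addn1.
elim: a => [|a IH]; first by rewrite !big_ord0 qint1 mulr1.
rewrite big_ord_recl subn0; congr (_ * _); rewrite [RHS]big_ord_recr /= mulrC -IH.
by apply: eq_bigr => i _; rewrite /= /bump /= add1n subSS.
Qed.
End QuantumIntegers.

(** Solves a two-term expansion from W2 for its first term, once everything else has become a
    multiple of one [w]. *)
Lemma scale_solve (k : fieldType) (V : lmodType k) (v w : V) (a b d : k) :
  a *: w = 1 *: v + b *: w -> a = b + d -> v = d *: w.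
Proof. by move=> e ab; move: e; rewrite ab scale1r scalerDl addrC => /addIr. Qed.

Section Context.
Variables (k : fieldType) (M : calc k).

(** The full diagrams [D] and [E] are tied to the context by equations, so that the caller may
    bracket them in any way and leave the matching to [mon]. *)
Lemma br_context1 (c : k) (x y f g D E : car M) A B X Y (u v : cob M) :
  br A B x = c *: br A B y -> ty x A B -> ty y A B ->
  ty f (u ⋅ B ⋅ v) Y -> ty g X (u ⋅ A ⋅ v) ->
  D = f ⊚ (cid u ⊗ x ⊗ cid v) ⊚ g -> E = f ⊚ (cid u ⊗ y ⊗ cid v) ⊚ g ->
  br X Y D = c *: br X Y E.
Proof.
move=> e xT yT fT gT -> ->; have [phi phiE] := lin_context fT gT.
by rewrite -phiE // e linearZ phiE.
Qed.

Lemma br_context2 (c d : k) (x y z f g D E F : car M) A B X Y (u v : cob M) :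
  br A B x = c *: br A B y + d *: br A B z -> ty x A B -> ty y A B -> ty z A B ->
  ty f (u ⋅ B ⋅ v) Y -> ty g X (u ⋅ A ⋅ v) ->
  D = f ⊚ (cid u ⊗ x ⊗ cid v) ⊚ g -> E = f ⊚ (cid u ⊗ y ⊗ cid v) ⊚ g ->
  F = f ⊚ (cid u ⊗ z ⊗ cid v) ⊚ g ->
  br X Y D = c *: br X Y E + d *: br X Y F.
Proof.
move=> e xT yT zT fT gT -> -> ->; have [phi phiE] := lin_context fT gT.
by rewrite -phiE // e linearD !linearZ !phiE.
Qed.
End Context.

Ltac ctx1 e ff uu vv gg :=
  refine (br_context1 (f := ff) (u := uu) (v := vv) (g := gg) e _ _ _ _ _ _);
  [typ | typ | typ | typ | mon | mon].
Ltac ctx2 e ff uu vv gg :=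
  refine (br_context2 (f := ff) (u := uu) (v := vv) (g := gg) e _ _ _ _ _ _ _ _);
  [typ | typ | typ | typ | typ | mon | mon | mon].

(** W3 is recorded for merges with a thin strand, since thickness will always grow by one thin
    strand at a time. *)
Record affine (k : fieldType) (q : k) (M : calc k) := Affine {
  aweb :> webs q M;
  ci : nat -> nat -> car M;
  dx : car M;
  dxV : car M;
  ci_ty : forall a b, ty (ci a b) (st b ⋅ st a) (st a ⋅ st b);
  crK : forall a b, ci a b ⊚ cr aweb a b = cid (st a ⋅ st b);
  crVK : forall a b, cr aweb a b ⊚ ci a b = cid (st b ⋅ st a);
  dx_ty : ty dx (st 1) (st 1);
  dxV_ty : ty dxV (st 1) (st 1);
  dxK : dxV ⊚ dx = cid (st 1);
  dxVK : dx ⊚ dxV = cid (st 1);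
  mgsp_n1 : forall a, br (st (a + 1)) (st (a + 1)) (mg aweb a 1 ⊚ sp aweb a 1)
    = qint q a.+1 *: br (st (a + 1)) (st (a + 1)) (cid (st (a + 1)));
  mgsp_1n : forall a, br (st (a + 1)) (st (a + 1)) (mg aweb 1 a ⊚ sp aweb 1 a)
    = qint q a.+1 *: br (st (a + 1)) (st (a + 1)) (cid (st (a + 1)));
  cr_dx : cr aweb 1 1 ⊚ (dx ⊗ cid (st 1)) = (cid (st 1) ⊗ dx) ⊚ ci 1 1;
  dx_cr : (dx ⊗ cid (st 1)) ⊚ cr aweb 1 1 = ci 1 1 ⊚ (cid (st 1) ⊗ dx)
}.
#[export] Instance ci_typed k q M (W : @affine k q M) a b : typed (ci W a b) _ _ := ci_ty W a b.
#[export] Instance dx_typed k q M (W : @affine k q M) : typed (dx W) _ _ := dx_ty W.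
#[export] Instance dxV_typed k q M (W : @affine k q M) : typed (dxV W) _ _ := dxV_ty W.

Section LadderExpansions.
Variables (k : fieldType) (q : k) (M : calc k) (W : webs q M).

Local Notation m := (mg W).
Local Notation s := (sp W).
Local Notation c := (cr W).
Local Notation one_ n := (@cid _ M (st n)).

(** A 2 by 2 matrix with given margins, one of them 1, is determined by the position of the 1 in
    that row or column; hence the expansions below have two terms. *)
Lemma spmg2 a c b d i j : (a + c = b + d)%N -> perm_eq (mats a c b d) [:: i; j] ->
  br (st a ⋅ st c) (st b ⋅ st d) (s b d ⊚ m a c)
  = q ^+ (i.1.1.1 * i.2) *: br (st a ⋅ st c) (st b ⋅ st d) (ladder W i)
  + q ^+ (j.1.1.1 * j.2) *: br (st a ⋅ st c) (st b ⋅ st d) (ladder W j).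
Proof. by move=> e p; rewrite (spmg W e) (perm_big _ p) !big_cons big_nil /= addr0. Qed.

Ltac mats2 := apply: uniq_perm; [exact: mats_uniq | by rewrite /= ?inE ?xpair_eqE; lia
  | by move=> [[[? ?] ?] ?]; rewrite mem_mats ?inE ?xpair_eqE; lia].

(** The factor 1 brings the expansion into the form that [br_context2] takes. *)
Lemma sp_mg_n1 n : br (st n.+1 ⋅ st 1) (st n.+1 ⋅ st 1) (s n.+1 1 ⊚ m n.+1 1)
  = 1 *: br (st n.+1 ⋅ st 1) (st n.+1 ⋅ st 1)
      ((m n 1 ⊗ one_ 1) ⊚ (one_ n ⊗ c 1 1) ⊚ (s n 1 ⊗ one_ 1))
  + q ^+ n.+1 *: br (st n.+1 ⋅ st 1) (st n.+1 ⋅ st 1) (cid (st n.+1 ⋅ st 1)).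
Proof.
rewrite (@spmg2 _ _ _ _ (n, 1, 1, 0)%N (n.+1, 0, 0, 1)%N) //; last by mats2.
rewrite /ladder /= muln0 muln1 expr0 !mg0n !mgn0 !sp0n !spn0 !crn0.
by congr (_ *: br _ _ _ + _ *: br _ _ _); mon.
Qed.

Lemma sp1n_mgn1 n : br (st n.+1 ⋅ st 1) (st 1 ⋅ st n.+1) (s 1 n.+1 ⊚ m n.+1 1)
  = 1 *: br (st n.+1 ⋅ st 1) (st 1 ⋅ st n.+1) (c n.+1 1)
  + q *: br (st n.+1 ⋅ st 1) (st 1 ⋅ st n.+1) ((one_ 1 ⊗ m n 1) ⊚ (s 1 n ⊗ one_ 1)).
Proof.
rewrite (@spmg2 _ _ _ _ (0, n.+1, 1, 0)%N (1, n, 0, 1)%N); [|by lia|by mats2].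
rewrite /ladder /= muln0 muln1 expr0 !mg0n !mgn0 !sp0n !spn0 !crn0.
by congr (_ *: br _ _ _ + _ *: br _ _ _); mon.
Qed.

Lemma spn1_mg1n n : br (st 1 ⋅ st n.+1) (st n.+1 ⋅ st 1) (s n.+1 1 ⊚ m 1 n.+1)
  = 1 *: br (st 1 ⋅ st n.+1) (st n.+1 ⋅ st 1) (c 1 n.+1)
  + q *: br (st 1 ⋅ st n.+1) (st n.+1 ⋅ st 1) ((m 1 n ⊗ one_ 1) ⊚ (one_ 1 ⊗ s n 1)).
Proof.
rewrite (@spmg2 _ _ _ _ (0, 1, n.+1, 0)%N (1, 0, n, 1)%N); [|by lia|by mats2].
rewrite /ladder /= muln0 muln1 expr0 !mg0n !mgn0 !sp0n !spn0 !cr0n.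
by congr (_ *: br _ _ _ + _ *: br _ _ _); mon.
Qed.

Lemma sp_mg_split r b : br (st (r.+1 + b) ⋅ st 1) (st (b + 1) ⋅ st r.+1) (s (b + 1) r.+1
  ⊚ m (r.+1 + b) 1)
  = 1 *: br (st (r.+1 + b) ⋅ st 1) (st (b + 1) ⋅ st r.+1)
      ((m b 1 ⊗ one_ r.+1) ⊚ (one_ b ⊗ c r.+1 1) ⊚ (s b r.+1 ⊗ one_ 1))
  + q ^+ b.+1 *: br (st (r.+1 + b) ⋅ st 1) (st (b + 1) ⋅ st r.+1)
      ((one_ (b + 1) ⊗ m r 1) ⊚ (s (b + 1) r ⊗ one_ 1)).
Proof.
rewrite (@spmg2 _ _ _ _ (b, r.+1, 1, 0)%N (b + 1, r, 0, 1)%N); [|by lia|by mats2].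
rewrite /ladder /= muln0 muln1 addn1 expr0 ?mg0n !mgn0 ?sp0n !spn0 !crn0.
by congr (_ *: br _ _ _ + _ *: br _ _ _); mon.
Qed.

End LadderExpansions.

(** * Absorption of crossings, and W4 and W5 for thick strands *)

Section Affine.
Variables (k : fieldType) (q : k) (q0 : q != 0) (qn0 : forall n, qint q n.+1 != 0).
Variables (M : calc k) (W : affine q M).
Let q1 := qn0 0.

Local Notation m := (mg W).
Local Notation s := (sp W).
Local Notation c := (cr W).
Local Notation ci := (ci W).
Local Notation x := (dx W).
Local Notation one_ n := (@cid _ M (st n)).
Local Notation ID A := (@cid _ M A).
Local Notation "𝟙" := (@one _ M).

Lemma merge_epi n (u v : cob M) Y f g : ty f (u ⋅ st (n + 1) ⋅ v) Y -> ty g (u ⋅ st (n + 1) ⋅ v) Y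
  ->
  f ⊚ (cid u ⊗ m n 1 ⊗ cid v) = g ⊚ (cid u ⊗ m n 1 ⊗ cid v) -> f = g.
Proof.
move=> fT gT e; set X := u ⋅ _ ⋅ v in fT gT.
have E h : typed h X Y ->
    br X Y (h ⊚ (cid u ⊗ m n 1 ⊗ cid v) ⊚ (cid u ⊗ s n 1 ⊗ cid v)) = qint q n.+1 *: br X Y h.
  by rewrite /X => hT; ctx1 (mgsp_n1 W n) h u v (cid (u ⋅ st (n + 1) ⋅ v)).
by apply: (br_inj fT gT); apply: (scalerI (qn0 n)); rewrite -(E f fT) -(E g gT) e.
Qed.

Lemma split_mono n (u v : cob M) Y f g : ty f Y (u ⋅ st (n + 1) ⋅ v) -> ty g Y (u ⋅ st (n + 1) ⋅ v)
  ->
  (cid u ⊗ s n 1 ⊗ cid v) ⊚ f = (cid u ⊗ s n 1 ⊗ cid v) ⊚ g -> f = g.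
Proof.
move=> fT gT e; set X := u ⋅ _ ⋅ v in fT gT.
have E h : typed h Y X ->
    br Y X ((cid u ⊗ m n 1 ⊗ cid v) ⊚ ((cid u ⊗ s n 1 ⊗ cid v) ⊚ h)) = qint q n.+1 *: br Y X h.
  by rewrite /X => hT; ctx1 (mgsp_n1 W n) (cid (u ⋅ st (n + 1) ⋅ v)) u v h.
by apply: (br_inj fT gT); apply: (scalerI (qn0 n)); rewrite -(E f fT) -(E g gT) e.
Qed.

(** Evaluate m_{n+1,1} s_{n+1,1} m_{1,n+1} by W3 on the lower or by W2 on the upper pair, and
    compare [n+2] with q [n+1]: the difference is q^-(n+1). The two lemmas after it follow the same
    pattern. *)
Lemma mg_cr_1n n : br (st 1 ⋅ st n) (st (n + 1)) (m n 1 ⊚ c 1 n)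
  = q ^- n *: br (st 1 ⋅ st n) (st (n + 1)) (m 1 n).
Proof.
case: n => [|n].
  by rewrite mg0n mgn0 crn0 expr0 invr1 scale1r; congr br; mon.
set X := st 1 ⋅ _; set Y := st (_ + 1).
have e1 : br X Y (m n.+1 1 ⊚ s n.+1 1 ⊚ m 1 n.+1)
  = 1 *: br X Y (m n.+1 1 ⊚ c 1 n.+1) + q *: br X Y (m n.+1 1 ⊚ (m 1 n ⊗ one_ 1)
    ⊚ (one_ 1 ⊗ s n 1)).
  by ctx2 (spn1_mg1n W n) (m n.+1 1) 𝟙 𝟙 (ID (st 1 ⋅ st n.+1)).
have e2 : br X Y (m n.+1 1 ⊚ s n.+1 1 ⊚ m 1 n.+1) = qint q n.+2 *: br X Y (m 1 n.+1)%N.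
  by ctx1 (mgsp_n1 W n.+1) (ID (st (n.+1 + 1))) 𝟙 𝟙 (m 1 n.+1).
have e3 : br X Y (m n.+1 1 ⊚ (m 1 n ⊗ one_ 1) ⊚ (one_ 1 ⊗ s n 1)) = qint q n.+1 *: br X Y
  (m 1 n.+1)%N.
  have -> : m n.+1 1 ⊚ (m 1 n ⊗ one_ 1) = m 1 (n + 1) ⊚ (one_ 1 ⊗ m n 1) by rewrite -mgA.
  by ctx1 (mgsp_n1 W n) (m 1 (n + 1)) (@st _ M 1) 𝟙 (ID (st 1 ⋅ st n.+1)).
by move: e1; rewrite e2 e3 scalerA => /scale_solve; apply; rewrite (qintS q0 q1).
Qed.

Lemma cr_sp_n1 n : br (st (n + 1)) (st 1 ⋅ st n) (c n 1 ⊚ s n 1)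
  = q ^- n *: br (st (n + 1)) (st 1 ⋅ st n) (s 1 n).
Proof.
case: n => [|n].
  by rewrite sp0n spn0 cr0n expr0 invr1 scale1r; congr br; mon.
set X := st (_ + 1); set Y := st 1 ⋅ _.
have e1 : br X Y (s 1 n.+1 ⊚ (m n.+1 1 ⊚ s n.+1 1))
  = 1 *: br X Y (c n.+1 1 ⊚ s n.+1 1) + q *: br X Y ((one_ 1 ⊗ m n 1) ⊚ ((s 1 n ⊗ one_ 1)
    ⊚ s n.+1 1)).
  by ctx2 (sp1n_mgn1 W n) (ID (st 1 ⋅ st n.+1)) 𝟙 𝟙 (s n.+1 1).
have e2 : br X Y (s 1 n.+1 ⊚ (m n.+1 1 ⊚ s n.+1 1)) = qint q n.+2 *: br X Y (s 1 n.+1)%N.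
  by ctx1 (mgsp_n1 W n.+1) (s 1 n.+1) 𝟙 𝟙 (ID (st (n.+1 + 1))).
have e3 : br X Y ((one_ 1 ⊗ m n 1) ⊚ ((s 1 n ⊗ one_ 1) ⊚ s n.+1 1)) = qint q n.+1 *: br X Y
  (s 1 n.+1)%N.
  have -> : (s 1 n ⊗ one_ 1) ⊚ s n.+1 1 = (one_ 1 ⊗ s n 1) ⊚ s 1 (n + 1) by rewrite -spA.
  by ctx1 (mgsp_n1 W n) (ID (st 1 ⋅ st n.+1)) (@st _ M 1) 𝟙 (s 1 (n + 1)).
by move: e1; rewrite e2 e3 scalerA => /scale_solve; apply; rewrite (qintS q0 q1).
Qed.

Lemma cr_sp_1n n : br (st (n + 1)) (st n ⋅ st 1) (c 1 n ⊚ s 1 n)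
  = q ^- n *: br (st (n + 1)) (st n ⋅ st 1) (s n 1).
Proof.
case: n => [|n].
  by rewrite sp0n spn0 crn0 expr0 invr1 scale1r; congr br; mon.
set X := st (_ + 1); set Y := st _ ⋅ _.
have e1 : br X Y (s n.+1 1 ⊚ (m 1 n.+1 ⊚ s 1 n.+1))
  = 1 *: br X Y (c 1 n.+1 ⊚ s 1 n.+1) + q *: br X Y ((m 1 n ⊗ one_ 1) ⊚ ((one_ 1 ⊗ s n 1)
    ⊚ s 1 n.+1)).
  by ctx2 (spn1_mg1n W n) (ID (st n.+1 ⋅ st 1)) 𝟙 𝟙 (s 1 n.+1).
have e2 : br X Y (s n.+1 1 ⊚ (m 1 n.+1 ⊚ s 1 n.+1)) = qint q n.+2 *: br X Y (s n.+1 1)%N.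
  by ctx1 (mgsp_1n W n.+1) (s n.+1 1) 𝟙 𝟙 (ID (st (n.+1 + 1))).
have e3 : br X Y ((m 1 n ⊗ one_ 1) ⊚ ((one_ 1 ⊗ s n 1) ⊚ s 1 n.+1)) = qint q n.+1 *: br X Y
  (s n.+1 1)%N.
  have -> : (one_ 1 ⊗ s n 1) ⊚ s 1 n.+1 = (s 1 n ⊗ one_ 1) ⊚ s (1 + n) 1 by rewrite spA addn1.
  by ctx1 (mgsp_1n W n) (ID (st n.+1 ⋅ st 1)) 𝟙 (@st _ M 1) (s (1 + n) 1).
by move: e1; rewrite e2 e3 scalerA => /scale_solve; apply; rewrite (qintS q0 q1).
Qed.

(** Skein relation for one thick strand. With V the last diagram, W2 gives s_{1,n+1} m_{n+1,1} = c +
    q V. Replacing s_{1,n+1} by a multiple of [ci] composed with s_{n+1,1} and then using W2 gives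
    ci + q^-1 V for the same morphism. *)
Lemma ci_1n n : br (st n.+1 ⋅ st 1) (st 1 ⋅ st n.+1) (ci 1 n.+1)
  = 1 *: br (st n.+1 ⋅ st 1) (st 1 ⋅ st n.+1) (c n.+1 1)
  + (q - q^-1) *: br (st n.+1 ⋅ st 1) (st 1 ⋅ st n.+1) ((one_ 1 ⊗ m n 1) ⊚ (s 1 n ⊗ one_ 1)).
Proof.
set X := st n.+1 ⋅ _; set Y := st 1 ⋅ _; set V := _ ⊚ (s 1 n ⊗ _).
have e1 : br X Y (ci 1 n.+1 ⊚ (s n.+1 1 ⊚ m n.+1 1)) = 1 *: br X Y (ci 1 n.+1 ⊚ ((m n 1 ⊗ one_ 1)
  ⊚ (one_ n ⊗ c 1 1) ⊚ (s n 1 ⊗ one_ 1))) + q ^+ n.+1 *: br X Y (ci 1 n.+1)%N.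
  by ctx2 (sp_mg_n1 W n) (ci 1 n.+1) 𝟙 𝟙 (ID (st n.+1 ⋅ st 1)).
have e2 : br X Y (s 1 n.+1 ⊚ m n.+1 1) = q ^- n.+1 *: br X Y (ci 1 n.+1 ⊚ (s n.+1 1 ⊚ m n.+1 1)).
  have -> : s 1 n.+1 ⊚ m n.+1 1 = ci 1 n.+1 ⊚ (c 1 n.+1 ⊚ s 1 n.+1) ⊚ m n.+1 1.
    rewrite cmpA crK; mon.
  by ctx1 (cr_sp_1n n.+1) (ci 1 n.+1) 𝟙 𝟙 (m n.+1 1).
have e3 : br X Y V = q ^- n *: br X Y (ci 1 n.+1 ⊚ ((m n 1 ⊗ one_ 1) ⊚ (one_ n ⊗ c 1 1)
  ⊚ (s n 1 ⊗ one_ 1))).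
  have -> : V = ci 1 (n + 1) ⊚ ((m n 1 ⊗ one_ 1) ⊚ (one_ n ⊗ c 1 1)) ⊚ (c 1 n ⊗ one_ 1)
    ⊚ (s 1 n ⊗ one_ 1).
    have [_ R] := slide_mg W 1 n 1.
    transitivity (ci 1 (n + 1) ⊚ c 1 (n + 1) ⊚ (one_ 1 ⊗ m n 1) ⊚ (s 1 n ⊗ one_ 1)).
      by rewrite crK /V; mon.
    transitivity (ci 1 (n + 1) ⊚ (c 1 (n + 1) ⊚ (one_ 1 ⊗ m n 1)) ⊚ (s 1 n ⊗ one_ 1)); first mon.
    by rewrite R; mon.
  by ctx1 (cr_sp_1n n) (ci 1 (n + 1) ⊚ ((m n 1 ⊗ one_ 1) ⊚ (one_ n ⊗ c 1 1))) 𝟙 (@st _ M 1)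
    (ID (st n.+1 ⋅ st 1)).
have := sp1n_mgn1 W n; rewrite -/X -/Y -/V e2 e1 e3; set P := br X Y (_ ⊚ _).
have z0 : q ^+ n.+1 != 0 by rewrite expf_neq0.
rewrite !scale1r scalerDr !scalerA mulVf // scale1r => /eqP; rewrite addrC eq_sym -subr_eq =>
  /eqP <-.
rewrite -addrA -scalerBl; congr (_ + _ *: _).
by rewrite exprS; field; rewrite q0 expf_neq0.
Qed.

(* The thick dots Y n determined by a thin dot y through W6; applied both to the dot and to
   its inverse. *)
Record dots (y : car M) (Y : nat -> car M) : Prop := Dots {
  dots_1 : ty y (st 1) (st 1);
  dots_ty : forall n, ty (Y n) (st n) (st n);
  dots_comm : c 1 1 ⊚ (y ⊗ y) = (y ⊗ y) ⊚ c 1 1;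
  dots0 : Y 0%N = cid (st 0);
  dotsS : forall n, br (st (n + 1)) (st (n + 1)) (m n 1 ⊚ (Y n ⊗ y) ⊚ s n 1)
    = qint q n.+1 *: br (st (n + 1)) (st (n + 1)) (Y (n + 1)%N)
}.

Section Dots.
Variables (y : car M) (Y : nat -> car M) (D : dots y Y).
#[local] Instance y_typed : typed y _ _ := dots_1 D.
#[local] Instance Y_typed n : typed (Y n) _ _ := dots_ty D n.

Lemma dots1 : Y 1 = y.
Proof.
apply: (@br_inj _ M _ _ (st 1) (st 1)); [exact: typedP | exact: typedP |].
have := dotsS D 0; rewrite mg0n sp0n (dots0 D) (qint1 q1) scale1r => <-.
by congr br; mon.
Qed.

(** By [dotsS], Y (n+1) is m (Y n ⊗ y) s divided by [n+1], so both identities follow once Y n ⊗ y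
    commutes with s m. W2 reduces this to a ladder with one thin crossing: the dots pass its split
    and its merge by the two halves of the induction hypothesis, and its crossing by [dots_comm].
    This is why the halves are proved together. *)
Lemma dots_n1 n : Y (n + 1)%N ⊚ m n 1 = m n 1 ⊚ (Y n ⊗ y) /\ s n 1 ⊚ Y (n + 1)%N = (Y n ⊗ y)
  ⊚ s n 1.
Proof.
elim: n => [|n [IHm IHs]].
  by rewrite mg0n sp0n dots1 (dots0 D); split; mon.
have C : s n.+1 1 ⊚ m n.+1 1 ⊚ (Y n.+1 ⊗ y) = (Y n.+1 ⊗ y) ⊚ (s n.+1 1 ⊚ m n.+1 1).
  pose T : cob M := st n.+1 ⋅ st 1.
  apply: (@br_inj _ M _ _ T T); [typ | typ |].
  pose R := (m n 1 ⊗ one_ 1) ⊚ (one_ n ⊗ c 1 1) ⊚ (s n 1 ⊗ one_ 1).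
  have -> : br T T (s n.+1 1 ⊚ m n.+1 1 ⊚ (Y n.+1 ⊗ y))
    = 1 *: br T T (R ⊚ (Y n.+1 ⊗ y)) + q ^+ n.+1 *: br T T (Y n.+1 ⊗ y).
    by rewrite /R; ctx2 (sp_mg_n1 W n) (ID (st n.+1 ⋅ st 1)) 𝟙 𝟙 (Y n.+1 ⊗ y).
  have -> : br T T ((Y n.+1 ⊗ y) ⊚ (s n.+1 1 ⊚ m n.+1 1))
    = 1 *: br T T ((Y n.+1 ⊗ y) ⊚ R) + q ^+ n.+1 *: br T T (Y n.+1 ⊗ y).
    by rewrite /R; ctx2 (sp_mg_n1 W n) (Y n.+1 ⊗ y) 𝟙 𝟙 (ID (st n.+1 ⋅ st 1)).
  congr (_ *: br _ _ _ + _); rewrite /R.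
  transitivity ((m n 1 ⊗ one_ 1) ⊚ (one_ n ⊗ c 1 1) ⊚ ((s n 1 ⊚ Y (n + 1)%N) ⊗ y)); first mon.
  rewrite IHs.
  transitivity ((m n 1 ⊗ one_ 1) ⊚ (Y n ⊗ (c 1 1 ⊚ (y ⊗ y))) ⊚ (s n 1 ⊗ one_ 1)); first mon.
  rewrite (dots_comm D).
  transitivity (((m n 1 ⊚ (Y n ⊗ y)) ⊗ y) ⊚ (one_ n ⊗ c 1 1) ⊚ (s n 1 ⊗ one_ 1)); first mon.
  by rewrite -IHm; mon.
pose T : cob M := st (n.+1 + 1); pose T2 : cob M := st n.+1 ⋅ st 1.
split.
  apply: (@br_inj _ M _ _ T2 T); [typ | typ |]; apply: (scalerI (qn0 n.+1)).
  transitivity (br T2 T (m n.+1 1 ⊚ ((Y n.+1 ⊗ y) ⊚ (s n.+1 1 ⊚ m n.+1 1)))).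
    by symmetry; ctx1 (dotsS D n.+1) (ID (st (n.+1 + 1))) 𝟙 𝟙 (m n.+1 1).
  by rewrite -C; ctx1 (mgsp_n1 W n.+1) (ID (st (n.+1 + 1))) 𝟙 𝟙 (m n.+1 1 ⊚ (Y n.+1 ⊗ y)).
apply: (@br_inj _ M _ _ T T2); [typ | typ |]; apply: (scalerI (qn0 n.+1)).
transitivity (br T T2 ((s n.+1 1 ⊚ m n.+1 1 ⊚ (Y n.+1 ⊗ y)) ⊚ s n.+1 1)).
  by symmetry; ctx1 (dotsS D n.+1) (s n.+1 1) 𝟙 𝟙 (ID (st (n.+1 + 1))).
by rewrite C; ctx1 (mgsp_n1 W n.+1) ((Y n.+1 ⊗ y) ⊚ s n.+1 1) 𝟙 𝟙 (ID (st (n.+1 + 1))).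
Qed.

Lemma dots_mg a b : Y (a + b)%N ⊚ m a b = m a b ⊚ (Y a ⊗ Y b).
Proof.
elim: b => [|b IH]; first by rewrite addn0 mgn0 (dots0 D); mon.
apply: (@merge_epi b (st a) 𝟙 (st (a + b.+1))); [typ | typ |].
transitivity (Y (a + b + 1)%N ⊚ (m a (b + 1) ⊚ (one_ a ⊗ m b 1))); first mon.
rewrite -mgA.
transitivity ((Y (a + b + 1)%N ⊚ m (a + b) 1) ⊚ (m a b ⊗ one_ 1)); first mon.
have [-> _] := dots_n1 (a + b).
transitivity (m (a + b) 1 ⊚ ((Y (a + b)%N ⊚ m a b) ⊗ y)); first mon.
rewrite IH.
transitivity ((m (a + b) 1 ⊚ (m a b ⊗ one_ 1)) ⊚ (Y a ⊗ Y b ⊗ y)); first mon.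
rewrite mgA.
transitivity (m a (b + 1) ⊚ (Y a ⊗ (m b 1 ⊚ (Y b ⊗ y)))); first mon.
by have [<- _] := dots_n1 b; mon.
Qed.

Lemma dots_sp a b : s a b ⊚ Y (a + b)%N = (Y a ⊗ Y b) ⊚ s a b.
Proof.
elim: b => [|b IH]; first by rewrite addn0 spn0 (dots0 D); mon.
apply: (@split_mono b (st a) 𝟙 (st (a + b.+1))); [typ | typ |].
transitivity (((one_ a ⊗ s b 1) ⊚ s a (b + 1)) ⊚ Y (a + b + 1)%N); first mon.
rewrite -spA.
transitivity ((s a b ⊗ one_ 1) ⊚ (s (a + b) 1 ⊚ Y (a + b + 1)%N)); first mon.
have [_ ->] := dots_n1 (a + b).
transitivity (((s a b ⊚ Y (a + b)%N) ⊗ y) ⊚ s (a + b) 1); first mon.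
rewrite IH.
transitivity ((Y a ⊗ Y b ⊗ y) ⊚ ((s a b ⊗ one_ 1) ⊚ s (a + b) 1)); first mon.
rewrite spA.
transitivity ((Y a ⊗ ((Y b ⊗ y) ⊚ s b 1)) ⊚ s a (b + 1)); first mon.
by have [_ <-] := dots_n1 b; mon.
Qed.
End Dots.

Lemma dots_inv y Y z Z : dots y Y -> dots z Z -> y ⊚ z = one_ 1 -> forall n, Y n ⊚ Z n = one_ n.
Proof.
move=> D E yz.
have Yt n : typed (Y n) _ _ := dots_ty D n.
have Zt n : typed (Z n) _ _ := dots_ty E n.
have yt : typed y _ _ := dots_1 D.
have zt : typed z _ _ := dots_1 E.
elim=> [|n IH]; first by rewrite (dots0 D) (dots0 E); mon.
apply: (@merge_epi n 𝟙 𝟙 (st n.+1)); [typ | typ |].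
transitivity (Y (n + 1)%N ⊚ (Z (n + 1)%N ⊚ m n 1)); first mon.
have [-> _] := dots_n1 E n.
transitivity ((Y (n + 1)%N ⊚ m n 1) ⊚ (Z n ⊗ z)); first mon.
have [-> _] := dots_n1 D n.
transitivity (m n 1 ⊚ ((Y n ⊚ Z n) ⊗ (y ⊚ z))); first mon.
by rewrite IH yz; mon.
Qed.

(** The first dot to pass inverts the crossing and the second one restores it. *)
Lemma dx_comm : c 1 1 ⊚ (x ⊗ x) = (x ⊗ x) ⊚ c 1 1.
Proof.
transitivity ((c 1 1 ⊚ (x ⊗ one_ 1)) ⊚ (one_ 1 ⊗ x)); first mon.
rewrite cr_dx -cmpA -dx_cr; mon.
Qed.

Lemma dxV_comm : c 1 1 ⊚ (dxV W ⊗ dxV W) = (dxV W ⊗ dxV W) ⊚ c 1 1.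
Proof.
transitivity (((dxV W ⊚ x) ⊗ (dxV W ⊚ x)) ⊚ c 1 1 ⊚ (dxV W ⊗ dxV W)); first by rewrite dxK; mon.
transitivity ((dxV W ⊗ dxV W) ⊚ ((x ⊗ x) ⊚ c 1 1) ⊚ (dxV W ⊗ dxV W)); first mon.
rewrite -dx_comm.
transitivity ((dxV W ⊗ dxV W) ⊚ c 1 1 ⊚ ((x ⊚ dxV W) ⊗ (x ⊚ dxV W))); first mon.
by rewrite dxVK; mon.
Qed.

(** Inserting cancelling pairs of crossings reduces both identities to slides of positive
    crossings. *)
Lemma ci_mg a b d :
  ci d (a + b) ⊚ (m a b ⊗ one_ d) = (one_ d ⊗ m a b) ⊚ (ci d a ⊗ one_ b) ⊚ (one_ a ⊗ ci d b) /\
  ci (a + b) d ⊚ (one_ d ⊗ m a b) = (m a b ⊗ one_ d) ⊚ (one_ a ⊗ ci b d) ⊚ (ci a d ⊗ one_ b).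
Proof.
have [L _] := slide_mg W a b d; have [_ R] := slide_mg W d a b; split.
  transitivity (ci d (a + b) ⊚ (m a b ⊗ one_ d) ⊚ (one_ a ⊗ (c d b ⊚ ci d b))).
    by rewrite (crVK W d b); mon.
  transitivity (ci d (a + b) ⊚ (m a b ⊗ one_ d) ⊚ (one_ a ⊗ c d b) ⊚ ((c d a ⊚ ci d a) ⊗ one_ b)
    ⊚ (one_ a ⊗ ci d b)).
    by rewrite (crVK W d a); mon.
  transitivity (ci d (a + b) ⊚ ((m a b ⊗ one_ d) ⊚ (one_ a ⊗ c d b) ⊚ (c d a ⊗ one_ b))
    ⊚ (ci d a ⊗ one_ b) ⊚ (one_ a ⊗ ci d b)).
    by mon.
  by rewrite -R cmpA crK; mon.
transitivity (ci (a + b) d ⊚ (one_ d ⊗ m a b) ⊚ ((c a d ⊚ ci a d) ⊗ one_ b)).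
  by rewrite (crVK W a d); mon.
transitivity (ci (a + b) d ⊚ (one_ d ⊗ m a b) ⊚ (c a d ⊗ one_ b) ⊚ (one_ a ⊗ (c b d ⊚ ci b d))
  ⊚ (ci a d ⊗ one_ b)).
  by rewrite (crVK W b d); mon.
transitivity (ci (a + b) d ⊚ ((one_ d ⊗ m a b) ⊚ (c a d ⊗ one_ b) ⊚ (one_ a ⊗ c b d))
  ⊚ (one_ a ⊗ ci b d) ⊚ (ci a d ⊗ one_ b)).
  by mon.
by rewrite -L cmpA crK; mon.
Qed.

(** First [H1] thickens the undotted strand, then the main induction thickens the dotted one.
    Positive slides are used before the dot has passed; afterwards the crossings are negative and
    [ci_mg] reassembles them. *)
Lemma cr_dots X : dots x X -> forall a b, c a b ⊚ (X a ⊗ one_ b) = (one_ b ⊗ X a) ⊚ ci b a.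
Proof.
move=> D; have Xt n : typed (X n) _ _ := dots_ty D n.
have H1 b : c 1 b ⊚ (x ⊗ one_ b) = (one_ b ⊗ x) ⊚ ci b 1.
  elim: b => [|b IH].
    have -> : ci 0 1 = one_ 1 by transitivity (ci 0 1 ⊚ c 0 1); [rewrite cr0n; mon | rewrite crK;
      mon].
    by rewrite crn0; mon.
  apply: (@merge_epi b (st 1) 𝟙 (st b.+1 ⋅ st 1)); [typ | typ |].
  transitivity ((c 1 (b + 1) ⊚ (one_ 1 ⊗ m b 1)) ⊚ (x ⊗ one_ b ⊗ one_ 1)); first mon.
  have [_ ->] := slide_mg W 1 b 1.
  transitivity ((m b 1 ⊗ one_ 1) ⊚ (one_ b ⊗ c 1 1) ⊚ ((c 1 b ⊚ (x ⊗ one_ b)) ⊗ one_ 1)); first mon.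
  rewrite IH.
  transitivity ((m b 1 ⊗ one_ 1) ⊚ (one_ b ⊗ (c 1 1 ⊚ (x ⊗ one_ 1))) ⊚ (ci b 1 ⊗ one_ 1));
    first mon.
  rewrite cr_dx.
  transitivity ((one_ (b + 1) ⊗ x) ⊚ ((m b 1 ⊗ one_ 1) ⊚ (one_ b ⊗ ci 1 1) ⊚ (ci b 1 ⊗ one_ 1)));
    first mon.
  by have [_ <-] := ci_mg b 1 1; mon.
elim=> [|a IH] b.
  have -> : ci b 0 = one_ b by transitivity (ci b 0 ⊚ c b 0); [rewrite crn0; mon | rewrite crK;
    mon].
  by rewrite cr0n (dots0 D); mon.
apply: (@merge_epi a 𝟙 (st b) (st b ⋅ st a.+1)); [typ | typ |].
transitivity (c (a + 1) b ⊚ ((X (a + 1)%N ⊚ m a 1) ⊗ one_ b)); first mon.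
have [-> _] := dots_n1 D a.
transitivity ((c (a + 1) b ⊚ (m a 1 ⊗ one_ b)) ⊚ (X a ⊗ x ⊗ one_ b)); first mon.
have [-> _] := slide_mg W a 1 b.
transitivity ((one_ b ⊗ m a 1) ⊚ (c a b ⊗ one_ 1) ⊚ (X a ⊗ (c 1 b ⊚ (x ⊗ one_ b)))); first mon.
rewrite H1.
transitivity ((one_ b ⊗ m a 1) ⊚ ((c a b ⊚ (X a ⊗ one_ b)) ⊗ x) ⊚ (one_ a ⊗ ci b 1)); first mon.
rewrite IH.
transitivity ((one_ b ⊗ (m a 1 ⊚ (X a ⊗ x))) ⊚ (ci b a ⊗ one_ 1) ⊚ (one_ a ⊗ ci b 1)); first mon.
have [<- _] := dots_n1 D a.
transitivity ((one_ b ⊗ X (a + 1)%N) ⊚ ((one_ b ⊗ m a 1) ⊚ (ci b a ⊗ one_ 1) ⊚ (one_ a ⊗ ci b 1)));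
  first mon.
by have [<- _] := ci_mg a 1 b; mon.
Qed.

Lemma dots_cr X : dots x X -> forall a b, (X b ⊗ one_ a) ⊚ c a b = ci b a ⊚ (one_ a ⊗ X b).
Proof.
move=> D a b; have Xt n : typed (X n) _ _ := dots_ty D n.
transitivity (ci b a ⊚ (c b a ⊚ (X b ⊗ one_ a)) ⊚ c a b).
  by rewrite cmpA crK; mon.
rewrite cr_dots //.
transitivity (ci b a ⊚ (one_ a ⊗ X b) ⊚ (ci a b ⊚ c a b)); first mon.
by rewrite crK; mon.
Qed.

End Affine.

(** * Red strands *)

Record schur (k : fieldType) (q : k) (M : calc k) (W : affine q M) (v : k) := SchurCalc {
  rd : cob M;
  ru : nat -> car M;
  ld : nat -> car M;
  ru_ty : forall a, ty (ru a) (st a ⋅ rd) (rd ⋅ st a);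
  ld_ty : forall a, ty (ld a) (rd ⋅ st a) (st a ⋅ rd);
  ru0 : ru 0 = cid rd;
  ld0 : ld 0 = cid rd;
  ld_mg : forall a b, ld (a + b) ⊚ (cid rd ⊗ mg W a b)
    = (mg W a b ⊗ cid rd) ⊚ (cid (st a) ⊗ ld b) ⊚ (ld a ⊗ cid (st b));
  ru_mg : forall a b, ru (a + b) ⊚ (mg W a b ⊗ cid rd)
    = (cid rd ⊗ mg W a b) ⊚ (ru a ⊗ cid (st b)) ⊚ (cid (st a) ⊗ ru b);
  ld_ru1 : br (st 1 ⋅ rd) (st 1 ⋅ rd) (ld 1 ⊚ ru 1)
    = 1 *: br (st 1 ⋅ rd) (st 1 ⋅ rd) (dx W ⊗ cid rd)
    + - v *: br (st 1 ⋅ rd) (st 1 ⋅ rd) (cid (st 1 ⋅ rd));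
  ru_ld1 : br (rd ⋅ st 1) (rd ⋅ st 1) (ru 1 ⊚ ld 1)
    = 1 *: br (rd ⋅ st 1) (rd ⋅ st 1) (cid rd ⊗ dx W)
    + - v *: br (rd ⋅ st 1) (rd ⋅ st 1) (cid (rd ⋅ st 1));
  ld_cr_ru1 : br (st 1 ⋅ rd ⋅ st 1) (st 1 ⋅ rd ⋅ st 1)
      ((ld 1 ⊗ cid (st 1)) ⊚ (cid rd ⊗ cr W 1 1) ⊚ (ru 1 ⊗ cid (st 1)))
    = 1 *: br (st 1 ⋅ rd ⋅ st 1) (st 1 ⋅ rd ⋅ st 1)
        ((cid (st 1) ⊗ ru 1) ⊚ (cr W 1 1 ⊗ cid rd) ⊚ (cid (st 1) ⊗ ld 1))
    + - (q^-1 - q) *: br (st 1 ⋅ rd ⋅ st 1) (st 1 ⋅ rd ⋅ st 1) (cid (st 1) ⊗ cid rd ⊗ dx W)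
}.
#[export] Instance ru_typed k q M (W : @affine k q M) v (S : schur W v) a : typed (ru S a) _ _ :=
  ru_ty S a.
#[export] Instance ld_typed k q M (W : @affine k q M) v (S : schur W v) a : typed (ld S a) _ _ :=
  ld_ty S a.

Lemma scale_cancel2 (k : fieldType) (V : lmodType k) (z a b : k) (x y w : V) : z != 0 ->
  z *: x = a *: (z *: y) + b *: (z *: w) -> x = a *: y + b *: w.
Proof.
move=> z0 e; apply: (scalerI z0); rewrite e scalerDr !scalerA.
by rewrite ![z * _]mulrC.
Qed.

Lemma br_contextn (k : fieldType) (M : calc k) (n : nat) (a : 'I_n -> k) (y E : 'I_n -> car M)
  (z f g F : car M) A B X Y (w w' : cob M) :
  br A B z = \sum_i a i *: br A B (y i) -> ty z A B -> (forall i, ty (y i) A B) ->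
  ty f (w ⋅ B ⋅ w') Y -> ty g X (w ⋅ A ⋅ w') ->
  F = f ⊚ (cid w ⊗ z ⊗ cid w') ⊚ g -> (forall i, E i = f ⊚ (cid w ⊗ y i ⊗ cid w') ⊚ g) ->
  br X Y F = \sum_i a i *: br X Y (E i).
Proof.
move=> e zT yT fT gT -> eE; rewrite (br_context e zT _ fT gT) //.
by apply: eq_bigr => i _; rewrite eE.
Qed.

Ltac ctxn e ff uu vv gg :=
  refine (br_contextn (f := ff) (w := uu) (w' := vv) (g := gg) e _ _ _ _ _ _);
  [typ | intro | typ | typ | mon | intro].

(** * Relation S2 for thick strands *)

Section Traverses.
Variables (k : fieldType) (q : k) (q0 : q != 0) (qn0 : forall n, qint q n.+1 != 0).
Variables (M : calc k) (W : affine q M) (v : k) (S : schur W v).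
Variables (X : nat -> car M) (D : dots W (dx W) X).
Let q1 := qn0 0.
#[local] Instance X_typed n : typed (X n) _ _ := dots_ty D n.

Local Notation m := (mg W).
Local Notation s := (sp W).
Local Notation c := (cr W).
Local Notation ci := (ci W).
Local Notation x := (dx W).
Local Notation u := (ru S).
Local Notation d := (ld S).
Local Notation "∥" := (rd S).
Local Notation one_ n := (@cid _ M (st n)).
Local Notation ID A := (@cid _ M A).
Local Notation st n := (@st _ M n).
Local Notation "𝟙" := (@one _ M).

(* Precomposition with a merge is injective: the split inverts it up to a nonzero scalar. *)
Lemma epi_lin n (w w' : cob M) A A' Y :
  A = w ⋅ (st n ⋅ st 1) ⋅ w' -> A' = w ⋅ st (n + 1) ⋅ w' ->
  exists phi : {linear ho A Y -> ho A' Y}, forall f F, ty f A' Y ->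
    F = f ⊚ (cid w ⊗ m n 1 ⊗ cid w') -> phi (br A Y F) = qint q n.+1 *: br A' Y f.
Proof.
move=> -> ->.
have gT : ty (cid w ⊗ s n 1 ⊗ cid w') (w ⋅ st (n + 1) ⋅ w') (w ⋅ (st n ⋅ st 1) ⋅ w') by typ.
have [phi phiE] := lin_cmpl Y gT.
exists phi => f F fT ->; have ft : typed f _ _ := fT.
rewrite phiE; last typ.
by ctx1 (mgsp_n1 W n) f w w' (ID (w ⋅ st (n + 1) ⋅ w')).
Qed.

(* The morphism omega_{r+t,r} of the paper. *)
Definition Om r t := m r t ⊚ (X r ⊗ one_ t) ⊚ s r t.

(** Insert c_{1,n} and its inverse below the merge. The dot makes the inverse crossing positive as
    it passes, and the two positive crossings, absorbed by the merge and the split, contribute q^-n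
    each. *)
Lemma mg_1dx_sp n : br (st (n + 1)) (st (n + 1)) (m n 1 ⊚ (one_ n ⊗ x) ⊚ s n 1)
  = q ^- (2 * n) *: br (st (n + 1)) (st (n + 1)) (m 1 n ⊚ (x ⊗ one_ n) ⊚ s 1 n).
Proof.
set T := st (n + 1).
have e : m n 1 ⊚ (one_ n ⊗ x) ⊚ s n 1 = m n 1 ⊚ c 1 n ⊚ (x ⊗ one_ n) ⊚ (c n 1 ⊚ s n 1).
  transitivity (m n 1 ⊚ c 1 n ⊚ ((x ⊗ one_ n) ⊚ c n 1) ⊚ s n 1); last mon.
  have := dots_cr q0 qn0 D n 1; rewrite (dots1 qn0 D) => ->.
  transitivity (m n 1 ⊚ (c 1 n ⊚ ci 1 n) ⊚ (one_ n ⊗ x) ⊚ s n 1); last mon.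
  by rewrite crVK; mon.
transitivity (q ^- n *: br T T (m 1 n ⊚ (x ⊗ one_ n) ⊚ (c n 1 ⊚ s n 1))).
  by rewrite e; ctx1 (mg_cr_1n q0 qn0 W n) (ID T) 𝟙 𝟙 ((x ⊗ one_ n) ⊚ (c n 1 ⊚ s n 1)).
rewrite mul2n -addnn exprD invfM -scalerA; congr (_ *: _).
by ctx1 (cr_sp_n1 q0 qn0 W n) (m 1 n ⊚ (x ⊗ one_ n)) 𝟙 𝟙 (ID T).
Qed.

(** Carrying the thin dot past the undotted strand of thickness t costs q^-(2t); joining it to X r
    gives [r+1]. *)
Lemma Om_dx r t : br (st (r + t + 1)) (st (r + t + 1)) (m (r + t) 1 ⊚ (Om r t ⊗ x) ⊚ s (r + t) 1)
  = (q ^- (2 * t) * qint q r.+1) *: br (st (r + t + 1)) (st (r + t + 1)) (Om r.+1 t).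
Proof.
rewrite /Om -scalerA; set T := st (r + t + 1).
transitivity (q ^- (2 * t) *: br T T (m (r + 1) t ⊚ ((m r 1 ⊚ (X r ⊗ x) ⊚ s r 1) ⊗ one_ t)
  ⊚ s (r + 1) t)); last first.
  by congr (_ *: _); ctx1 (dotsS D r) (m (r + 1) t) 𝟙 (st t) (s (r + 1) t).
have -> : br T T (m (r + t) 1 ⊚ ((m r t ⊚ (X r ⊗ one_ t) ⊚ s r t) ⊗ x) ⊚ s (r + t) 1)
  = q ^- (2 * t) *: br T T (m r (1 + t) ⊚ (X r ⊗ (m 1 t ⊚ (x ⊗ one_ t) ⊚ s 1 t)) ⊚ s r (1 + t)).
  have -> : m (r + t) 1 ⊚ ((m r t ⊚ (X r ⊗ one_ t) ⊚ s r t) ⊗ x) ⊚ s (r + t) 1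
    = m r (t + 1) ⊚ (X r ⊗ (m t 1 ⊚ (one_ t ⊗ x) ⊚ s t 1)) ⊚ s r (t + 1).
    transitivity ((m (r + t) 1 ⊚ (m r t ⊗ one_ 1)) ⊚ (X r ⊗ one_ t ⊗ x) ⊚ ((s r t ⊗ one_ 1)
      ⊚ s (r + t) 1)); first mon.
    by rewrite mgA spA; mon.
  by ctx1 (mg_1dx_sp t) (m r (t + 1)) (st r) 𝟙 ((X r ⊗ one_ (t + 1)) ⊚ s r (t + 1)).
congr (_ *: br _ _ _).
transitivity ((m r (1 + t) ⊚ (one_ r ⊗ m 1 t)) ⊚ (X r ⊗ x ⊗ one_ t) ⊚ ((one_ r ⊗ s 1 t)
  ⊚ s r (1 + t))); first mon.
by rewrite -mgA -spA; mon.
Qed.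

(** The thin strand joins the undotted one, and the bubble so formed is [t+1]. *)
Lemma Om_1 r t : br (st (r + t + 1)) (st (r + t + 1)) (m (r + t) 1 ⊚ (Om r t ⊗ one_ 1)
  ⊚ s (r + t) 1)
  = qint q t.+1 *: br (st (r + t + 1)) (st (r + t + 1)) (Om r t.+1).
Proof.
rewrite /Om; set T := st (r + t + 1).
have -> : m (r + t) 1 ⊚ ((m r t ⊚ (X r ⊗ one_ t) ⊚ s r t) ⊗ one_ 1) ⊚ s (r + t) 1
  = m r (t + 1) ⊚ (X r ⊗ (m t 1 ⊚ s t 1)) ⊚ s r (t + 1).
  transitivity ((m (r + t) 1 ⊚ (m r t ⊗ one_ 1)) ⊚ (X r ⊗ one_ t ⊗ one_ 1) ⊚ ((s r t ⊗ one_ 1)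
    ⊚ s (r + t) 1)); first mon.
  by rewrite mgA spA; mon.
by ctx1 (mgsp_n1 W t) (m r (t + 1)) (st r) 𝟙 ((X r ⊗ one_ (t + 1)) ⊚ s r (t + 1)).
Qed.

(* The coefficients of S2. *)
Definition zeta a t : k := (-1) ^+ t * q ^- (t * (a - t)) * v ^+ t.

(** Put a + 1 = t + n. In [t+n] = q^n [t] + q^-t [n] the second summand comes from attaching a
    dotted thin strand at index t, the first from attaching an undotted one at index t - 1. *)
Lemma zeta_sum (V : lmodType k) (B : nat -> V) a :
  \sum_(t < a.+1) zeta a t *: ((q ^- (2 * t) * qint q (a - t).+1) *: B t
      + - v *: (qint q t.+1 *: B t.+1))
  = qint q a.+1 *: \sum_(t < a.+2) zeta a.+1 t *: B t.
Proof.
pose P t := zeta a t * q ^- (2 * t) * qint q (a.+1 - t).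
pose Q t := if t is t'.+1 then - v * zeta a t' * qint q t else 0.
transitivity (\sum_(t < a.+2) P t *: B t + \sum_(t < a.+2) Q t *: B t).
  (* Both sums gain one term to share the range t < a + 2: the extra [P] contains [0], and [Q] is 0
     at t = 0. *)
  rewrite [X in X + _]big_ord_recr [X in _ + X]big_ord_recl /= /P subnn qint0 mulr0 !scale0r addr0
    add0r.
  rewrite -big_split /=; apply: eq_bigr => t _.
  rewrite scalerDr !scalerA subSn -1?ltnS // mulrA; congr (_ + _ *: _).
  by rewrite [zeta a t * _]mulrC.
rewrite -big_split scaler_sumr /=; apply: eq_bigr => -[t lt] _ /=.
rewrite -scalerDl scalerA; congr (_ *: _).
rewrite /P /Q /zeta; have [n en] : exists n, (a.+1 = t + n)%N by exists (a.+1 - t)%N; lia.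
have qt j : q ^+ j != 0 by rewrite expf_neq0.
rewrite en addKn (qintD q0 q1) mulrDl [q ^+ n * _ * _ + _]addrC; congr (_ + _).
  case: n en => [|n] en; first by rewrite qint0 !(mulr0, mul0r).
  have -> : (a - t = n)%N by lia.
  rewrite mulnS -[(2 * t)%N]/(t + (t + 0))%N addn0 !exprD.
  by field; rewrite !qt.
case: t lt en => [|t] lt en; first by rewrite qint0 mulr0 mul0r.
have -> : (a - t = n)%N by lia.
rewrite mulSn exprD [(-1) ^+ t.+1]exprS [v ^+ t.+1]exprS.
by field; rewrite !qt.
Qed.

#[local] Instance Om_typed r t : typed (Om r t) (st (r + t)) (st (r + t)).
Proof. by rewrite /typed /Om; typ. Qed.

(** [a+1] times the left side opens a bubble m s, whose legs are pulled through both traverses by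
    S1. The pair of thickness a is then the inner one: the induction hypothesis resolves it, which
    brings the thin pair together. *)
Lemma ld_ru a : br (st a ⋅ ∥) (st a ⋅ ∥) (d a ⊚ u a)
  = \sum_(t < a.+1) zeta a t *: br (st a ⋅ ∥) (st a ⋅ ∥) (Om (a - t) t ⊗ cid ∥).
Proof.
elim: a => [|a IH].
  rewrite big_ord1 /zeta /= sub0n !expr0 invr1 !mulr1 scale1r /Om (dots0 D) mg0n sp0n ru0 ld0.
  by congr br; mon.
pose T := st a.+1 ⋅ ∥.
have Ot (i : 'I_a.+1) : typed (Om (a - i) i) (st a) (st a).
  by have := Om_typed (a - i) i; rewrite subnK // -ltnS.
apply: (scalerI (qn0 a)); rewrite -(zeta_sum (fun t => br T T (Om (a.+1 - t) t ⊗ cid ∥))).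
transitivity (br T T ((m a 1 ⊗ cid ∥) ⊚ (one_ a ⊗ d 1) ⊚ ((d a ⊚ u a) ⊗ one_ 1) ⊚ (one_ a ⊗ u 1)
  ⊚ (s a 1 ⊗ cid ∥))).
  symmetry.
  have -> : (m a 1 ⊗ cid ∥) ⊚ (one_ a ⊗ d 1) ⊚ ((d a ⊚ u a) ⊗ one_ 1) ⊚ (one_ a ⊗ u 1)
    ⊚ (s a 1 ⊗ cid ∥)
    = d (a + 1) ⊚ u (a + 1) ⊚ ((m a 1 ⊚ s a 1) ⊗ cid ∥).
    transitivity (((m a 1 ⊗ cid ∥) ⊚ (one_ a ⊗ d 1) ⊚ (d a ⊗ one_ 1)) ⊚ (u a ⊗ one_ 1)
      ⊚ (one_ a ⊗ u 1) ⊚ (s a 1 ⊗ cid ∥)); first mon.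
    rewrite -ld_mg.
    transitivity (d (a + 1) ⊚ ((cid ∥ ⊗ m a 1) ⊚ (u a ⊗ one_ 1) ⊚ (one_ a ⊗ u 1))
      ⊚ (s a 1 ⊗ cid ∥)); first mon.
    by rewrite -ru_mg; mon.
  by ctx1 (mgsp_n1 W a) (d (a + 1) ⊚ u (a + 1)) 𝟙 ∥ (ID T).
transitivity (\sum_(t < a.+1) zeta a t *: br T T ((m a 1 ⊗ cid ∥) ⊚ (one_ a ⊗ d 1) ⊚ (Om (a - t) t
  ⊗ cid ∥ ⊗ one_ 1) ⊚ (one_ a ⊗ u 1) ⊚ (s a 1 ⊗ cid ∥))).
  ctxn IH ((m a 1 ⊗ cid ∥) ⊚ (one_ a ⊗ d 1)) 𝟙 (st 1) ((one_ a ⊗ u 1) ⊚ (s a 1 ⊗ cid ∥)).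
    by typ.
  by mon.
apply: eq_bigr => t _; congr (_ *: _).
transitivity (1 *: br T T ((m a 1 ⊚ (Om (a - t) t ⊗ x) ⊚ s a 1) ⊗ cid ∥)
  + - v *: br T T ((m a 1 ⊚ (Om (a - t) t ⊗ one_ 1) ⊚ s a 1) ⊗ cid ∥)).
  by ctx2 (ld_ru1 S) ((m a 1 ⊗ cid ∥) ⊚ (Om (a - t) t ⊗ one_ 1 ⊗ cid ∥)) (st a) 𝟙 (s a 1 ⊗ cid ∥).
rewrite scale1r; case: t => t /=; rewrite ltnS => le {Ot}.
have [r ar] : exists r, (a = r + t)%N by exists (a - t)%N; rewrite subnK.
subst a; rewrite subSS subSn // addnK; congr (_ + _ *: _).
  by ctx1 (Om_dx r t) (ID T) 𝟙 ∥ (ID T).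
by ctx1 (Om_1 r t) (ID T) 𝟙 ∥ (ID T).
Qed.

(** Here the thin pair is the inner one, so it is resolved before the induction hypothesis
    applies. *)
Lemma ru_ld a : br (∥ ⋅ st a) (∥ ⋅ st a) (u a ⊚ d a)
  = \sum_(t < a.+1) zeta a t *: br (∥ ⋅ st a) (∥ ⋅ st a) (cid ∥ ⊗ Om (a - t) t).
Proof.
elim: a => [|a IH].
  rewrite big_ord1 /zeta /= sub0n !expr0 invr1 !mulr1 scale1r /Om (dots0 D) mg0n sp0n ru0 ld0.
  by congr br; mon.
pose T := ∥ ⋅ st a.+1.
have Ot (i : 'I_a.+1) : typed (Om (a - i) i) (st a) (st a).
  by have := Om_typed (a - i) i; rewrite subnK // -ltnS.
apply: (scalerI (qn0 a)); rewrite -(zeta_sum (fun t => br T T (cid ∥ ⊗ Om (a.+1 - t) t))).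
transitivity (br T T ((cid ∥ ⊗ m a 1) ⊚ (u a ⊗ one_ 1) ⊚ (one_ a ⊗ (u 1 ⊚ d 1)) ⊚ (d a ⊗ one_ 1)
  ⊚ (cid ∥ ⊗ s a 1))).
  symmetry.
  have -> : (cid ∥ ⊗ m a 1) ⊚ (u a ⊗ one_ 1) ⊚ (one_ a ⊗ (u 1 ⊚ d 1)) ⊚ (d a ⊗ one_ 1)
    ⊚ (cid ∥ ⊗ s a 1)
    = u (a + 1) ⊚ d (a + 1) ⊚ (cid ∥ ⊗ (m a 1 ⊚ s a 1)).
    transitivity (((cid ∥ ⊗ m a 1) ⊚ (u a ⊗ one_ 1) ⊚ (one_ a ⊗ u 1)) ⊚ (one_ a ⊗ d 1)
      ⊚ (d a ⊗ one_ 1) ⊚ (cid ∥ ⊗ s a 1)); first mon.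
    rewrite -ru_mg.
    transitivity (u (a + 1) ⊚ ((m a 1 ⊗ cid ∥) ⊚ (one_ a ⊗ d 1) ⊚ (d a ⊗ one_ 1))
      ⊚ (cid ∥ ⊗ s a 1)); first mon.
    by rewrite -ld_mg; mon.
  by ctx1 (mgsp_n1 W a) (u (a + 1) ⊚ d (a + 1)) ∥ 𝟙 (ID T).
transitivity (1 *: br T T ((cid ∥ ⊗ m a 1) ⊚ ((u a ⊚ d a) ⊗ x) ⊚ (cid ∥ ⊗ s a 1))
    + - v *: br T T ((cid ∥ ⊗ m a 1) ⊚ ((u a ⊚ d a) ⊗ one_ 1) ⊚ (cid ∥ ⊗ s a 1))).
  by ctx2 (ru_ld1 S) ((cid ∥ ⊗ m a 1) ⊚ (u a ⊗ one_ 1)) (st a) 𝟙 ((d a ⊗ one_ 1) ⊚ (cid ∥ ⊗ s a 1)).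
have -> : br T T ((cid ∥ ⊗ m a 1) ⊚ ((u a ⊚ d a) ⊗ x) ⊚ (cid ∥ ⊗ s a 1))
  = \sum_(t < a.+1) zeta a t *: br T T (cid ∥ ⊗ (m a 1 ⊚ (Om (a - t) t ⊗ x) ⊚ s a 1)).
  ctxn IH (cid ∥ ⊗ m a 1) 𝟙 (st 1) ((cid ∥ ⊗ one_ a ⊗ x) ⊚ (cid ∥ ⊗ s a 1)); first by typ.
  by mon.
have -> : br T T ((cid ∥ ⊗ m a 1) ⊚ ((u a ⊚ d a) ⊗ one_ 1) ⊚ (cid ∥ ⊗ s a 1))
  = \sum_(t < a.+1) zeta a t *: br T T (cid ∥ ⊗ (m a 1 ⊚ (Om (a - t) t ⊗ one_ 1) ⊚ s a 1)).
  ctxn IH (cid ∥ ⊗ m a 1) 𝟙 (st 1) (cid ∥ ⊗ s a 1); first by typ.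
  by mon.
rewrite scale1r scaler_sumr -big_split; apply: eq_bigr => t _ /=.
rewrite [- v *: (_ *: _)]scalerA [- v * _]mulrC -[(zeta _ _ * - v) *: _]scalerA -scalerDr;
  congr (_ *: _).
case: t => t /=; rewrite ltnS => le {Ot}.
have [r ar] : exists r, (a = r + t)%N by exists (a - t)%N; rewrite subnK.
subst a; rewrite subSS subSn // addnK; congr (_ + _ *: _).
  by ctx1 (Om_dx r t) (ID T) ∥ 𝟙 (ID T).
by ctx1 (Om_1 r t) (ID T) ∥ 𝟙 (ID T).
Qed.

(** * Relation S3 for thick strands *)

Lemma mg_ci_1n n : br (st n ⋅ st 1) (st (n + 1)) (m 1 n ⊚ ci 1 n)
  = q ^+ n *: br (st n ⋅ st 1) (st (n + 1)) (m n 1).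
Proof.
have qt : q ^+ n != 0 by rewrite expf_neq0.
apply: (scalerI (invr_neq0 qt)); rewrite scalerA mulVf // scale1r.
have -> : m n 1 = m n 1 ⊚ c 1 n ⊚ ci 1 n by rewrite -cmpA crVK; mon.
by symmetry; ctx1 (mg_cr_1n q0 qn0 W n) (ID (st (n + 1))) 𝟙 𝟙 (ci 1 n).
Qed.

(* The two sides of S3: [Lh a b], and the sum over r of [alpha r] times [Tw r (a - r) (b - r) _],
   whose middle part is [Bm]; in [Tw] the lower right split is a parameter w, to be varied in
   the induction on b. *)
Definition Lh a b := (d b ⊗ one_ a) ⊚ (cid ∥ ⊗ c a b) ⊚ (u a ⊗ one_ b).
Definition Bm a b := (one_ b ⊗ u a) ⊚ (c a b ⊗ cid ∥) ⊚ (one_ a ⊗ d b).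
Definition Tw r a b w := (m r b ⊗ cid ∥ ⊗ m a r) ⊚ (one_ r ⊗ Bm a b ⊗ X r) ⊚ (s r a ⊗ cid ∥ ⊗ w).
Definition T1 a := (cid (st 1 ⋅ ∥) ⊗ m a 1) ⊚ (one_ 1 ⊗ u a ⊗ x) ⊚ (s 1 a ⊗ cid ∥ ⊗ one_ 1).
#[local] Instance Lh_typed a b : typed (Lh a b) (st a ⋅ ∥ ⋅ st b) (st b ⋅ ∥ ⋅ st a).
Proof. by rewrite /typed /Lh; typ. Qed.
#[local] Instance Bm_typed a b : typed (Bm a b) (st a ⋅ ∥ ⋅ st b) (st b ⋅ ∥ ⋅ st a).
Proof. by rewrite /typed /Bm; typ. Qed.
#[local] Instance T1_typed a : typed (T1 a) (st a.+1 ⋅ ∥ ⋅ st 1) (st 1 ⋅ ∥ ⋅ st a.+1).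
Proof. by rewrite /typed /T1; typ. Qed.
Local Notation κ := (- (q^-1 - q)).

(** S3 for b = 1, tested on the merge [N]. The induction hypothesis and the thin S3 give D11 + κ D12
    + κ q D22. As D11 is the leading term composed with [N], it remains that D12 + q D22 is the
    expansion by W2 of [T1 a.+1] composed with [N]. *)
Lemma Lh_Sn1 a : br (st a.+1 ⋅ ∥ ⋅ st 1) (st 1 ⋅ ∥ ⋅ st a.+1) (Lh a.+1 1)
  = 1 *: br (st a.+1 ⋅ ∥ ⋅ st 1) (st 1 ⋅ ∥ ⋅ st a.+1) (Bm a.+1 1)
  + κ *: br (st a.+1 ⋅ ∥ ⋅ st 1) (st 1 ⋅ ∥ ⋅ st a.+1) (T1 a).
Proof.
elim: a => [|a IH].
  rewrite /T1 mg0n spn0 ru0 (ld_cr_ru1 S); congr (_ + _ *: br _ _ _); mon.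
pose A := st a.+1 ⋅ st 1 ⋅ ∥ ⋅ st 1; pose B := st 1 ⋅ ∥ ⋅ st a.+2.
pose N := m a.+1 1 ⊗ cid (∥ ⋅ st 1).
have D0 : Lh a.+2 1 ⊚ N = (cid (st 1 ⋅ ∥) ⊗ m a.+1 1) ⊚ (Lh a.+1 1 ⊗ one_ 1) ⊚ (cid (st a.+1 ⋅ ∥)
  ⊗ c 1 1) ⊚ (one_ a.+1 ⊗ u 1 ⊗ one_ 1).
  rewrite /Lh /N.
  transitivity ((d 1 ⊗ one_ (a.+1 + 1)) ⊚ (cid ∥ ⊗ c (a.+1 + 1) 1)
    ⊚ ((u (a.+1 + 1) ⊚ (m a.+1 1 ⊗ cid ∥)) ⊗ one_ 1)); first mon.
  rewrite ru_mg.
  transitivity ((d 1 ⊗ one_ (a.+1 + 1)) ⊚ (cid ∥ ⊗ (c (a.+1 + 1) 1 ⊚ (m a.+1 1 ⊗ one_ 1)))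
    ⊚ (((u a.+1 ⊗ one_ 1) ⊚ (one_ a.+1 ⊗ u 1)) ⊗ one_ 1)); first mon.
  by have [-> _] := slide_mg W a.+1 1 1; mon.
pose D2 := (cid (st 1 ⋅ ∥) ⊗ m a.+1 1) ⊚ (T1 a ⊗ one_ 1) ⊚ (cid (st a.+1 ⋅ ∥) ⊗ c 1 1)
  ⊚ (one_ a.+1 ⊗ u 1 ⊗ one_ 1).
pose D11 := Bm a.+2 1 ⊚ N.
pose D12 := (cid (st 1 ⋅ ∥) ⊗ m a.+1 1) ⊚ (one_ 1 ⊗ u a.+1 ⊗ x) ⊚ (c a.+1 1 ⊗ cid ∥ ⊗ one_ 1).
pose D22 := (cid (st 1 ⋅ ∥) ⊗ m a.+1 1) ⊚ (one_ 1 ⊗ u a.+1 ⊗ x)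
  ⊚ (((one_ 1 ⊗ m a 1) ⊚ (s 1 a ⊗ one_ 1)) ⊗ cid ∥ ⊗ one_ 1).
have E0 : br A B (Lh a.+2 1 ⊚ N) = 1 *: br A B ((cid (st 1 ⋅ ∥) ⊗ m a.+1 1) ⊚ (Bm a.+1 1 ⊗ one_ 1)
  ⊚ (cid (st a.+1 ⋅ ∥) ⊗ c 1 1) ⊚ (one_ a.+1 ⊗ u 1 ⊗ one_ 1)) + κ *: br A B D2.
  rewrite D0 /D2.
  by ctx2 IH (cid (st 1 ⋅ ∥) ⊗ m a.+1 1) 𝟙 (st 1) ((cid (st a.+1 ⋅ ∥) ⊗ c 1 1) ⊚ (one_ a.+1 ⊗ u 1
    ⊗ one_ 1)).
have E1 : br A B ((cid (st 1 ⋅ ∥) ⊗ m a.+1 1) ⊚ (Bm a.+1 1 ⊗ one_ 1) ⊚ (cid (st a.+1 ⋅ ∥) ⊗ c 1 1)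
  ⊚ (one_ a.+1 ⊗ u 1 ⊗ one_ 1))
    = 1 *: br A B D11 + κ *: br A B D12.
  have -> : D11 = (cid (st 1 ⋅ ∥) ⊗ m a.+1 1) ⊚ (one_ 1 ⊗ u a.+1 ⊗ one_ 1) ⊚ (c a.+1 1 ⊗ cid ∥
    ⊗ one_ 1) ⊚ (one_ a.+1 ⊗ Bm 1 1).
    rewrite /D11 /Bm /N.
    transitivity ((one_ 1 ⊗ u (a.+1 + 1)) ⊚ ((c (a.+1 + 1) 1 ⊚ (m a.+1 1 ⊗ one_ 1)) ⊗ cid ∥)
      ⊚ (cid (st a.+1 ⋅ st 1) ⊗ d 1)); first mon.
    have [-> _] := slide_mg W a.+1 1 1.
    transitivity ((one_ 1 ⊗ (u (a.+1 + 1) ⊚ (m a.+1 1 ⊗ cid ∥))) ⊚ (c a.+1 1 ⊗ cid (st 1 ⋅ ∥))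
      ⊚ (one_ a.+1 ⊗ c 1 1 ⊗ cid ∥) ⊚ (cid (st a.+1 ⋅ st 1) ⊗ d 1)); first mon.
    by rewrite ru_mg; mon.
  rewrite /D12 /Bm.
  by ctx2 (ld_cr_ru1 S) ((cid (st 1 ⋅ ∥) ⊗ m a.+1 1) ⊚ (one_ 1 ⊗ u a.+1 ⊗ one_ 1)
    ⊚ (c a.+1 1 ⊗ cid ∥ ⊗ one_ 1)) (st a.+1) 𝟙 (ID A).
(* The dot makes the thin crossing below it negative, and the merge of the two thin strands absorbs
   this crossing with a factor q. *)
have E2 : br A B D2 = q *: br A B D22.
  pose R := (one_ 1 ⊗ u a ⊗ one_ 1 ⊗ x) ⊚ (s 1 a ⊗ u 1 ⊗ one_ 1).
  have -> : D2 = (cid (st 1 ⋅ ∥) ⊗ m a (1 + 1)) ⊚ (cid (st 1 ⋅ ∥ ⋅ st a) ⊗ (m 1 1 ⊚ ci 1 1)) ⊚ R.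
    rewrite /D2 /T1.
    transitivity ((cid (st 1 ⋅ ∥) ⊗ (m (a + 1) 1 ⊚ (m a 1 ⊗ one_ 1))) ⊚ (one_ 1 ⊗ u a
      ⊗ ((x ⊗ one_ 1) ⊚ c 1 1)) ⊚ (s 1 a ⊗ u 1 ⊗ one_ 1)); first mon.
    by rewrite mgA dx_cr /R; mon.
  have -> : D22 = (cid (st 1 ⋅ ∥) ⊗ m a (1 + 1)) ⊚ (cid (st 1 ⋅ ∥ ⋅ st a) ⊗ m 1 1) ⊚ R.
    rewrite /D22 /R.
    transitivity ((cid (st 1 ⋅ ∥) ⊗ m a.+1 1) ⊚ (one_ 1 ⊗ (u (a + 1) ⊚ (m a 1 ⊗ cid ∥)) ⊗ x)
      ⊚ (s 1 a ⊗ cid (st 1 ⋅ ∥ ⋅ st 1))); first mon.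
    rewrite ru_mg.
    transitivity ((cid (st 1 ⋅ ∥) ⊗ (m (a + 1) 1 ⊚ (m a 1 ⊗ one_ 1)))
      ⊚ (one_ 1 ⊗ ((u a ⊗ one_ 1) ⊚ (one_ a ⊗ u 1)) ⊗ x) ⊚ (s 1 a ⊗ cid (st 1 ⋅ ∥ ⋅ st 1)));
      first mon.
    by rewrite mgA; mon.
  have e := mg_ci_1n 1; rewrite expr1 in e.
  by rewrite /R; ctx1 e (cid (st 1 ⋅ ∥) ⊗ m a (1 + 1)) (st 1 ⋅ ∥ ⋅ st a) 𝟙 ((one_ 1 ⊗ u a ⊗ one_ 1
    ⊗ x) ⊚ (s 1 a ⊗ u 1 ⊗ one_ 1)).
have E3 : br A B (T1 a.+1 ⊚ N) = 1 *: br A B D12 + q *: br A B D22.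
  rewrite /D12 /D22 /T1 /N.
  by ctx2 (sp1n_mgn1 W a) ((cid (st 1 ⋅ ∥) ⊗ m a.+1 1) ⊚ (one_ 1 ⊗ u a.+1 ⊗ x)) 𝟙 (∥ ⋅ st 1) (ID A).
have E : br A B (Lh a.+2 1 ⊚ N) = 1 *: br A B (Bm a.+2 1 ⊚ N) + κ *: br A B (T1 a.+1 ⊚ N).
  by rewrite E0 E1 E2 E3 scalerDr !scale1r scalerDr addrA.
have [phi phiE] := @epi_lin a.+1 𝟙 (∥ ⋅ st 1) A (st a.+2 ⋅ ∥ ⋅ st 1) B ltac:(obj) ltac:(obj).
move/(congr1 phi): E; rewrite linearD !linearZ /=.
rewrite (phiE (Lh a.+2 1)); [|typ|by rewrite /N; mon].
rewrite (phiE (Bm a.+2 1)); [|typ|by rewrite /N; mon].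
rewrite (phiE (T1 a.+1)); [|typ|by rewrite /N; mon].
exact: (scale_cancel2 (qn0 a.+1)).
Qed.

Lemma Lh_step a b : Lh a (b + 1) ⊚ (cid (st a ⋅ ∥) ⊗ m b 1)
  = (m b 1 ⊗ cid (∥ ⋅ st a)) ⊚ (one_ b ⊗ ((d 1 ⊗ one_ a) ⊚ (cid ∥ ⊗ c a 1))) ⊚ (Lh a b ⊗ one_ 1).
Proof.
rewrite /Lh.
transitivity ((d (b + 1) ⊗ one_ a) ⊚ (cid ∥ ⊗ (c a (b + 1) ⊚ (one_ a ⊗ m b 1))) ⊚ (u a ⊗ one_ b
  ⊗ one_ 1)); first mon.
have [_ ->] := slide_mg W a b 1.
transitivity (((d (b + 1) ⊚ (cid ∥ ⊗ m b 1)) ⊗ one_ a) ⊚ (cid (∥ ⋅ st b) ⊗ c a 1) ⊚ (cid ∥ ⊗ c a b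
  ⊗ one_ 1) ⊚ (u a ⊗ one_ b ⊗ one_ 1)); first mon.
by rewrite ld_mg; mon.
Qed.

(** Lower right parts that occur when a thin strand is added. [wU] and [wZ] are the terms of W2 that
    cross and do not cross the thin strand; [wUV] is [wU] after a dot has made its crossing
    negative. *)
Definition wU r b := (m b 1 ⊗ one_ r) ⊚ (one_ b ⊗ c r 1) ⊚ (s b r ⊗ one_ 1).
Definition wUV r b := (m b 1 ⊗ one_ r) ⊚ (one_ b ⊗ ci 1 r) ⊚ (s b r ⊗ one_ 1).
Definition wZ r b := (one_ b ⊗ m r 1) ⊚ (s b r ⊗ one_ 1).

(** The new thin strand slides past the merge of a and r and then past the dot. This exposes
    [Lh a 1], to which the case b = 1 of S3 applies, and leaves a negative crossing with the strand
    r. *)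
Lemma Lh_step_Tw r a b :
  (m (r + b) 1 ⊗ cid (∥ ⋅ st (r + a)))
    ⊚ (one_ (r + b) ⊗ ((d 1 ⊗ one_ (r + a)) ⊚ (cid ∥ ⊗ c (r + a) 1))) ⊚ (Tw r a b (s b r) ⊗ one_ 1)
  = (m (r + b) 1 ⊗ cid (∥ ⋅ st (r + a))) ⊚ (m r b ⊗ one_ 1 ⊗ cid ∥ ⊗ m a r)
    ⊚ (cid (st r ⋅ st b) ⊗ Lh a 1 ⊗ one_ r)
    ⊚ ((one_ r ⊗ ((c a b ⊗ cid ∥) ⊚ (one_ a ⊗ d b)) ⊗ ((one_ 1 ⊗ X r) ⊚ ci 1 r)) ⊚ (s r a ⊗ cid ∥
      ⊗ s b r ⊗ one_ 1)).
Proof.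
transitivity ((m (r + b) 1 ⊗ cid (∥ ⋅ st (r + a)))
  ⊚ (m r b ⊗ ((d 1 ⊗ one_ (r + a)) ⊚ (cid ∥ ⊗ (c (a + r) 1 ⊚ (m a r ⊗ one_ 1)))))
  ⊚ (one_ r ⊗ Bm a b ⊗ X r ⊗ one_ 1) ⊚ (s r a ⊗ cid ∥ ⊗ s b r ⊗ one_ 1)).
  by rewrite /Tw; mon.
have [-> _] := slide_mg W a r 1.
transitivity ((m (r + b) 1 ⊗ cid (∥ ⋅ st (r + a))) ⊚ (m r b ⊗ one_ 1 ⊗ cid ∥ ⊗ m a r)
  ⊚ (cid (st r ⋅ st b) ⊗ ((d 1 ⊗ one_ a) ⊚ (cid ∥ ⊗ c a 1)) ⊗ one_ r)
  ⊚ (one_ r ⊗ Bm a b ⊗ (c r 1 ⊚ (X r ⊗ one_ 1))) ⊚ (s r a ⊗ cid ∥ ⊗ s b r ⊗ one_ 1)); first mon.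
by rewrite (cr_dots q0 qn0 D) /Lh /Bm; mon.
Qed.

(** In the leading term of that case S1 and a slide merge the thin strand back into the strand b,
    with the negative crossing left at the bottom. *)
Lemma step_Bm r a b :
  (m (r + b) 1 ⊗ cid (∥ ⋅ st (r + a))) ⊚ (m r b ⊗ one_ 1 ⊗ cid ∥ ⊗ m a r)
    ⊚ (cid (st r ⋅ st b) ⊗ Bm a 1 ⊗ one_ r)
    ⊚ ((one_ r ⊗ ((c a b ⊗ cid ∥) ⊚ (one_ a ⊗ d b)) ⊗ ((one_ 1 ⊗ X r) ⊚ ci 1 r)) ⊚ (s r a ⊗ cid ∥
      ⊗ s b r ⊗ one_ 1))
  = Tw r a (b + 1) (wUV r b).
Proof.
symmetry; rewrite /Tw /wUV /Bm.
transitivity ((m r (b + 1) ⊗ cid ∥ ⊗ m a r)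
  ⊚ (one_ r ⊗ ((one_ (b + 1) ⊗ u a) ⊚ (c a (b + 1) ⊗ cid ∥)
    ⊚ (one_ a ⊗ (d (b + 1) ⊚ (cid ∥ ⊗ m b 1)))) ⊗ X r)
  ⊚ (cid (st r ⋅ st a ⋅ ∥) ⊗ ((one_ b ⊗ ci 1 r) ⊚ (s b r ⊗ one_ 1)))
    ⊚ (s r a ⊗ cid (∥ ⋅ st (b + r) ⋅ st 1))); first mon.
rewrite ld_mg.
transitivity ((m r (b + 1) ⊗ cid ∥ ⊗ m a r)
  ⊚ (one_ r ⊗ ((one_ (b + 1) ⊗ u a) ⊚ ((c a (b + 1) ⊚ (one_ a ⊗ m b 1)) ⊗ cid ∥)) ⊗ X r)
  ⊚ (one_ r ⊗ ((cid (st a ⋅ st b) ⊗ d 1) ⊚ (one_ a ⊗ d b ⊗ one_ 1)) ⊗ one_ r)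
  ⊚ (cid (st r ⋅ st a ⋅ ∥) ⊗ ((one_ b ⊗ ci 1 r) ⊚ (s b r ⊗ one_ 1)))
    ⊚ (s r a ⊗ cid (∥ ⋅ st (b + r) ⋅ st 1))); first mon.
have [_ ->] := slide_mg W a b 1.
transitivity (((m r (b + 1) ⊚ (one_ r ⊗ m b 1)) ⊗ cid ∥ ⊗ m a r)
  ⊚ (one_ r ⊗ (cid (st b ⋅ st 1) ⊗ u a) ⊗ X r)
  ⊚ (one_ r ⊗ (((one_ b ⊗ c a 1) ⊚ (c a b ⊗ one_ 1)) ⊗ cid ∥) ⊗ one_ r)
  ⊚ (one_ r ⊗ ((cid (st a ⋅ st b) ⊗ d 1) ⊚ (one_ a ⊗ d b ⊗ one_ 1)) ⊗ one_ r)
  ⊚ (cid (st r ⋅ st a ⋅ ∥) ⊗ ((one_ b ⊗ ci 1 r) ⊚ (s b r ⊗ one_ 1)))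
    ⊚ (s r a ⊗ cid (∥ ⋅ st (b + r) ⋅ st 1))); first mon.
by rewrite -mgA; mon.
Qed.

(** The correction term raises r by one. The factors come from a positive crossing absorbed on the
    left, q^-b, a negative crossing absorbed on the right, q^r, and the bubble that W1 forms on the
    left, [r+1]. *)
Lemma step_T1 r a b (A := st (r + a.+1) ⋅ ∥ ⋅ st (r + b) ⋅ st 1) (B := st (r + b + 1) ⋅ ∥ ⋅ st (r
  + a.+1)) :
  br A B ((m (r + b) 1 ⊗ cid (∥ ⋅ st (r + a.+1))) ⊚ (m r b ⊗ one_ 1 ⊗ cid ∥ ⊗ m a.+1 r)
    ⊚ (cid (st r ⋅ st b) ⊗ T1 a ⊗ one_ r)
    ⊚ ((one_ r ⊗ ((c a.+1 b ⊗ cid ∥) ⊚ (one_ a.+1 ⊗ d b)) ⊗ ((one_ 1 ⊗ X r) ⊚ ci 1 r))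
      ⊚ (s r a.+1 ⊗ cid ∥ ⊗ s b r ⊗ one_ 1)))
  = (q ^+ r * q ^- b * qint q r.+1) *: br A B (Tw r.+1 a b (wZ r b)).
Proof.
pose R := (cid (st r ⋅ st 1) ⊗ ((c a b ⊗ cid ∥) ⊚ (one_ a ⊗ d b)) ⊗ cid (st r ⋅ st 1))
  ⊚ (((one_ r ⊗ s 1 a) ⊚ s r (1 + a)) ⊗ cid ∥ ⊗ s b r ⊗ one_ 1).
pose E1 := (m r (b + 1) ⊗ cid ∥ ⊗ m a (1 + r))
  ⊚ (one_ r ⊗ (m b 1 ⊚ c 1 b) ⊗ u a ⊗ (X (1 + r)%N ⊚ (m 1 r ⊚ ci 1 r))) ⊚ R.
pose E2 := (m r (b + 1) ⊗ cid ∥ ⊗ m a (1 + r))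
  ⊚ (one_ r ⊗ m 1 b ⊗ u a ⊗ (X (1 + r)%N ⊚ (m 1 r ⊚ ci 1 r))) ⊚ R.
pose E3 := (m r (b + 1) ⊗ cid ∥ ⊗ m a (1 + r)) ⊚ (one_ r ⊗ m 1 b ⊗ u a ⊗ (X (1 + r)%N ⊚ m r 1)) ⊚ R.
transitivity (br A B E1).
  congr br; rewrite /T1 /E1 /R.
  transitivity (((m (r + b) 1 ⊚ (m r b ⊗ one_ 1)) ⊗ cid ∥ ⊗ (m (a + 1) r ⊚ (m a 1 ⊗ one_ r)))
    ⊚ (cid (st r ⋅ st b ⋅ st 1) ⊗ u a ⊗ ((x ⊗ X r) ⊚ ci 1 r))
    ⊚ (one_ r ⊗ ((((one_ b ⊗ s 1 a) ⊚ c (1 + a) b) ⊗ cid ∥) ⊚ (one_ (1 + a) ⊗ d b))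
      ⊗ cid (st r ⋅ st 1))
    ⊚ (s r (1 + a) ⊗ cid ∥ ⊗ s b r ⊗ one_ 1)); first mon.
  rewrite (mgA W r b 1) (mgA W a 1 r); have [_ ->] := slide_sp W b 1 a.
  rewrite -(dots1 qn0 D).
  transitivity ((m r (b + 1) ⊗ cid ∥ ⊗ m a (1 + r))
    ⊚ (one_ r ⊗ (m b 1 ⊚ c 1 b) ⊗ u a ⊗ ((m 1 r ⊚ (X 1%N ⊗ X r)) ⊚ ci 1 r)) 
    ⊚ (cid (st r ⋅ st 1) ⊗ ((c a b ⊗ cid ∥) ⊚ (one_ a ⊗ d b)) ⊗ cid (st r ⋅ st 1))
    ⊚ (((one_ r ⊗ s 1 a) ⊚ s r (1 + a)) ⊗ cid ∥ ⊗ s b r ⊗ one_ 1)); first mon.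
  by rewrite -(dots_mg q0 qn0 D); mon.
have -> : br A B E1 = q ^- b *: br A B E2.
  rewrite /E1 /E2 /R.
  by ctx1 (mg_cr_1n q0 qn0 W b) ((m r (b + 1) ⊗ cid ∥ ⊗ m a (1 + r)) ⊚ (one_ r ⊗ one_ (b + 1) ⊗ u a
    ⊗ X (1 + r)%N)) (st r)
   (st a ⋅ ∥ ⋅ st (1 + r)) ((cid (st r ⋅ st 1 ⋅ st b ⋅ st a ⋅ ∥) ⊗ (m 1 r ⊚ ci 1 r))
     ⊚ ((cid (st r ⋅ st 1) ⊗ ((c a b ⊗ cid ∥) ⊚ (one_ a ⊗ d b)) ⊗ cid (st r ⋅ st 1))
  ⊚ (((one_ r ⊗ s 1 a) ⊚ s r (1 + a)) ⊗ cid ∥ ⊗ s b r ⊗ one_ 1))).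
have -> : br A B E2 = q ^+ r *: br A B E3.
  rewrite /E2 /E3 /R.
  by ctx1 (mg_ci_1n r) ((m r (b + 1) ⊗ cid ∥ ⊗ m a (1 + r)) ⊚ (one_ r ⊗ m 1 b ⊗ u a ⊗ X (1 + r)%N))
    (st r ⋅ st 1 ⋅ st b ⋅ st a ⋅ ∥)
   𝟙 ((cid (st r ⋅ st 1) ⊗ ((c a b ⊗ cid ∥) ⊚ (one_ a ⊗ d b)) ⊗ cid (st r ⋅ st 1))
  ⊚ (((one_ r ⊗ s 1 a) ⊚ s r (1 + a)) ⊗ cid ∥ ⊗ s b r ⊗ one_ 1)).
rewrite scalerA [q ^- b * _]mulrC -scalerA; congr (_ *: _).
transitivity (br A B ((m (r + 1) b ⊗ cid ∥ ⊗ m a (1 + r))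
  ⊚ ((m r 1 ⊚ s r 1) ⊗ one_ b ⊗ u a ⊗ (X (1 + r)%N ⊚ m r 1))
  ⊚ (one_ (r + 1) ⊗ ((c a b ⊗ cid ∥) ⊚ (one_ a ⊗ d b)) ⊗ cid (st r ⋅ st 1))
  ⊚ (s (r + 1) a ⊗ cid ∥ ⊗ s b r ⊗ one_ 1))).
  congr br; rewrite /E3 /R -(spA W r 1 a).
  transitivity (((m r (1 + b) ⊚ (one_ r ⊗ m 1 b)) ⊗ cid ∥ ⊗ m a (1 + r)) ⊚ (cid (st r ⋅ st 1 ⋅ st b)
    ⊗ u a ⊗ (X (1 + r)%N ⊚ m r 1)) ⊚
    ((cid (st r ⋅ st 1) ⊗ ((c a b ⊗ cid ∥) ⊚ (one_ a ⊗ d b)) ⊗ cid (st r ⋅ st 1))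
  ⊚ (((s r 1 ⊗ one_ a) ⊚ s (r + 1) a) ⊗ cid ∥ ⊗ s b r ⊗ one_ 1))); first mon.
  by rewrite -mgA; mon.
rewrite /Tw /Bm /wZ.
by ctx1 (mgsp_n1 W r) (m (r + 1) b ⊗ cid ∥ ⊗ m a (1 + r)) 𝟙 (st b ⋅ ∥ ⋅ st a ⋅ st (1 + r))
  ((one_ (r + 1) ⊗ one_ b ⊗ u a ⊗ (X (1 + r)%N ⊚ m r 1))
  ⊚ (one_ (r + 1) ⊗ ((c a b ⊗ cid ∥) ⊚ (one_ a ⊗ d b)) ⊗ cid (st r ⋅ st 1))
  ⊚ (s (r + 1) a ⊗ cid ∥ ⊗ s b r ⊗ one_ 1)).
Qed.

(** The skein relation [ci_1n] makes the crossing positive; in its error term a bubble of b and 1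
    appears, which is [b+1]. *)
Lemma UV_U r b a (A := st (r.+1 + a) ⋅ ∥ ⋅ st (r.+1 + b) ⋅ st 1) (B := st (r.+1 + b + 1) ⋅ ∥ ⋅ st
  (r.+1 + a)) :
  br A B (Tw r.+1 a (b + 1) (wUV r.+1 b)) = 1 *: br A B (Tw r.+1 a (b + 1) (wU r.+1 b))
    + ((q - q^-1) * qint q b.+1) *: br A B (Tw r.+1 a (b + 1) (wZ r (b + 1))).
Proof.
pose f := (m r.+1 (b + 1) ⊗ cid ∥ ⊗ m a r.+1) ⊚ (one_ r.+1 ⊗ Bm a (b + 1) ⊗ X r.+1).
pose V := (one_ 1 ⊗ m r 1) ⊚ (s 1 r ⊗ one_ 1).
pose F := f ⊚ (s r.+1 a ⊗ cid ∥ ⊗ ((m b 1 ⊗ one_ r.+1) ⊚ (one_ b ⊗ V) ⊚ (s b r.+1 ⊗ one_ 1))).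
have -> : br A B (Tw r.+1 a (b + 1) (wUV r.+1 b)) = 1 *: br A B (Tw r.+1 a (b + 1) (wU r.+1 b))
  + (q - q^-1) *: br A B F.
  rewrite /F /f /V /Tw /wUV /wU.
  by ctx2 (ci_1n q0 qn0 W r) ((m r.+1 (b + 1) ⊗ cid ∥ ⊗ m a r.+1) ⊚ (one_ r.+1 ⊗ Bm a (b + 1)
    ⊗ X r.+1) ⊚ (s r.+1 a ⊗ cid ∥ ⊗ m b 1 ⊗ one_ r.+1))
    (st (r.+1 + a) ⋅ ∥ ⋅ st b) 𝟙 (cid (st (r.+1 + a) ⋅ ∥) ⊗ s b r.+1 ⊗ one_ 1).
rewrite -scalerA; congr (_ + _ *: _).
have -> : F = f ⊚ (s r.+1 a ⊗ cid ∥ ⊗ (((m b 1 ⊚ s b 1) ⊗ m r 1) ⊚ (s (b + 1) r ⊗ one_ 1))).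
  rewrite /F /f /V.
  transitivity ((m r.+1 (b + 1) ⊗ cid ∥ ⊗ m a r.+1) ⊚ (one_ r.+1 ⊗ Bm a (b + 1) ⊗ X r.+1)
    ⊚ (s r.+1 a ⊗ cid ∥ ⊗ ((m b 1 ⊗ m r 1) ⊚ (((one_ b ⊗ s 1 r) ⊚ s b (1 + r)) ⊗ one_ 1))));
      first mon.
  by rewrite -spA; mon.
rewrite /f /Tw /wZ.
by ctx1 (mgsp_n1 W b) ((m r.+1 (b + 1) ⊗ cid ∥ ⊗ m a r.+1) ⊚ (one_ r.+1 ⊗ Bm a (b + 1) ⊗ X r.+1)
  ⊚ (s r.+1 a ⊗ cid ∥ ⊗ one_ (b + 1) ⊗ m r 1))
    (st (r.+1 + a) ⋅ ∥) (st r ⋅ st 1) (cid (st (r.+1 + a) ⋅ ∥) ⊗ s (b + 1) r ⊗ one_ 1).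
Qed.

Lemma Tw_mg r a b (A := st (r.+1 + a) ⋅ ∥ ⋅ st (r.+1 + b) ⋅ st 1) (B := st (r.+1 + b + 1) ⋅ ∥ ⋅ st
  (r.+1 + a)) :
  br A B (Tw r.+1 a (b + 1) (s (b + 1) r.+1) ⊚ (cid (st (r.+1 + a) ⋅ ∥) ⊗ m (r.+1 + b) 1))
  = 1 *: br A B (Tw r.+1 a (b + 1) (wU r.+1 b)) + q ^+ b.+1 *: br A B (Tw r.+1 a (b
    + 1) (wZ r (b + 1))).
Proof.
rewrite /Tw /wU /wZ.
by ctx2 (sp_mg_split W r b) ((m r.+1 (b + 1) ⊗ cid ∥ ⊗ m a r.+1) ⊚ (one_ r.+1 ⊗ Bm a (b + 1)
  ⊗ X r.+1) ⊚ (s r.+1 a ⊗ cid ∥ ⊗ cid (st (b + 1) ⋅ st r.+1)))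
  (st (r.+1 + a) ⋅ ∥) 𝟙 (cid A).
Qed.

Definition alpha r : k := (-1) ^+ r * q ^+ (r * r.-1)./2 * (q^-1 - q) ^+ r * qfact q r.

(** Passing from r to r + 1 raises the triangular exponent by r. The new factor, up to a power of q
    depending on b, is the coefficient that a correction term acquires in [Lh_step_r]. *)
Lemma alphaS r : alpha r.+1 = alpha r * (κ * q ^+ r * qint q r.+1).
Proof.
have e : ((r.+1 * r)./2 = (r * r.-1)./2 + r)%N.
  have -> : (r.+1 * r = r * r.-1 + r.*2)%N by case: r => // r; rewrite /= mulSn mulnC; lia.
  by lia.
rewrite /alpha /= e exprD ![_ ^+ r.+1]exprS /qfact big_nat_recr //=.
by rewrite -/(qfact q r); move: (qint q r.+1) (qfact q r) => y z; ring.
Qed.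

Lemma Tw_ty r a b w Z : ty w Z (st b ⋅ st r) -> ty (Tw r a b w) (st (r + a) ⋅ ∥ ⋅ Z) (st (r + b) ⋅ ∥
  ⋅ st (a + r)).
Proof. by move=> wT; have wT' : typed w _ _ := wT; rewrite /Tw; typ. Qed.

(** For a = 0 the thin strand has no black strand to interact with, and the correction is absent. *)
Lemma Lh_step_r r a b (A := st (r + a) ⋅ ∥ ⋅ st (r + b) ⋅ st 1) (B := st (r + b + 1) ⋅ ∥ ⋅ st (r
  + a)) :
  br A B ((m (r + b) 1 ⊗ cid (∥ ⋅ st (r + a)))
    ⊚ (one_ (r + b) ⊗ ((d 1 ⊗ one_ (r + a)) ⊚ (cid ∥ ⊗ c (r + a) 1))) ⊚ (Tw r a b (s b r) ⊗ one_ 1))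
  = br A B (Tw r a (b + 1) (wUV r b))
    + (if a is a'.+1 then (κ * q ^+ r * q ^- b * qint q r.+1) *: br A B (Tw r.+1 a' b (wZ r b)) else
      0).
Proof.
rewrite Lh_step_Tw -step_Bm; case: a @A @B => [|a] A B.
  have -> : Lh 0 1 = Bm 0 1 by rewrite /Lh /Bm cr0n ru0; mon.
  by rewrite addr0.
rewrite -2!mulrA -scalerA mulrA -step_T1 -[X in X + _]scale1r.
by ctx2 (Lh_Sn1 a) ((m (r + b) 1 ⊗ cid (∥ ⋅ st (r + a.+1))) ⊚ (m r b ⊗ one_ 1 ⊗ cid ∥ ⊗ m a.+1 r))
  (st r ⋅ st b) (st r)
 ((one_ r ⊗ ((c a.+1 b ⊗ cid ∥) ⊚ (one_ a.+1 ⊗ d b)) ⊗ ((one_ 1 ⊗ X r) ⊚ ci 1 r))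
   ⊚ (s r a.+1 ⊗ cid ∥ ⊗ s b r ⊗ one_ 1)).
Qed.

(** Composed with the merge [N], both sides become combinations of [U r] and [Z r]. The [U r] agree
    at once. On the left [Z r] arises from the skein relation in the term r + 1 and from the
    correction of the term r, on the right from W2 in the term r + 1. *)
Lemma ld_cr_ru a b : br (st a ⋅ ∥ ⋅ st b) (st b ⋅ ∥ ⋅ st a) (Lh a b)
  = \sum_(r < (minn a b).+1) alpha r *:
      br (st a ⋅ ∥ ⋅ st b) (st b ⋅ ∥ ⋅ st a) (Tw r (a - r) (b - r) (s (b - r) r)).
Proof.
elim: b => [|b IH].
  rewrite minn0 big_ord1 /= !subn0 /alpha /qfact big_geq // expr0 !mulr1 scale1r.
  by rewrite /Lh /Tw /Bm (dots0 D) mg0n mgn0 sp0n spn0 ld0 crn0; congr br; mon.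
pose A := st a ⋅ ∥ ⋅ st b ⋅ st 1; pose B := st (b + 1) ⋅ ∥ ⋅ st a.
pose N := cid (st a ⋅ ∥) ⊗ m b 1.
(* Index r of [Z] carries a dot of thickness r + 1, so [Z r] pairs with [alpha r.+1]. *)
pose U r := br A B (Tw r (a - r) (b - r + 1) (wU r (b - r))).
pose Z r := br A B (Tw r.+1 (a - r.+1) (b - r) (wZ r (b - r))).
have expandL r : (r <= minn a b)%N ->
  br A B ((m b 1 ⊗ cid (∥ ⋅ st a)) ⊚ (one_ b ⊗ ((d 1 ⊗ one_ a) ⊚ (cid ∥ ⊗ c a 1)))
    ⊚ (Tw r (a - r) (b - r) (s (b - r) r) ⊗ one_ 1))
  = U r + (if r is r'.+1 then ((q - q^-1) * qint q (b - r')) *: Z r' else 0)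
    + (if (r < a)%N then (κ * q ^+ r * q ^- (b - r) * qint q r.+1) *: Z r else 0).
  rewrite leq_min => /andP[ra rb].
  have [a1 ea] : exists a1, a = (r + a1)%N by exists (a - r)%N; lia.
  have [b1 eb] : exists b1, b = (r + b1)%N by exists (b - r)%N; lia.
  rewrite /U /Z /A /B ea eb !addKn Lh_step_r; congr (_ + _).
    case: r ra rb ea eb => [|r] ra rb ea eb.
      rewrite addr0; congr br; congr Tw.
      rewrite /wUV /wU cr0n; congr (_ ⊚ (_ ⊗ _) ⊚ _).
      by transitivity (ci 1 0 ⊚ c 1 0); [rewrite crn0; mon | rewrite crK; mon].
    rewrite UV_U scale1r.
    have -> : (r.+1 + b1 - r = b1 + 1)%N by lia.
    by rewrite -(addn1 b1) addKn.
  case: a1 ea => [|a1] ea; first by rewrite addn0 ltnn.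
  have -> : (r < r + a1.+1)%N by lia.
  by have -> : (r + a1.+1 - r.+1 = a1)%N by lia.
have expandR r : (r <= minn a b.+1)%N ->
  br A B (Tw r (a - r) (b.+1 - r) (s (b.+1 - r) r) ⊚ N)
  = (if (r <= b)%N then U r else 0) + (if r is r'.+1 then q ^+ (b - r') *: Z r' else 0).
  rewrite leq_min => /andP[ra rb]; case: r ra rb => [|r] ra rb.
    by rewrite /U /N !subn0 addr0 /Tw /wU (dots0 D) !spn0 !sp0n !mg0n !mgn0 cr0n; congr br; mon.
  have [a1 ea] : exists a1, a = (r.+1 + a1)%N by exists (a - r.+1)%N; lia.
  rewrite /U /Z subSS /N /A /B; case: (leqP r.+1 b) => rb'.
    have [b1 eb] : exists b1, b = (r.+1 + b1)%N by exists (b - r.+1)%N; lia.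
    rewrite ea eb !addKn; have -> : (r.+1 + b1 - r = b1 + 1)%N by lia.
    by rewrite Tw_mg scale1r -(addn1 b1).
  have er : b = r by lia.
  by rewrite ea er !addKn subnn expr0 scale1r add0r /Tw /wZ !sp0n ?mgn0; congr br; mon.
(* The ranges of the sums differ by a boundary term that vanishes: for a <= b the correction at r =
   a is absent; for b < a the factor [b - r] is 0 at r = b, and there is no [U r] at r = b + 1. *)
have sumC : \sum_(r < (minn a b).+1) alpha r *: (if (r < a)%N then (κ * q ^+ r * q ^- (b - r) * qint
  q r.+1) *: Z r else 0)
  = \sum_(r < minn a b.+1) (alpha r.+1 * q ^- (b - r)) *: Z r.
  have e r : (alpha r * (κ * q ^+ r * q ^- (b - r) * qint q r.+1)) *: Z r
    = (alpha r.+1 * q ^- (b - r)) *: Z r.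
    by rewrite alphaS; congr (_ *: _); move: (alpha r) κ (qint q r.+1) (q ^- _) => *; ring.
  case: (leqP a b) => ab.
    rewrite (minn_idPl _); last lia.
    rewrite big_ord_recr /= ltnn scaler0 addr0; apply: eq_bigr => r _.
    by rewrite ltn_ord scalerA e.
  rewrite (minn_idPr _) //; apply: eq_bigr => r _.
  by rewrite (leq_trans (ltn_ord r) ab) scalerA e.
have sumA : \sum_(r < (minn a b).+1) alpha r *: (if (r : nat) is r'.+1 then ((q - q^-1) * qint q
  (b - r')) *: Z r' else 0)
  = \sum_(r < minn a b.+1) (alpha r.+1 * ((q - q^-1) * qint q (b - r))) *: Z r.
  rewrite big_ord_recl scaler0 add0r.
  case: (leqP a b) => ab.
    rewrite (minn_idPl _); last lia.
    by apply: eq_bigr => r _; rewrite scalerA.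
  rewrite (minn_idPr _) // big_ord_recr /= subnn qint0 !mulr0 scale0r addr0.
  by apply: eq_bigr => r _; rewrite scalerA.
have sumU : \sum_(r < (minn a b.+1).+1) alpha r *: (if (r <= b)%N then U r else 0)
  = \sum_(r < (minn a b).+1) alpha r *: U r.
  case: (leqP a b) => ab.
    rewrite (minn_idPl _); last lia.
    by apply: eq_bigr => r _; rewrite (leq_trans _ ab) // -ltnS.
  rewrite (minn_idPr _) // big_ord_recr /= ltnn scaler0 addr0.
  by apply: eq_bigr => r _; rewrite -ltnS ltn_ord.
have sumL : br A B (Lh a b.+1 ⊚ N)
  = \sum_(r < (minn a b.+1).+1) alpha r *: br A B (Tw r (a - r) (b.+1 - r) (s (b.+1 - r) r) ⊚ N).
  transitivity (\sum_(r < (minn a b).+1) alpha r *: br A B ((m b 1 ⊗ cid (∥ ⋅ st a))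
    ⊚ (one_ b ⊗ ((d 1 ⊗ one_ a) ⊚ (cid ∥ ⊗ c a 1))) ⊚ (Tw r (a - r) (b - r) (s (b - r) r)
      ⊗ one_ 1))).
    have T (r : 'I_(minn a b).+1) : typed (Tw r (a - r) (b - r) (s (b - r) r)) (st a ⋅ ∥ ⋅ st b)
      (st b ⋅ ∥ ⋅ st a).
      have := ltn_ord r; rewrite ltnS leq_min => /andP[ra rb].
      have := @Tw_ty r (a - r) (b - r) _ (st b) (_ : ty (s (b - r) r) _ _).
      rewrite !subnKC // subnK //; apply.
      by have := sp_ty W (b - r) r; rewrite subnK.
    rewrite -addn1 Lh_step.
    ctxn IH ((m b 1 ⊗ cid (∥ ⋅ st a)) ⊚ (one_ b ⊗ ((d 1 ⊗ one_ a) ⊚ (cid ∥ ⊗ c a 1)))) 𝟙 (st 1)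
      (cid A); first exact: T.
    by mon.
  under eq_bigr => r _ do rewrite expandL -1?ltnS // !scalerDr.
  under [RHS]eq_bigr => r _ do rewrite expandR -1?ltnS // scalerDr.
  rewrite !big_split /= sumA sumC sumU -addrA; congr (_ + _).
  rewrite big_ord_recl /= scaler0 add0r -big_split; apply: eq_bigr => r _ /=.
  rewrite scalerA -scalerDl -mulrDr; congr ((_ * _) *: _).
  (* The two contributions add up by (q - q^-1)[n] + q^-n = q^n with n = b - r. *)
  rewrite /qint mulrCA divff ?mulr1; last exact: subqV_neq0.
  by rewrite addrNK.
have [phi phiE] := @epi_lin b (st a ⋅ ∥) 𝟙 A (st a ⋅ ∥ ⋅ st b.+1) (st b.+1 ⋅ ∥ ⋅ st a) ltac:(obj)
  ltac:(obj).
apply: (scalerI (qn0 b)).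
rewrite /N /B addn1 in sumL.
rewrite -(phiE _ (Lh a b.+1 ⊚ N)); [|typ|by rewrite /N; mon].
rewrite sumL linear_sum scaler_sumr; apply: eq_bigr => r _; rewrite linearZ /=.
rewrite scalerA [qint q b.+1 * _]mulrC -[RHS]scalerA; congr (_ *: _).
have T : typed (Tw r (a - r) (b.+1 - r) (s (b.+1 - r) r)) (st a ⋅ ∥ ⋅ st b.+1) (st b.+1 ⋅ ∥ ⋅ st a).
  have := ltn_ord r; rewrite ltnS leq_min => /andP[ra rb].
  have := @Tw_ty r (a - r) (b.+1 - r) _ (st b.+1) (_ : ty (s (b.+1 - r) r) _ _).
  rewrite !subnKC // subnK //; apply.
  by have := sp_ty W (b.+1 - r) r; rewrite subnK.
by apply: phiE; [exact: T | mon].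
Qed.

End Traverses.

(** * Functors between presented categories *)

Section Translation.
Variables (k : fieldType) (U : eqType) (D1 D2 : Type).
Variables (dth1 : D1 -> thickness) (dth2 : D2 -> thickness).
Local Notation S1 := (web_sig U dth1).
Local Notation S2 := (web_sig U dth2).
Variables (dot dotV : D1 -> expr k S2).

Definition translate_gen (g : gmor S1) : expr k S2 :=
  match g with
  | GMerge a b => @Gen k S2 (GMerge a b)
  | GSplit a b => @Gen k S2 (GSplit a b)
  | GCross a b => @Gen k S2 (GCross a b)
  | GCrossV a b => @Gen k S2 (GCrossV a b)
  | GDot d => dot d
  | GDotV d => dotV d
  | GUp a u => @Gen k S2 (GUp a u)
  | GDown u a => @Gen k S2 (GDown u a)
  end.

Fixpoint translate (t : expr k S1) : expr k S2 :=
  match t with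
  | Gen g => translate_gen g
  | Id A => @Id k S2 A
  | Comp f g => Comp (translate f) (translate g)
  | Tens f g => Tens (translate f) (translate g)
  | Zero A B => @Zero k S2 A B
  | Add f g => Add (translate f) (translate g)
  | Scale a f => Scale a (translate f)
  end.

Hypothesis dot_type : forall d, oftype (S := S2) [:: Black (dth1 d)] [:: Black (dth1 d)] (dot d).
Hypothesis dotV_type : forall d, oftype (S := S2) [:: Black (dth1 d)] [:: Black (dth1 d)] (dotV d).

Lemma translateE t :
  [/\ wf (translate t) = wf t, src (translate t) = src t & tgt (translate t) = tgt t].
Proof.
elim: t => //= [g|f [wf_ sf tf] g [wg sg tg]|f [wf_ sf tf] g [wg sg tg]|f [wf_ sf tf] g [wg sg tg]].
- by case: g => //= d; [case/and3P: (dot_type d) | case/and3P: (dotV_type d)] => -> /eqP-> /eqP->.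
- by rewrite wf_ wg sf sg tf tg.
- by rewrite wf_ wg sf sg tf tg.
- by rewrite wf_ wg sf sg tf tg.
Qed.

Lemma translate_type (A B : seq (obj U)) (t : expr k S1) : oftype (S := S1) A B t ->
  oftype (S := S2) A B (translate t).
Proof. by have [w s e] := translateE t; rewrite /oftype w s e. Qed.

Lemma translate_big I (r : seq I) (p : pred I) (F : I -> expr k S1) A B :
  translate (\big[@Add k S1/@Zero k S1 A B]_(i <- r | p i) F i)
  = \big[@Add k S2/@Zero k S2 A B]_(i <- r | p i) translate (F i).
Proof. by elim/big_rec2: _ => [|i t t' _ <-]. Qed.

Lemma translate_merge a b : translate (merge a b) = merge a b.
Proof. by case: a b => [|a] []. Qed.
Lemma translate_split a b : translate (split a b) = split a b.
Proof. by case: a b => [|a] []. Qed.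
Lemma translate_cross a b : translate (cross a b) = cross a b.
Proof. by case: a b => [|a] []. Qed.
Lemma translate_crossV a b : translate (crossV a b) = crossV a b.
Proof. by case: a b => [|a] []. Qed.
Lemma translate_up a u : translate (up a u) = up a u.
Proof. by case: a. Qed.
Lemma translate_down u a : translate (down u a) = down u a.
Proof. by case: a. Qed.
Lemma translate_merge1s a : translate (merge1s a) = merge1s a.
Proof. by elim: a => //= a ->; rewrite translate_merge. Qed.
Lemma translate_split1s a : translate (split1s a) = split1s a.
Proof. by elim: a => //= a ->; rewrite translate_split. Qed.
Lemma translate_tens_pow f a : translate (tens_pow f a) = tens_pow (translate f) a.
Proof. by elim: a => //= a ->. Qed.
Definition translate_diagE := (translate_merge, translate_split, translate_cross,
  translate_crossV, translate_up, translate_down, translate_merge1s, translate_split1s,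
  translate_tens_pow).

Variables (rel1 : expr k S1 -> expr k S1 -> Prop) (rel2 : expr k S2 -> expr k S2 -> Prop).
Hypothesis wf1 : forall t t', rel1 t t' -> wf t /\ parallel t t'.
Hypothesis wf2 : forall t t', rel2 t t' -> wf t /\ parallel t t'.
Local Notation P1 := (Presentation wf1).
Local Notation P2 := (Presentation wf2).

(** Translation fixes all generators but the dots, so each common relation goes to itself, except
    for the invertibility of dots. *)
Lemma translate_common q :
  (forall t t', common_rel q t t' -> @eqm k P2 t t') ->
  (forall d, @eqm k P2 (Comp (dot d) (dotV d)) (idb (val (dth1 d)))) ->
  (forall d, @eqm k P2 (Comp (dotV d) (dot d)) (idb (val (dth1 d)))) ->
  forall t t', common_rel q t t' -> @eqm k P2 (translate t) (translate t').
Proof.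
move=> common dotK dotVK t t'; case=> {t t'} /=; rewrite ?translate_diagE.
- by move=> a b a0 b0; rewrite !translate_diagE; apply/common/rel_crossVr.
- by move=> a b a0 b0; rewrite !translate_diagE; apply/common/rel_crossVl.
- exact: dotK.
- exact: dotVK.
- by move=> a b c a0 b0 c0; rewrite !translate_diagE; apply/common/rel_W1m.
- by move=> a b c a0 b0 c0; rewrite !translate_diagE; apply/common/rel_W1s.
- move=> a b c d a0 b0 c0 d0 e; rewrite !translate_diagE translate_big.
  have := common _ _ (@rel_W2 k q U D2 dth2 a b c d a0 b0 c0 d0 e); congr eqm.
  apply: eq_bigr => s _; rewrite translate_big; apply: eq_bigr => t _ /=.
  by rewrite !translate_diagE.
- by move=> a b a0 b0; rewrite !translate_diagE; apply/common/rel_W3.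
- by move=> a b u a0 b0; rewrite !translate_diagE; apply/common/rel_S1rs.
- by move=> a b u a0 b0; rewrite !translate_diagE; apply/common/rel_S1ls.
- by move=> a b u a0 b0; rewrite !translate_diagE; apply/common/rel_S1lm.
- by move=> a b u a0 b0; rewrite !translate_diagE; apply/common/rel_S1rm.
Qed.

Hypothesis rel_translate : forall t t', rel1 t t' -> @eqm k P2 (translate t) (translate t').

Lemma translate_eqm t t' : @eqm k P1 t t' -> @eqm k P2 (translate t) (translate t').
Proof.
elim=> {t t'} /=.
- exact: rel_translate.
- by move=> *; apply: eqm_refl.
- by move=> *; apply: eqm_sym.
- by move=> t t' t'' _ e _ e'; apply: eqm_trans e e'.
- by move=> *; apply: eqm_Comp.
- by move=> *; apply: eqm_Tens.
- by move=> *; apply: eqm_Add.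
- by move=> *; apply: eqm_Scale.
- by move=> *; apply: eqm_compA.
- by move=> f; have := @eqm_comp1m k P2 (translate f); have [_ _ ->] := translateE f.
- by move=> f; have := @eqm_compm1 k P2 (translate f); have [_ -> _] := translateE f.
- by move=> *; apply: eqm_tensA.
- by move=> *; apply: eqm_tens1m.
- by move=> *; apply: eqm_tensm1.
- by move=> *; apply: eqm_tens_id.
- move=> f g f' g' e e'; apply: eqm_interchange.
    by have [_ -> _] := translateE f; have [_ _ ->] := translateE g.
  by have [_ -> _] := translateE f'; have [_ _ ->] := translateE g'.
- by move=> *; apply: eqm_addA.
- move=> f g e e'; apply: eqm_addC.
    by have [_ -> _] := translateE f; have [_ -> _] := translateE g.
  by have [_ _ ->] := translateE f; have [_ _ ->] := translateE g.
- by move=> f; have := @eqm_add0 k P2 (translate f); have [_ -> ->] := translateE f.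
- by move=> *; apply: eqm_scaleA.
- by move=> *; apply: eqm_scale1.
- move=> f wf_; have := @eqm_scale0 k P2 (translate f); have [-> -> ->] := translateE f.
  exact.
- by move=> *; apply: eqm_scaleDl.
- by move=> *; apply: eqm_scaleDr.
- by move=> *; apply: eqm_compDl.
- by move=> *; apply: eqm_compDr.
- by move=> *; apply: eqm_compZl.
- by move=> *; apply: eqm_compZr.
- by move=> *; apply: eqm_tensDl.
- by move=> *; apply: eqm_tensDr.
- by move=> *; apply: eqm_tensZl.
- by move=> *; apply: eqm_tensZr.
Qed.

Definition translate_hom (A B : seq (obj U)) (f : @phom k P1 A B) : @phom k P2 A B :=
  @cls k P2 A B _ (translate_type (exP f)).

Lemma ex_translate (A B : seq (obj U)) (f : @phom k P1 A B) t : @eqm k P1 (ex f) t ->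
  @eqm k P2 (ex (translate_hom f)) (translate t).
Proof. by move=> e; rewrite clsK; apply: translate_eqm. Qed.

Lemma translate_hom_linear (A B : seq (obj U)) : linear (@translate_hom A B).
Proof.
move=> a f g; apply: ex_eqm.
rewrite (ex_translate (t := Add (Scale a (ex f)) (ex g))) /=; last first.
  by rewrite ex_add ex_scale; reflexivity.
by rewrite ex_add ex_scale !clsK; reflexivity.
Qed.

HB.instance Definition _ (A B : seq (obj U)) :=
  GRing.isLinear.Build k (@phom k P1 A B) (@phom k P2 A B) *:%R (@translate_hom A B)
    (@translate_hom_linear A B).

Definition translate_functor : linmonfunctor (presented P1) (presented P2).
Proof.
refine (@LinMonFunctor k (presented P1) (presented P2) id
  (fun A B => @translate_hom A B : {linear @phom k P1 A B -> @phom k P2 A B}) _ _ erefl (fun _ _ =>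
    erefl) _).
- move=> A; apply: ex_eqm; rewrite (ex_translate (clsK _)) clsK; exact: eqm_refl.
- move=> A B C f g; apply: ex_eqm; rewrite (ex_translate (clsK _)) !clsK; exact: eqm_refl.
- move=> A B A' B' f g; apply: ex_eqm; rewrite (ex_translate (clsK _)) !clsK; exact: eqm_refl.
Defined.

End Translation.

Section Inverse.
Variables (k : fieldType) (U : eqType) (D1 D2 : Type).
Variables (dth1 : D1 -> thickness) (dth2 : D2 -> thickness).
Local Notation S1 := (web_sig U dth1).
Local Notation S2 := (web_sig U dth2).
Variables (dot12 dotV12 : D1 -> expr k S2) (dot21 dotV21 : D2 -> expr k S1).
Hypothesis dot12_type : forall d, oftype (S := S2) [:: Black (dth1 d)] [:: Black (dth1 d)]
  (dot12 d).
Hypothesis dotV12_type : forall d, oftype (S := S2) [:: Black (dth1 d)] [:: Black (dth1 d)]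
  (dotV12 d).
Hypothesis dot21_type : forall d, oftype (S := S1) [:: Black (dth2 d)] [:: Black (dth2 d)]
  (dot21 d).
Hypothesis dotV21_type : forall d, oftype (S := S1) [:: Black (dth2 d)] [:: Black (dth2 d)]
  (dotV21 d).
Variables (rel1 : expr k S1 -> expr k S1 -> Prop) (rel2 : expr k S2 -> expr k S2 -> Prop).
Hypothesis wf1 : forall t t', rel1 t t' -> wf t /\ parallel t t'.
Hypothesis wf2 : forall t t', rel2 t t' -> wf t /\ parallel t t'.
Local Notation P1 := (Presentation wf1).
Local Notation P2 := (Presentation wf2).
Local Notation tr12 := (translate dot12 dotV12).
Local Notation tr21 := (translate dot21 dotV21).
Hypothesis rel12 : forall t t', rel1 t t' -> @eqm k P2 (tr12 t) (tr12 t').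
Hypothesis rel21 : forall t t', rel2 t t' -> @eqm k P1 (tr21 t) (tr21 t').
Hypothesis dotK : forall d, @eqm k P1 (tr21 (dot12 d)) (@Gen k S1 (GDot d)).
Hypothesis dotVK : forall d, @eqm k P1 (tr21 (dotV12 d)) (@Gen k S1 (GDotV d)).

Lemma translateK t : @eqm k P1 (tr21 (tr12 t)) t.
Proof.
elim: t => [g|A|f ef g eg|f ef g eg|A B|f ef g eg|a f ef] /=; try exact: eqm_refl.
- by case: g => *; first [exact: dotK | exact: dotVK | exact: eqm_refl].
- exact: eqm_Comp.
- exact: eqm_Tens.
- exact: eqm_Add.
- exact: eqm_Scale.
Qed.

Lemma translate_left_inverse :
  is_left_inverse (translate_functor dot21_type dotV21_type wf2 rel21)
    (translate_functor dot12_type dotV12_type wf1 rel12).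
Proof.
(* Both functors are the identity on objects, so no transport remains. *)
exists (fun=> erefl) => A B f; apply: (@ex_eqm k P1) => /=.
apply: eqm_trans (translateK _).
have H := ex_translate dot21_type dotV21_type (wf1 := wf2) rel21.
apply: H.
exact: (@clsK k P2).
Qed.
End Inverse.

(** * Presented categories as calculi *)

Section PresentedCalc.
Local Open Scope quotient_scope.
Variables (k : fieldType) (P : presentation k) (str : nat -> seq (gob P)) (str0 : str 0 = [::]).
Local Notation word := (seq (gob P)).
Local Notation expr := (expr k P).
Local Notation eqm := (@eqm k P).

(* The hom spaces [phom A B] glued into a single quotient of all expressions. *)
Definition eqmb1 : rel expr := fun t t' => `[< eqm t t' >].
Lemma eqmb1_equiv : equiv_class_of eqmb1.
Proof.
split=> [t|t t'|t t' t''].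
- by apply/asboolP/eqm_refl.
- by apply/asboolP/asboolP; apply: eqm_sym.
- by move=> /asboolP e /asboolP e'; apply/asboolP; apply: eqm_trans e e'.
Qed.
Canonical eqmb1_equiv_rel := EquivRelPack eqmb1_equiv.
Definition uexpr := {eq_quot eqmb1_equiv_rel}.

Definition pi_expr (t : expr) : uexpr := \pi_uexpr t.
Lemma pi_eq t t' : pi_expr t = pi_expr t' <-> eqm t t'.
Proof.
by split=> [/eqmodP/asboolP | e]; [|apply/eqmodP/asboolP].
Qed.
Lemma repr_pi t : eqm (repr (pi_expr t)) t.
Proof. by apply/pi_eq; rewrite /pi_expr reprK. Qed.

Lemma eqm_oftype A B t t' : eqm t t' -> oftype A B t = oftype A B t'.
Proof. by move=> /eqm_parallel[w s e]; rewrite /oftype w s e. Qed.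

Definition uty (f : uexpr) (A B : word) : Prop := oftype A B (repr f).
Definition ucid A := pi_expr (Id A).
Definition ucmp (f g : uexpr) := pi_expr (Comp (repr f) (repr g)).
Definition utns (f g : uexpr) := pi_expr (Tens (repr f) (repr g)).
(** Off the type (A, B) the value 0 is a placeholder; the laws of a calculus constrain [br] on typed
    diagrams only. *)
Definition ubr A B (f : uexpr) : phom A B :=
  if @idP (oftype A B (repr f)) is ReflectT fT then cls fT else 0.

Lemma uty_pi t A B : uty (pi_expr t) A B <-> oftype A B t.
Proof. by rewrite /uty (eqm_oftype _ _ (repr_pi t)). Qed.

Lemma ubrE A B f (fT : uty f A B) : ubr A B f = cls fT.
Proof. by rewrite /ubr; case: {-}_ / idP => [h|/(_ fT)//]; apply/cls_eqm/eqm_refl. Qed.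

Lemma ubr_pi A B t (tT : oftype A B t) : ubr A B (pi_expr t) = cls tT.
Proof. by rewrite (ubrE (proj2 (uty_pi _ _ _) tT)); apply/cls_eqm/repr_pi. Qed.

Lemma uexprP (f : uexpr) : exists t, f = pi_expr t.
Proof. by exists (repr f); rewrite /pi_expr reprK. Qed.

Lemma pi_cmp f g : pi_expr (Comp f g) = ucmp (pi_expr f) (pi_expr g).
Proof. by apply/pi_eq; apply: eqm_sym; apply: eqm_Comp; apply: repr_pi. Qed.
Lemma pi_tns f g : pi_expr (Tens f g) = utns (pi_expr f) (pi_expr g).
Proof. by apply/pi_eq; apply: eqm_sym; apply: eqm_Tens; apply: repr_pi. Qed.

Lemma uty_tgt t A B : uty (pi_expr t) A B -> tgt t = B.
Proof. by case/uty_pi/and3P => _ _ /eqP. Qed.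
Lemma uty_src t A B : uty (pi_expr t) A B -> src t = A.
Proof. by case/uty_pi/and3P => _ /eqP. Qed.
Lemma uty_cmp f g A B C : uty f B C -> uty g A B -> uty (ucmp f g) A C.
Proof.
move=> /and3P[wf_ /eqP sf /eqP tf] /and3P[wg /eqP sg /eqP tg]; apply/uty_pi.
by rewrite /oftype /= wf_ wg sf sg tf tg !eqxx.
Qed.
Lemma uty_tns f g A B C D : uty f A B -> uty g C D -> uty (utns f g) (A ++ C) (B ++ D).
Proof.
move=> /and3P[wf_ /eqP sf /eqP tf] /and3P[wg /eqP sg /eqP tg]; apply/uty_pi.
by rewrite /oftype /= wf_ wg sf sg tf tg !eqxx.
Qed.

Lemma ubr_cmp A B C f g : uty f B C -> uty g A B ->
  ubr A C (ucmp f g) = phom_comp (ubr B C f) (ubr A B g).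
Proof.
move=> fT gT; rewrite (ubrE fT) (ubrE gT) (ubrE (uty_cmp fT gT)).
apply/cls_eqm; rewrite repr_pi !clsK; exact: eqm_refl.
Qed.
Lemma ubr_tns A B C D f g : uty f A B -> uty g C D ->
  ubr (A ++ C) (B ++ D) (utns f g) = phom_tens (ubr A B f) (ubr C D g).
Proof.
move=> fT gT; rewrite (ubrE fT) (ubrE gT) (ubrE (uty_tns fT gT)).
apply/cls_eqm; rewrite repr_pi !clsK; exact: eqm_refl.
Qed.

Lemma uty_cid A : uty (ucid A) A A.
Proof. by apply/uty_pi; rewrite /oftype /= !eqxx. Qed.

Lemma linear_exists (V W : lmodType k) (f : V -> W) : linear f ->
  exists phi : {linear V -> W}, forall v, phi v = f v.
Proof.
move=> fl; pose fL := GRing.isLinear.Build k V W *:%R f fl.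
by exists (HB.pack f fL : {linear V -> W}).
Qed.

Definition presented_calc : calc k.
Proof.
refine (@Calc k word cat [::] (@catA _) (@cat0s _) (@cats0 _) str str0
  uexpr (fun A B => phom A B : lmodType k) uty ucid ucmp utns ubr uty_cid uty_cmp uty_tns
  _ _ _ _ _ _ _ _ _ _ _ _ _).
- move=> f g A B fT gT; rewrite (ubrE fT) (ubrE gT) => /cls_eqm e.
  by rewrite -[f]reprK -[g]reprK; apply/pi_eq.
- move=> f g h; have [[[f' ->] [g' ->]] [h' ->]] := (uexprP f, uexprP g, uexprP h).
  by rewrite -!pi_cmp; apply/pi_eq/eqm_compA.
- move=> f A B; have [f' ->] := uexprP f => /uty_tgt <-.
  by rewrite -pi_cmp; apply/pi_eq/eqm_comp1m.
- move=> f A B; have [f' ->] := uexprP f => /uty_src <-.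
  by rewrite -pi_cmp; apply/pi_eq/eqm_compm1.
- move=> f g h; have [[[f' ->] [g' ->]] [h' ->]] := (uexprP f, uexprP g, uexprP h).
  by rewrite -!pi_tns; apply/pi_eq/eqm_tensA.
- by move=> f; have [f' ->] := uexprP f; rewrite -pi_tns; apply/pi_eq/eqm_tens1m.
- by move=> f; have [f' ->] := uexprP f; rewrite -pi_tns; apply/pi_eq/eqm_tensm1.
- by move=> A B; rewrite -pi_tns; apply/pi_eq/eqm_tens_id.
- move=> f g f' g' A B C A' B' C'.
  have [[f0 ->] [g0 ->]] := (uexprP f, uexprP g).
  have [[f0' ->] [g0' ->]] := (uexprP f', uexprP g').
  move=> /uty_src fs /uty_tgt gt /uty_src fs' /uty_tgt gt'.
  rewrite -!(pi_cmp, pi_tns); apply/pi_eq/eqm_interchange; by rewrite ?fs ?fs'.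
- move=> A B C g gT; have [phi phiE] := linear_exists (phom_comp_linl (C := C) (ubr A B g)).
  by exists phi => f fT; rewrite phiE (ubr_cmp fT gT).
- move=> A B C f fT; have [phi phiE] := linear_exists (phom_comp_linr (A := A) (ubr B C f)).
  by exists phi => g gT; rewrite phiE (ubr_cmp fT gT).
- move=> A B Z; have [phi phiE] := linear_exists (phom_tens_linr (C := A) (D :=
  B) (ubr Z Z (ucid Z))).
  by exists phi => f fT; rewrite phiE (ubr_tns (uty_cid Z) fT).
- move=> A B Z; have [phi phiE] := linear_exists (phom_tens_linl (A := A) (B :=
  B) (ubr Z Z (ucid Z))).
  by exists phi => f fT; rewrite phiE (ubr_tns fT (uty_cid Z)).
Defined.

Lemma ubr_add A B f g : oftype A B f -> oftype A B g ->
  ubr A B (pi_expr (Add f g)) = ubr A B (pi_expr f) + ubr A B (pi_expr g).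
Proof.
move=> fT gT; have fgT : oftype A B (Add f g).
  case/and3P: fT gT => wf_ /eqP sf /eqP tf /and3P[wg /eqP sg /eqP tg].
  by rewrite /oftype /= wf_ wg sf sg tf tg !eqxx.
rewrite (ubr_pi fT) (ubr_pi gT) (ubr_pi fgT); apply/cls_eqm.
rewrite !clsK; exact: eqm_refl.
Qed.

Lemma ubr_scale A B a f : oftype A B f ->
  ubr A B (pi_expr (Scale a f)) = a *: ubr A B (pi_expr f).
Proof.
move=> fT; have afT : oftype A B (Scale a f) by [].
rewrite (ubr_pi fT) (ubr_pi afT); apply/cls_eqm.
rewrite !clsK; exact: eqm_refl.
Qed.

Lemma big_oftype A B I (r : seq I) (p : pred I) (F : I -> expr) :
  (forall i, p i -> oftype A B (F i)) -> oftype A B (\big[@Add k P/Zero A B]_(i <- r | p i) F i).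
Proof.
move=> FP; elim/big_rec: _ => [|i t pi /and3P[wt /eqP st /eqP tt]].
  by rewrite /oftype /= !eqxx.
have /and3P[wF /eqP sF /eqP tF] := FP i pi.
by rewrite /oftype /= wt wF st tt sF tF !eqxx.
Qed.

Lemma ubr_big A B I (r : seq I) (p : pred I) (F : I -> expr) :
  (forall i, p i -> oftype A B (F i)) ->
  ubr A B (pi_expr (\big[@Add k P/Zero A B]_(i <- r | p i) F i))
  = \sum_(i <- r | p i) ubr A B (pi_expr (F i)).
Proof.
move=> FT; elim: r => [|i r IH].
  by rewrite !big_nil (ubr_pi (oftype_Zero A B)); apply/cls_eqm/eqm_refl.
rewrite !big_cons; case: ifP => // pi.
by rewrite ubr_add ?IH //; [exact: FT | exact: big_oftype].
Qed.

Lemma ubr_eqm A B t t' : oftype A B t -> oftype A B t' ->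
  ubr A B (pi_expr t) = ubr A B (pi_expr t') -> eqm t t'.
Proof. by move=> tT t'T; rewrite (ubr_pi tT) (ubr_pi t'T) => /cls_eqm. Qed.
End PresentedCalc.

(** * The web relations in a presented category *)

Section Common.
Variables (k : fieldType) (q : k) (U : eqType) (D : Type) (dth : D -> thickness).
Local Notation S := (web_sig U dth).
Variables (rel : expr k S -> expr k S -> Prop) (wfr : forall t t', rel t t' ->
  wf t /\ parallel t t').
Local Notation P := (Presentation wfr).
Hypothesis common : forall t t', common_rel q t t' -> @eqm k P t t'.

Definition pcalc : calc k := @presented_calc k P (@strand U) erefl.
Local Notation M := pcalc.
Definition pi (t : expr k S) : car M := @pi_expr k P t.

Lemma piC f g : pi f ⊚ pi g = pi (Comp f g).
Proof. exact: esym (@pi_cmp k P f g). Qed.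
Lemma piT f g : pi f ⊗ pi g = pi (Tens f g).
Proof. exact: esym (@pi_tns k P f g). Qed.
Lemma piI A : @cid k M A = pi (@Id k S A).
Proof. by []. Qed.
Lemma pi_eqm t t' : @eqm k P t t' -> pi t = pi t'.
Proof. by move/(@pi_eq k P). Qed.
Lemma pi_rel t t' : common_rel q t t' -> pi t = pi t'.
Proof. by move/common/pi_eqm. Qed.
Lemma pi_ty A B t : oftype (S := S) A B t -> @ty k M (pi t) A B.
Proof. by move/(@uty_pi k P). Qed.
Lemma br_pi_scale (A B : seq (obj U)) a t : oftype (S := S) A B t ->
  @br k M A B (pi (Scale a t)) = a *: @br k M A B (pi t).
Proof. exact: (@ubr_scale k P). Qed.
Lemma br_pi_add (A B : seq (obj U)) t t' : oftype (S := S) A B t -> oftype (S := S) A B t' ->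
  @br k M A B (pi (Add t t')) = @br k M A B (pi t) + @br k M A B (pi t').
Proof. exact: (@ubr_add k P). Qed.
Lemma br_pi_big (A B : seq (obj U)) I (r : seq I) (p : pred I) (F : I -> expr k S) :
  (forall i, p i -> oftype (S := S) A B (F i)) ->
  @br k M A B (pi (\big[@Add k S/@Zero k S A B]_(i <- r | p i) F i))
  = \sum_(i <- r | p i) @br k M A B (pi (F i)).
Proof. exact: (@ubr_big k P). Qed.
Lemma pi_eqmP (A B : seq (obj U)) t t' : oftype (S := S) A B t -> oftype (S := S) A B t' ->
  @br k M A B (pi t) = @br k M A B (pi t') -> @eqm k P t t'.
Proof. exact: (@ubr_eqm k P). Qed.

Lemma pi_merge_ty a b : @ty k M (pi (merge a b)) (st a ⋅ st b) (st (a + b)).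
Proof. by apply: pi_ty; rewrite /oftype wf_merge src_merge tgt_merge !eqxx. Qed.
Lemma pi_split_ty a b : @ty k M (pi (split a b)) (st (a + b)) (st a ⋅ st b).
Proof. by apply: pi_ty; rewrite /oftype wf_split src_split tgt_split !eqxx. Qed.
Lemma pi_cross_ty a b : @ty k M (pi (cross a b)) (st a ⋅ st b) (st b ⋅ st a).
Proof. by apply: pi_ty; rewrite /oftype wf_cross src_cross tgt_cross !eqxx. Qed.
Lemma pi_crossV_ty a b : @ty k M (pi (crossV a b)) (st b ⋅ st a) (st a ⋅ st b).
Proof. by apply: pi_ty; rewrite /oftype wf_crossV src_crossV tgt_crossV !eqxx. Qed.
#[local] Instance pi_merge_typed a b : typed (pi (merge a b)) _ _ := pi_merge_ty a b.
#[local] Instance pi_split_typed a b : typed (pi (split a b)) _ _ := pi_split_ty a b.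
#[local] Instance pi_cross_typed a b : typed (pi (cross a b)) _ _ := pi_cross_ty a b.
#[local] Instance pi_crossV_typed a b : typed (pi (crossV a b)) _ _ := pi_crossV_ty a b.

Lemma pi_mergen0 a : pi (merge a 0) = cid (st a).
Proof. by case: a => //= a; rewrite addn0. Qed.
Lemma pi_splitn0 a : pi (split a 0) = cid (st a).
Proof. by case: a => //= a; rewrite addn0. Qed.
Lemma pi_crossn0 a : pi (cross a 0) = cid (st a).
Proof. by case: a => //= a; rewrite addn0. Qed.
Lemma pi_merge0n b : pi (merge 0 b) = cid (st b).
Proof. by []. Qed.
Lemma pi_split0n b : pi (split 0 b) = cid (st b).
Proof. by []. Qed.
Lemma pi_cross0n b : pi (cross 0 b) = cid (st b).
Proof. by []. Qed.

Lemma pi_mergeA a b c : pi (merge (a + b) c) ⊚ (pi (merge a b) ⊗ cid (st c))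
  = pi (merge a (b + c)) ⊚ (cid (st a) ⊗ pi (merge b c)).
Proof.
case: (posnP a) => [->|a0]; first by rewrite !pi_merge0n add0n; mon.
case: (posnP b) => [->|b0]; first by rewrite addn0 add0n pi_merge0n pi_mergen0; mon.
case: (posnP c) => [->|c0]; first by rewrite addn0 !pi_mergen0; mon.
by rewrite !piI !piT !piC; apply: pi_rel; apply: rel_W1m.
Qed.

Lemma pi_splitA a b c : (pi (split a b) ⊗ cid (st c)) ⊚ pi (split (a + b) c)
  = (cid (st a) ⊗ pi (split b c)) ⊚ pi (split a (b + c)).
Proof.
case: (posnP a) => [->|a0]; first by rewrite !pi_split0n add0n; mon.
case: (posnP b) => [->|b0]; first by rewrite addn0 add0n pi_split0n pi_splitn0; mon.
case: (posnP c) => [->|c0]; first by rewrite addn0 !pi_splitn0; mon.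
by rewrite !piI !piT !piC; apply: pi_rel; apply: rel_W1s.
Qed.

Definition rung (i : nat * nat * nat * nat) : car M := let: (s, x, y, t) := i in
  (pi (merge s y) ⊗ pi (merge x t)) ⊚ (cid (st s) ⊗ pi (cross x y) ⊗ cid (st t))
  ⊚ (pi (split s x) ⊗ pi (split y t)).

(** The side condition determines t from s, so each inner sum has at most one term. *)
Lemma sum_mats (V : lmodType k) a b c d (F : nat * nat * nat * nat -> V) : (a + c = b + d)%N ->
  \sum_(s < (minn a b).+1) \sum_(t < (minn c d).+1 | (t + a == s + d)%N)
    F (nat_of_ord s, a - s, c - t, nat_of_ord t)%N
  = \sum_(i <- mats a c b d) F i.
Proof.
move=> e; rewrite /mats big_map big_filter.
have -> : iota 0 (minn a b).+1 = index_iota 0 (minn a b).+1 by rewrite /index_iota subn0.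
rewrite big_mkord [RHS]big_mkcond /=; apply: eq_bigr => -[s ls] _ /=.
case: (leqP a (s + d)) => h; last by rewrite big_pred0 // => t; lia.
have lt : (s + d - a < (minn c d).+1)%N by lia.
rewrite (big_pred1 (Ordinal lt)) /=; last first.
  by move=> t; apply/eqP/eqP => [h'|->] /=; [apply: val_inj => /=; lia | lia].
by congr (F (_, _, _, _)); lia.
Qed.

Lemma sum_mats1 (V : lmodType k) a c b d (F : nat * nat * nat * nat -> V) i :
  perm_eq (mats a c b d) [:: i] -> \sum_(i <- mats a c b d) F i = F i.
Proof. by move=> e; rewrite (perm_big _ e) big_seq1. Qed.

(** W2 is imposed for positive thicknesses only. When one of the four is 0 there is exactly one
    matrix, its coefficient is 1, and deleting the empty strands makes both sides equal. *)
Lemma pi_split_merge a c b d : (a + c = b + d)%N ->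
  @br k M (st a ⋅ st c) (st b ⋅ st d) (pi (split b d) ⊚ pi (merge a c))
  = \sum_(i <- mats a c b d) q ^+ (i.1.1.1 * i.2) *: br (st a ⋅ st c) (st b ⋅ st d) (rung i).
Proof.
move=> e.
have mats1 i : i \in mats a c b d -> (a == 0)%N || (b == 0)%N || (c == 0)%N || (d == 0)%N ->
    perm_eq (mats a c b d) [:: i].
  move=> im z; apply: uniq_perm => //; first exact: mats_uniq.
  move: im; case: i => [[[s x] y] t]; rewrite mem_mats // => im [[[s' x'] y'] t'].
  by rewrite mem_mats // inE !xpair_eqE; lia.
have mem1 : (minn a b, a - minn a b, b - minn a b, d - (a - minn a b))%N \in mats a c b d by rewrite
  mem_mats //; lia.
case: (posnP a) => [a0|a0].
  subst a; rewrite (sum_mats1 _ (mats1 (0, 0, b, d)%N _ _)) ?mem_mats //; last by lia.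
  rewrite mul0n expr0 scale1r /rung !pi_merge0n ?pi_split0n ?pi_cross0n.
  have -> : c = (b + d)%N by lia.
  by congr br; mon.
case: (posnP c) => [c0|c0].
  subst c; rewrite (sum_mats1 _ (mats1 (b, d, 0, 0)%N _ _)) ?mem_mats //; [|lia|lia].
  rewrite muln0 expr0 scale1r /rung !pi_mergen0 ?pi_splitn0 ?pi_crossn0.
  have -> : a = (b + d)%N by lia.
  by congr br; mon.
case: (posnP b) => [b0|b0].
  subst b; rewrite (sum_mats1 _ (mats1 (0, a, 0, c)%N _ _)) ?mem_mats //; [|lia|lia].
  rewrite mul0n expr0 scale1r /rung !pi_split0n ?pi_merge0n ?pi_crossn0.
  have -> : d = (a + c)%N by lia.
  by congr br; mon.
case: (posnP d) => [d0|d0].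
  subst d; rewrite (sum_mats1 _ (mats1 (a, 0, c, 0)%N _ _)) ?mem_mats //; [|lia|lia].
  rewrite muln0 expr0 scale1r /rung !pi_splitn0 ?pi_mergen0 ?pi_cross0n.
  have -> : b = (a + c)%N by lia.
  by congr br; mon.
have T (s t : nat) : (s < (minn a b).+1)%N -> (t < (minn c d).+1)%N -> (t + a == s + d)%N ->
  oftype (S := S) (strand a ++ strand c) (strand b ++ strand d)
    (Comp (Comp (Tens (merge s (b - s)) (merge (a - s) t))
      (Tens (Tens (idb s) (cross (a - s) (c - t))) (idb t))) (Tens (split s (a - s)) (split (c - t)
        t))).
  move=> ls lt st.
  have [x ea] : exists x, a = (s + x)%N by exists (a - s)%N; lia.
  have [y ec] : exists y, c = (y + t)%N by exists (c - t)%N; lia.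
  have eb : b = (s + y)%N by lia.
  have ed : d = (x + t)%N by lia.
  by subst a b c d; rewrite !addKn addnK /oftype /= !diagE /= -!catA !eqxx /=.
rewrite piC (pi_rel (@rel_W2 k q U D dth a b c d a0 b0 c0 d0 e)).
rewrite br_pi_big; last first.
  by move=> s _; apply: oftype_big => t st; apply: T (ltn_ord s) (ltn_ord t) st.
rewrite -(sum_mats (fun i => q ^+ (i.1.1.1 * i.2) *: br (st a ⋅ st c) (st b ⋅ st d) (rung i)) e).
apply: eq_bigr => s _; rewrite br_pi_big; last first.
  by move=> t st; apply: T (ltn_ord s) (ltn_ord t) st.
apply: eq_bigr => t st_; rewrite br_pi_scale; last exact: T (ltn_ord s) (ltn_ord t) st_.
congr (_ *: br _ _ _); rewrite /rung !piI !piT !piC.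
by have -> : (b - s = c - t)%N by have := ltn_ord s; have := ltn_ord t; lia.
Qed.

Definition pwebs : webs q M := Webs pi_merge_ty pi_split_ty pi_cross_ty pi_merge0n pi_mergen0
  pi_split0n pi_splitn0 pi_cross0n pi_crossn0 pi_mergeA pi_splitA pi_split_merge.

Hypothesis (qn0 : forall n, qint q n.+1 != 0).

Lemma pi_oftype (A B : seq (obj U)) t : @ty k M (pi t) A B -> oftype (S := S) A B t.
Proof. by move/(@uty_pi k P). Qed.

Lemma pi_crossVn0 a : pi (crossV a 0) = cid (st a).
Proof. by case: a => //= a; rewrite addn0. Qed.

Lemma pi_crossVK a b : pi (crossV a b) ⊚ pi (cross a b) = cid (st a ⋅ st b).
Proof.
case: (posnP a) => [->|a0]; first by rewrite pi_cross0n; mon.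
case: (posnP b) => [->|b0]; first by rewrite !pi_crossn0 ?pi_crossVn0; mon.
by rewrite -tns_id !piI piC piT; apply: pi_rel; apply: rel_crossVl.
Qed.

Lemma pi_crossK a b : pi (cross a b) ⊚ pi (crossV a b) = cid (st b ⋅ st a).
Proof.
case: (posnP a) => [->|a0]; first by rewrite pi_cross0n; mon.
case: (posnP b) => [->|b0]; first by rewrite !pi_crossn0 ?pi_crossVn0; mon.
by rewrite -tns_id !piI piC piT; apply: pi_rel; apply: rel_crossVr.
Qed.

Lemma pi_merge_split_n1 a : br (st (a + 1)) (st (a + 1)) (pi (merge a 1) ⊚ pi (split a 1))
  = qint q a.+1 *: br (st (a + 1)) (st (a + 1)) (cid (st (a + 1))).
Proof.
case: a => [|a]; first by rewrite (qint1 (qn0 0)) scale1r; congr br;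
  rewrite !pi_merge0n ?pi_split0n; mon.
rewrite piC (pi_rel (@rel_W3 k q U D dth a.+1 1 isT isT)) br_pi_scale;
  last by rewrite /oftype /= !eqxx.
by rewrite qbinom_nn.
Qed.

Lemma pi_merge_split_1n a : br (st (a + 1)) (st (a + 1)) (pi (merge 1 a) ⊚ pi (split 1 a))
  = qint q a.+1 *: br (st (a + 1)) (st (a + 1)) (cid (st (a + 1))).
Proof.
rewrite addnC; case: a => [|a]; first by rewrite (qint1 (qn0 0)) scale1r; congr br;
  rewrite !pi_mergen0 ?pi_splitn0; mon.
rewrite piC (pi_rel (@rel_W3 k q U D dth 1 a.+1 isT isT)) br_pi_scale;
  last by rewrite /oftype /= !eqxx.
by rewrite addnC qbinom_n1 // (qn0 0).
Qed.

Section PAffine.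
Variables (x xV : expr k S).
Hypothesis x_type : oftype (S := S) (@strand U 1) (@strand U 1) x.
Hypothesis xV_type : oftype (S := S) (@strand U 1) (@strand U 1) xV.
Hypothesis xK : @eqm k P (Comp xV x) (idb 1).
Hypothesis xVK : @eqm k P (Comp x xV) (idb 1).
Hypothesis cross_x : @eqm k P (Comp (cross 1 1) (Tens x (idb 1))) (Comp (Tens (idb 1) x)
  (crossV 1 1)).
Hypothesis x_cross : @eqm k P (Comp (Tens x (idb 1)) (cross 1 1)) (Comp (crossV 1 1)
  (Tens (idb 1) x)).

Definition paffine : affine q M.
Proof.
refine (@Affine k q M pwebs (fun a b => pi (crossV a b)) (pi x) (pi xV) pi_crossV_ty pi_crossVK
  pi_crossK
  (pi_ty x_type) (pi_ty xV_type) _ _ pi_merge_split_n1 pi_merge_split_1n _ _);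
  by rewrite ?piI ?piT ?piC; apply: pi_eqm.
Defined.

Section Power.
Variables (y : expr k S).
Hypothesis y_type : oftype (S := S) (@strand U 1) (@strand U 1) y.

(** The left side of W6 for an arbitrary thin endomorphism y in place of the dot. *)
Definition thick_pow n := Comp (Comp (merge1s n) (tens_pow y n)) (split1s n).

Lemma thick_powS n :
  pi (thick_pow n.+1) = pi (merge n 1) ⊚ (pi (thick_pow n) ⊗ pi y) ⊚ pi (split n 1).
Proof.
have t1 : typed (pi (merge1s n)) (ones U dth n : cob M) (st n) :=
  pi_ty (@oftype_merge1s k U D dth n).
have t2 : typed (pi (split1s n)) (st n) (ones U dth n : cob M) :=
  pi_ty (@oftype_split1s k U D dth n).
have t3 : typed (pi (tens_pow y n)) (ones U dth n : cob M) (ones U dth n : cob M) :=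
  pi_ty (oftype_tens_pow n y_type).
have t4 : typed (pi y) (st 1) (st 1) := pi_ty y_type.
rewrite /thick_pow [merge1s n.+1]/= [tens_pow y n.+1]/= [split1s n.+1]/= -!piC -!piT.
have -> : pi (idb 1) = cid (st 1) by [].
mon.
Qed.

Lemma thick_pow_type n : oftype (S := S) (@strand U n) (@strand U n) (thick_pow n).
Proof.
by apply: oftype_Comp3; [exact: oftype_merge1s | exact: oftype_tens_pow | exact: oftype_split1s].
Qed.

(** As [n+1]! = [n]! [n+1], dividing the recursion [thick_powS] by factorials gives exactly
    [dotsS]. *)
Lemma pdots (X : nat -> car M) :
  cr paffine 1 1 ⊚ (pi y ⊗ pi y) = (pi y ⊗ pi y) ⊚ cr paffine 1 1 ->
  X 0%N = cid (st 0) -> (forall n, ty (X n) (st n) (st n)) ->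
  (forall n, br (st n) (st n) (X n) = (qfact q n)^-1 *: br (st n) (st n) (pi (thick_pow n))) ->
  dots paffine (pi y) X.
Proof.
move=> yc X0 XT XE; split=> //; first exact: pi_ty.
move=> n; have Xt i : typed (X i) _ _ := XT i.
have t4 : typed (pi y) (st 1) (st 1) := pi_ty y_type.
have Yt : typed (pi (thick_pow n)) (st n) (st n) := pi_ty (thick_pow_type n).
have -> : br (st (n + 1)) (st (n + 1)) (mg paffine n 1 ⊚ (X n ⊗ pi y) ⊚ sp paffine n 1)
  = (qfact q n)^-1 *: br (st (n + 1)) (st (n + 1)) (mg paffine n 1 ⊚ (pi (thick_pow n) ⊗ pi y)
    ⊚ sp paffine n 1).
  by ctx1 (XE n) (mg paffine n 1) (@one _ M) (@st _ M 1) ((cid (st n) ⊗ pi y) ⊚ sp paffine n 1).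
rewrite XE addn1 [pi (thick_pow n.+1)]thick_powS scalerA; congr (_ *: _).
have -> : qfact q n.+1 = qfact q n * qint q n.+1 by rewrite /qfact big_nat_recr.
by rewrite invfM mulrCA mulfV ?mulr1.
Qed.
End Power.
Section PSchur.
Variables (u : U) (v : k).
Local Notation rd := ([:: Red u] : cob M).

Lemma pi_up_ty a : @ty k M (pi (up a u)) (st a ⋅ rd) (rd ⋅ st a).
Proof. by apply: pi_ty; rewrite /oftype wf_up src_up tgt_up !eqxx. Qed.
Lemma pi_down_ty a : @ty k M (pi (down u a)) (rd ⋅ st a) (st a ⋅ rd).
Proof. by apply: pi_ty; rewrite /oftype wf_down src_down tgt_down !eqxx. Qed.
#[local] Instance pi_up_typed a : typed (pi (up a u)) _ _ := pi_up_ty a.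
#[local] Instance pi_down_typed a : typed (pi (down u a)) _ _ := pi_down_ty a.

Lemma pi_up0 : pi (up 0 u) = cid rd. Proof. by []. Qed.
Lemma pi_down0 : pi (down u 0) = cid rd. Proof. by []. Qed.

Lemma pi_down_merge a b : pi (down u (a + b)) ⊚ (cid rd ⊗ pi (merge a b))
  = (pi (merge a b) ⊗ cid rd) ⊚ (cid (st a) ⊗ pi (down u b)) ⊚ (pi (down u a) ⊗ cid (st b)).
Proof.
case: (posnP a) => [->|a0]; first by rewrite !pi_merge0n pi_down0; mon.
case: (posnP b) => [->|b0]; first by rewrite addn0 !pi_mergen0 pi_down0; mon.
by rewrite !piI !piT !piC; apply: pi_rel; apply: rel_S1lm.
Qed.

Lemma pi_up_merge a b : pi (up (a + b) u) ⊚ (pi (merge a b) ⊗ cid rd)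
  = (cid rd ⊗ pi (merge a b)) ⊚ (pi (up a u) ⊗ cid (st b)) ⊚ (cid (st a) ⊗ pi (up b u)).
Proof.
case: (posnP a) => [->|a0]; first by rewrite !pi_merge0n pi_up0; mon.
case: (posnP b) => [->|b0]; first by rewrite addn0 !pi_mergen0 pi_up0; mon.
by rewrite !piI !piT !piC; apply: pi_rel; apply: rel_S1rm.
Qed.

Hypothesis down_up : @eqm k P (Comp (down u 1) (up 1 u))
  (Add (Tens x (idr u)) (Scale (- v) (Tens (idb 1) (idr u)))).
Hypothesis up_down : @eqm k P (Comp (up 1 u) (down u 1))
  (Add (Tens (idr u) x) (Scale (- v) (Tens (idr u) (idb 1)))).
Hypothesis down_cross_up :
  @eqm k P (Comp (Comp (Tens (down u 1) (idb 1)) (Tens (idr u) (cross 1 1))) (Tens (up 1 u)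
    (idb 1)))
    (Add (Comp (Comp (Tens (idb 1) (up 1 u)) (Tens (cross 1 1) (idr u))) (Tens (idb 1) (down u 1)))
      (Scale (- (q^-1 - q)) (Tens (Tens (idb 1) (idr u)) x))).

Let x_ty : @ty k M (pi x) (st 1) (st 1) := pi_ty x_type.

Definition pschur : schur paffine v.
Proof.
refine (@SchurCalc k q M paffine v rd (fun a => pi (up a u)) (fun a => pi (down u a)) pi_up_ty
  pi_down_ty
  pi_up0 pi_down0 pi_down_merge pi_up_merge _ _ _).
- rewrite piC (pi_eqm down_up) br_pi_add; last 2 first.
  + by apply: pi_oftype; rewrite -piT; apply: ty_tns x_ty (ty_id rd).
  + by rewrite /oftype /= !eqxx.
  rewrite br_pi_scale; last by rewrite /oftype /= !eqxx.
  by rewrite scale1r -!piT tns_id.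
- rewrite piC (pi_eqm up_down) br_pi_add; last 2 first.
  + by apply: pi_oftype; rewrite -piT; apply: ty_tns (ty_id rd) x_ty.
  + by rewrite /oftype /= !eqxx.
  rewrite br_pi_scale; last by rewrite /oftype /= !eqxx.
  by rewrite scale1r -!piT tns_id.
have T3 : oftype (S := S) (st 1 ⋅ rd ⋅ st 1 : cob M) (st 1 ⋅ rd ⋅ st 1 : cob M)
  (Tens (Tens (idb 1) (idr u)) x).
  by apply: pi_oftype; rewrite -!piT; apply: ty_tns (ty_tns (ty_id (st 1)) (ty_id rd)) x_ty.
rewrite !piI !piT !piC (pi_eqm down_cross_up) br_pi_add; [|by rewrite /oftype /= !eqxx|exact: T3].
by rewrite (br_pi_scale _ T3) scale1r.
Defined.
End PSchur.

End PAffine.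

End Common.

(** * The isomorphisms *)

Section Reduction.
Variables (k : fieldType) (q : k) (q0 : q != 0) (qn0 : forall n, qint q n.+1 != 0).
Variables (U : eqType) (coef : U -> k).
Local Notation Sf := (web_sig U (@id thickness)).
Local Notation Sr := (web_sig U (fun _ : unit => thick 0)).
Local Notation Pf := (schur_presentation q coef).
Local Notation Pr := (schur_presentation' q coef).
Local Notation wfR := (@reduced_rel_wf k q U coef).
Local Notation wfF := (@full_rel_wf k q U coef).

Definition thin_dot (_ : unit) : expr k Sf := @Gen k Sf (GDot (thick 0)).
Definition thin_dotV (_ : unit) : expr k Sf := @Gen k Sf (GDotV (thick 0)).
Local Notation x := (dot1 k U).
Local Notation xV := (@Gen k Sr (GDotV tt)).
(* Relation W6 solved for the thick dot. *)
Definition thick_dot (a : thickness) : expr k Sr := Scale (qfact q (val a))^-1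
  (thick_pow x (val a)).
Definition thick_dotV (a : thickness) : expr k Sr := Scale (qfact q (val a))^-1
  (thick_pow xV (val a)).
Local Notation reduce := (translate thick_dot thick_dotV).
Local Notation expand := (translate thin_dot thin_dotV).

Lemma x_type : oftype (S := Sr) (strand 1) (strand 1) x. Proof. by []. Qed.
Lemma xV_type : oftype (S := Sr) (strand 1) (strand 1) xV. Proof. by []. Qed.

Lemma thick_dot_type a : oftype (S := Sr) [:: Black a] [:: Black a] (thick_dot a).
Proof. by rewrite -!strand_val; apply: (thick_pow_type x_type). Qed.
Lemma thick_dotV_type a : oftype (S := Sr) [:: Black a] [:: Black a] (thick_dotV a).
Proof. by rewrite -!strand_val; apply: (thick_pow_type xV_type). Qed.

Lemma common_reduced t t' : common_rel q t t' -> @eqm k Pr t t'.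
Proof. by move=> h; apply: eqm_rel; apply: reduced_common. Qed.
Lemma common_full t t' : common_rel q t t' -> @eqm k Pf t t'.
Proof. by move=> h; apply: eqm_rel; apply: full_common. Qed.

Lemma x_VK : @eqm k Pr (Comp xV x) (idb 1).
Proof. exact: (common_reduced (@rel_dotVl k q U unit (fun=> thick 0) tt)). Qed.
Lemma x_KV : @eqm k Pr (Comp x xV) (idb 1).
Proof. exact: (common_reduced (@rel_dotVr k q U unit (fun=> thick 0) tt)). Qed.

Local Notation M := (pcalc wfR).
Definition reduced_affine : affine q M := @paffine k q U unit (fun=> thick 0) _ wfR common_reduced
  qn0 x xV
  x_type xV_type x_VK x_KV (eqm_rel (reduced_W4l q coef : prel (p := Pr) _ _))
  (eqm_rel (reduced_W4r q coef : prel (p := Pr) _ _)).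
Definition reduced_schur u : schur reduced_affine (coef u) := @pschur k q U unit (fun=> thick 0) _
  wfR common_reduced qn0 x xV
  x_type xV_type x_VK x_KV (eqm_rel (reduced_W4l q coef : prel (p := Pr) _ _))
  (eqm_rel (reduced_W4r q coef : prel (p := Pr) _ _)) u (coef u)
  (eqm_rel (reduced_S2l q coef u : prel (p := Pr) _ _))
  (eqm_rel (reduced_S2r q coef u : prel (p := Pr) _ _))
  (eqm_rel (reduced_S3 q coef u : prel (p := Pr) _ _)).

Definition reduced_dot n : car M := pi wfR (reduce (dot k U n)).
Definition reduced_dotV n : car M := pi wfR (reduce (dotV k U n)).

Lemma thick_pow0 y : pi wfR (thick_pow y 0) = cid (st 0).
Proof.
have e : pi wfR (idb 0) = cid (st 0) by [].
by rewrite /thick_pow -!piC e; mon.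
Qed.

Lemma dots_reduced_dot : dots reduced_affine (dx reduced_affine) reduced_dot.
Proof.
apply: pdots => //.
- exact: (@dx_comm _ _ _ reduced_affine).
- case=> [|n]; first exact: (ty_id (st 0)).
  exact: (pi_ty wfR (thick_dot_type _)).
case=> [|n].
  by rewrite thick_pow0 /qfact big_geq // invr1 scale1r.
exact: (br_pi_scale wfR _ (thick_pow_type x_type n.+1)).
Qed.

Lemma dots_reduced_dotV : dots reduced_affine (dxV reduced_affine) reduced_dotV.
Proof.
apply: (@pdots _ _ _ _ _ _ _ _ _ _ _ _ _ _ _ _ _ xV) => //.
- exact: (@dxV_comm _ _ _ reduced_affine).
- case=> [|n]; first exact: (ty_id (st 0)).
  exact: (pi_ty wfR (thick_dotV_type _)).
case=> [|n].
  by rewrite thick_pow0 /qfact big_geq // invr1 scale1r.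
exact: (br_pi_scale wfR _ (thick_pow_type xV_type n.+1)).
Qed.

Lemma pi_inj t t' : pi wfR t = pi wfR t' -> @eqm k Pr t t'.
Proof. by move/(@pi_eq k Pr). Qed.

Lemma pi_thick_dot d : pi wfR (thick_dot d) = reduced_dot (val d).
Proof. by case: d => -[] // n p; congr pi; congr thick_dot; apply: val_inj. Qed.
Lemma pi_thick_dotV d : pi wfR (thick_dotV d) = reduced_dotV (val d).
Proof. by case: d => -[] // n p; congr pi; congr thick_dotV; apply: val_inj. Qed.

Lemma reduce_dotK d : @eqm k Pr (Comp (thick_dot d) (thick_dotV d)) (idb (val d)).
Proof.
apply: pi_inj; rewrite -piC pi_thick_dot pi_thick_dotV.
by rewrite (dots_inv q0 qn0 dots_reduced_dot dots_reduced_dotV) // dxVK.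
Qed.

Lemma reduce_dotVK d : @eqm k Pr (Comp (thick_dotV d) (thick_dot d)) (idb (val d)).
Proof.
apply: pi_inj; rewrite -piC pi_thick_dot pi_thick_dotV.
by rewrite (dots_inv q0 qn0 dots_reduced_dotV dots_reduced_dot) // dxK.
Qed.

Lemma full_dot_type a : oftype (S := Sf) (strand a) (strand a) (dot k U a).
Proof. by rewrite /oftype !dotE !eqxx. Qed.
Lemma reduce_dot1 : @eqm k Pr (reduce (dot k U 1)) x.
Proof. by apply: pi_inj; apply: (dots1 qn0 dots_reduced_dot). Qed.
Lemma reduce_dotV1 : @eqm k Pr (reduce (dotV k U 1)) xV.
Proof. by apply: pi_inj; apply: (dots1 qn0 dots_reduced_dotV). Qed.

Lemma tens_pow_eqm (y y' : expr k Sr) n : @eqm k Pr y y' -> @eqm k Pr (tens_pow y n)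
  (tens_pow y' n).
Proof.
by move=> e; elim: n => [|n IH] /=; [apply: eqm_refl | apply: eqm_Tens].
Qed.

Lemma scaleK (P : presentation k) (a : k) (t : expr k P) : a != 0 ->
  @eqm k P (Scale a (Scale a^-1 t)) t.
Proof.
move=> a0; apply: eqm_trans (eqm_scaleA _ _ _) _; rewrite mulfV //; exact: eqm_scale1.
Qed.

Lemma reduce_W6 a (y : expr k Sf) (y' : expr k Sr) : @eqm k Pr (reduce y) y' ->
  @eqm k Pr (reduce (Comp (Comp (merge1s a) (tens_pow y a)) (split1s a)))
    (Scale (qfact q a) (Scale (qfact q a)^-1 (thick_pow y' a))).
Proof.
move=> e; apply: eqm_trans (eqm_sym (scaleK _ (qfact_neq0 qn0 a))).
rewrite /= !translate_diagE; apply: eqm_Comp; last exact: eqm_refl.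
by apply: eqm_Comp; [exact: eqm_refl | apply: tens_pow_eqm].
Qed.

Lemma pi_reduce_omega a t : (t <= a)%N -> pi wfR (reduce (omega k U a (a - t)))
  = Om reduced_affine reduced_dot (a - t) t.
Proof.
by move=> ta; rewrite /omega /= !translate_diagE -!piC -!piT subKn.
Qed.

Lemma reduce_rel t t' : full_rel q coef t t' -> @eqm k Pr (reduce t) (reduce t').
Proof.
move=> h; have [wt [wt' st tt]] := full_rel_wf h.
(* S2 and S3 contain sums, which are compared in a typed space of morphisms; both sides must be
   known to have the same type. *)
have type_l : oftype (S := Sr) (src t) (tgt t) (reduce t).
  by apply: (translate_type thick_dot_type thick_dotV_type); rewrite /oftype wt !eqxx.
have type_r : oftype (S := Sr) (src t) (tgt t) (reduce t').
  by apply: (translate_type thick_dot_type thick_dotV_type); rewrite /oftype -wt' wt st tt !eqxx.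
case: h type_l type_r {wt wt' st tt} => {t t'}.
- move=> t t' h _ _.
  exact: (translate_common (wf2 := wfR) common_reduced reduce_dotK reduce_dotVK h).
- move=> a b a0 b0 _ _; apply: pi_inj; rewrite /= !translate_diagE -!piC -!piT.
  exact: (cr_dots q0 qn0 dots_reduced_dot).
- move=> a b a0 b0 _ _; apply: pi_inj; rewrite /= !translate_diagE -!piC -!piT.
  exact: (dots_cr q0 qn0 dots_reduced_dot).
- move=> a b a0 b0 _ _; apply: pi_inj; rewrite /= !translate_diagE -!piC -!piT.
  exact: (dots_sp q0 qn0 dots_reduced_dot).
- move=> a b a0 b0 _ _; apply: pi_inj; rewrite /= !translate_diagE -!piC -!piT.
  exact: (dots_mg q0 qn0 dots_reduced_dot).
- by case=> // a _ _ _; apply: (reduce_W6 a.+1 reduce_dot1).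
- by case=> // a _ _ _; apply: (reduce_W6 a.+1 reduce_dotV1).
- move=> a u _ /= Tl Tr; move: Tl Tr; rewrite src_up tgt_down => Tl Tr.
  have omT (t : 'I_a.+1) : oftype (S := Sr) (strand a ++ [:: Red u]) (strand a ++ [:: Red u])
      (reduce (Tens (omega k U a (a - t)) (idr u))).
    have ta : (t <= a)%N by rewrite -ltnS.
    apply: (pi_oftype (wfr := wfR)); rewrite [reduce _]/= -piT pi_reduce_omega //.
    apply: ty_tns (ty_id _); have := Om_typed dots_reduced_dot (a - t) t.
    by rewrite /typed subnK.
  apply: (pi_eqmP Tl Tr); rewrite !translate_diagE -piC.
  transitivity (\sum_(t < a.+1) zeta q (coef u) a t *: @br k M (strand a ++ [:: Red u])
    (strand a ++ [:: Red u])
    (Om reduced_affine reduced_dot (a - t) t ⊗ cid ([:: Red u] : cob M)));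
      first exact: (ld_ru q0 qn0 (reduced_schur u) dots_reduced_dot a).
  rewrite translate_big br_pi_big; last by move=> t _; apply: omT.
  apply: eq_bigr => t _; rewrite [reduce _]/= br_pi_scale; last exact: omT.
  by rewrite -piT pi_reduce_omega // -ltnS.
- move=> a u _ /= Tl Tr; move: Tl Tr; rewrite src_down tgt_up => Tl Tr.
  have omT (t : 'I_a.+1) : oftype (S := Sr) ([:: Red u] ++ strand a) ([:: Red u] ++ strand a)
      (reduce (Tens (idr u) (omega k U a (a - t)))).
    have ta : (t <= a)%N by rewrite -ltnS.
    apply: (pi_oftype (wfr := wfR)); rewrite [reduce _]/= -piT pi_reduce_omega //.
    apply: ty_tns (ty_id _) _; have := Om_typed dots_reduced_dot (a - t) t.
    by rewrite /typed subnK.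
  apply: (pi_eqmP Tl Tr); rewrite !translate_diagE -piC.
  transitivity (\sum_(t < a.+1) zeta q (coef u) a t *: @br k M ([:: Red u] ++ strand a)
    ([:: Red u] ++ strand a)
    (cid ([:: Red u] : cob M) ⊗ Om reduced_affine reduced_dot (a - t) t));
      first exact: (ru_ld q0 qn0 (reduced_schur u) dots_reduced_dot a).
  rewrite translate_big br_pi_big; last by move=> t _; apply: omT.
  apply: eq_bigr => t _; rewrite [reduce _]/= br_pi_scale; last exact: omT.
  by rewrite -piT pi_reduce_omega // -ltnS.
move=> a b u _ _ /= Tl Tr; move: Tl Tr; rewrite src_up tgt_down => Tl Tr.
pose W1 := (strand a ++ [:: Red u]) ++ strand b : seq (obj U).
pose W2 := (strand b ++ [:: Red u]) ++ strand a : seq (obj U).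
pose T s := Comp (Comp (Tens (Tens (merge s (b - s)) (idr u)) (merge (a - s) s))
  (Tens (Tens (idb s) (S3_middle k a b s u)) (dot k U s)))
  (Tens (Tens (split s (a - s)) (idr u)) (split (b - s) s)).
have TE s : pi wfR (reduce (T s)) = Tw (reduced_schur u) reduced_dot s (a - s) (b - s)
  (sp reduced_affine (b - s) s).
  by rewrite /T /S3_middle /= !translate_diagE -!piC -!piT -!piC -!piT.
have TT (s : 'I_(minn a b).+1) : oftype (S := Sr) W1 W2 (reduce (T s)).
  apply: (pi_oftype (wfr := wfR)); rewrite TE.
  have := ltn_ord s; rewrite ltnS leq_min => /andP[sa sb].
  have := @Tw_ty _ _ _ _ _ (reduced_schur u) reduced_dot dots_reduced_dot s (a - s) (b - s)
    (sp reduced_affine (b - s) s) (st b) (_ : ty _ _ _).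
  rewrite !subnKC // subnK //; apply.
  by have := sp_ty reduced_affine (b - s) s; rewrite subnK.
apply: (pi_eqmP (A := W1) (B := W2)) => //.
transitivity (\sum_(s < (minn a b).+1) alpha q s *: @br k M W1 W2 (Tw (reduced_schur u) reduced_dot
  s (a - s) (b - s) (sp reduced_affine (b - s) s))).
  rewrite !translate_diagE -!piC -!piT.
  exact: (ld_cr_ru q0 qn0 (reduced_schur u) dots_reduced_dot a b).
have e1 : strand a ++ (Red u :: strand b) = W1 by rewrite -cat1s catA.
have e2 : strand b ++ (Red u :: strand a) = W2 by rewrite -cat1s catA.
rewrite e1 e2.
rewrite translate_big br_pi_big; last by move=> s _; apply: TT.
by apply: eq_bigr => s _; rewrite -TE; symmetry; apply: br_pi_scale (TT s).
Qed.

Lemma oftype_add (S : signature) (W W' : seq (gob S)) (f g : expr k S) :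
  oftype W W' f -> oftype W W' g -> oftype W W' (Add f g).
Proof.
move=> /and3P[wf_ /eqP sf /eqP tf] /and3P[wg /eqP sg /eqP tg].
by rewrite /oftype /= wf_ wg sf sg tf tg !eqxx.
Qed.

(** [g] tensors with the red strand on either side, so both halves of S2 are covered. At a = 1 the
    sum consists of omega_{1,1}, the dot, and omega_{1,0}, the identity with coefficient -u. *)
Lemma expand_S2 u (W : seq (obj U)) (t : expr k Sf) (g : expr k Sf -> expr k Sf) :
    (forall y, oftype (S := Sf) (strand 1) (strand 1) y -> oftype (S := Sf) W W (g y)) ->
    (forall y y', pi wfF y = pi wfF y' -> pi wfF (g y) = pi wfF (g y')) -> oftype (S := Sf) W W t ->
  @eqm k Pf t (\big[@Add k Sf/@Zero k Sf W W]_(t < 2)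
     Scale ((-1) ^+ t * q ^- (t * (1 - t)) * coef u ^+ t) (g (omega k U 1 (1 - t)))) ->
  @eqm k Pf t (Add (g (dot k U 1)) (Scale (- coef u) (g (idb 1)))).
Proof.
move=> gT gE tT e.
have y_typed : typed (pi wfF (dot k U 1)) (st 1) (st 1) := pi_ty wfF (full_dot_type 1).
have om1 : pi wfF (omega k U 1 1) = pi wfF (dot k U 1).
  transitivity (cid (st 1) ⊚ (pi wfF (dot k U 1) ⊗ cid (st 0)) ⊚ cid (st 1)); last mon.
  by rewrite /omega -!piC -!piT.
have om0 : pi wfF (omega k U 1 0) = pi wfF (idb 1).
  have eI : pi wfF (idb 1) = cid (st 1) by [].
  transitivity (cid (st 1) ⊚ (cid (st 0) ⊗ cid (st 1)) ⊚ @cid k (pcalc wfF) (st 1));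
    last by rewrite eI; mon.
  by rewrite /omega -!piC -!piT.
have iT : oftype (S := Sf) (strand 1) (strand 1) (idb 1 : expr k Sf) by [].
have oT (i : 'I_2) : oftype (S := Sf) W W (g (omega k U 1 (1 - i))).
  by apply: gT; case: i => -[|[|]].
have T1 := gT _ (full_dot_type 1); have T0 := gT _ iT.
apply: eqm_trans e _; apply: (@pi_eqmP _ _ _ _ _ wfF W W).
- by apply: oftype_big => i _; apply: oT.
- exact: (oftype_add T1 (T0 : oftype (S := Sf) W W (Scale (- coef u) (g (idb 1))))).
rewrite br_pi_big; last by move=> i _; apply: oT.
have omT r : (r <= 1)%N -> oftype (S := Sf) W W (g (omega k U 1 r)).
  by move=> r1; apply: gT; case: r r1 => [|[|]].
transitivity (@br k (pcalc wfF) W W (pi wfF (Scale ((-1) ^+ 0 * q ^- (0 * (1 - 0)) * coef u ^+ 0)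
  (g (omega k U 1 1))))
    + @br k (pcalc wfF) W W (pi wfF (Scale ((-1) ^+ 1 * q ^- (1 * (1 - 1)) * coef u ^+ 1)
      (g (omega k U 1 0))))).
  by rewrite !big_ord_recl big_ord0 addr0.
rewrite br_pi_add // !br_pi_scale ?omT // (gE _ _ om1) (gE _ _ om0).
by rewrite mul0n subnn muln0 !expr1 !expr0 invr1 !mulr1 mulN1r scale1r.
Qed.

Lemma expand_rel t t' : reduced_rel q coef t t' -> @eqm k Pf (expand t) (expand t').
Proof.
case=> {t t'} /=.
- move=> t t' h; apply: (translate_common (wf2 := wfF) common_full _ _ h) => -[].
    exact: (common_full (@rel_dotVr k q U thickness id (thick 0))).
  exact: (common_full (@rel_dotVl k q U thickness id (thick 0))).
- exact: (eqm_rel (full_W4l q coef (a := 1) (b := 1) isT isT : prel (p := Pf) _ _)).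
- exact: (eqm_rel (full_W4r q coef (a := 1) (b := 1) isT isT : prel (p := Pf) _ _)).
- move=> u; apply: (@expand_S2 u [:: Black (thick 0); Red u] _ (fun y => Tens y (idr u))) => //.
  + move=> y yT; apply: (pi_oftype (wfr := wfF)); rewrite -piT.
    exact: ty_tns (pi_ty wfF yT) (ty_id ([:: Red u] : cob (pcalc wfF))).
  + by move=> y y' e; rewrite -!piT e.
  + by rewrite /oftype /= !eqxx.
  exact: (eqm_rel (full_S2l q coef (a := 1) u isT : prel (p := Pf) _ _)).
- move=> u; apply: (@expand_S2 u [:: Red u; Black (thick 0)] _ (fun y => Tens (idr u) y)) => //.
  + move=> y yT; apply: (pi_oftype (wfr := wfF)); rewrite -piT.
    exact: ty_tns (ty_id ([:: Red u] : cob (pcalc wfF))) (pi_ty wfF yT).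
  + by move=> y y' e; rewrite -!piT e.
  + by rewrite /oftype /= !eqxx.
  exact: (eqm_rel (full_S2r q coef (a := 1) u isT : prel (p := Pf) _ _)).
(* For a = b = 1 the sum in S3 has the terms s = 0 and s = 1. Once empty strands are deleted they
   are the two terms of the thin relation. *)
move=> u; apply: eqm_trans (eqm_rel (full_S3 q coef (a := 1) (b := 1) u isT isT : prel (p :=
  Pf) _ _)) _.
pose W := [:: Black (thick 0); Red u; Black (thick 0)] : seq (obj U).
pose r := [:: Red u] : cob (pcalc wfF).
pose y := pi wfF (dot k U 1).
have y_typed : typed y (st 1) (st 1) := pi_ty wfF (full_dot_type 1).
pose B := (cid (st 1) ⊗ pi wfF (up 1 u)) ⊚ (pi wfF (cross 1 1) ⊗ cid r)
  ⊚ (cid (st 1) ⊗ pi wfF (down u 1)).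
have BE : pi wfF (S3_middle k 1 1 0 u) = B by rewrite /S3_middle -!piC -!piT.
have B_typed : typed B (st 1 ⋅ r ⋅ st 1) (st 1 ⋅ r ⋅ st 1).
  by rewrite -BE; apply: (pi_ty wfF (A := W) (B := W)); rewrite /oftype /= !eqxx.
pose c s := (-1) ^+ s * q ^+ (s * s.-1)./2 * (q^-1 - q) ^+ s * qfact q s.
pose F s := Comp (Comp (Tens (Tens (merge s (1 - s)) (idr u)) (merge (1 - s) s))
  (Tens (Tens (idb s) (S3_middle k 1 1 s u)) (dot k U s)))
  (Tens (Tens (split s (1 - s)) (idr u)) (split (1 - s) s)) : expr k Sf.
have FT s : (s <= 1)%N -> oftype (S := Sf) W W (F s).
  by case: s => [|[|]] // _; rewrite /oftype /= !eqxx.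
have F0 : pi wfF (F 0%N) = B.
  transitivity ((cid (st 1) ⊗ cid r ⊗ cid (st 1)) ⊚ (cid (st 0) ⊗ B ⊗ cid (st 0))
    ⊚ (cid (st 1) ⊗ cid r ⊗ cid (st 1))); last mon.
  by rewrite /F /S3_middle -!piC -!piT -!piC -!piT.
have F1 : pi wfF (F 1%N) = cid (st 1) ⊗ cid r ⊗ y.
  transitivity ((cid (st 1) ⊗ cid r ⊗ cid (st 1)) ⊚ (cid (st 1) ⊗ ((cid (st 0) ⊗ cid r)
    ⊚ (cid (st 0) ⊗ cid r) ⊚ (cid (st 0) ⊗ cid r)) ⊗ y) ⊚ (cid (st 1) ⊗ cid r ⊗ cid (st 1)));
    last mon.
  by rewrite /F /S3_middle -!piC -!piT -!piC -!piT.
pose t1 := Comp (Comp (Tens (idb 1) (up 1 u)) (Tens (cross 1 1) (idr u))) (Tens (idb 1) (down u 1))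
  : expr k Sf.
pose t2 := Tens (Tens (idb 1) (idr u)) (dot k U 1) : expr k Sf.
have T1 : oftype (S := Sf) W W t1 by rewrite /oftype /= !eqxx.
have T2 : oftype (S := Sf) W W t2 by rewrite /oftype /= !eqxx.
have T2' : oftype (S := Sf) W W (Scale (- (q^-1 - q)) t2) by [].
apply: (@pi_eqmP _ _ _ _ _ wfF W W).
- by apply: oftype_big => s _; apply: FT; rewrite -ltnS.
- by rewrite /oftype /= !eqxx.
rewrite br_pi_big; last by move=> s _; apply: FT; rewrite -ltnS.
transitivity (@br k (pcalc wfF) W W (pi wfF (Scale (c 0%N) (F 0%N))) + @br k (pcalc wfF) W W
  (pi wfF (Scale (c 1%N) (F 1%N)))).
  by rewrite !big_ord_recl big_ord0 addr0.
transitivity (@br k (pcalc wfF) W W (pi wfF (Add t1 (Scale (- (q^-1 - q)) t2)))); last by [].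
rewrite !br_pi_scale ?FT // F0 F1 (br_pi_add wfF T1 T2') (br_pi_scale wfF _ T2) /t1 /t2 -!piC -!piT.
congr (_ + _); first by rewrite /c !expr0 /qfact big_geq // !mulr1 scale1r.
by rewrite /c /qfact big_nat1 (qint1 (qn0 0%N)) !expr1 expr0 !mulr1 mulN1r.
Qed.

(** On thin dots the composite is the case of thickness 1 of the defining formula for thick dots; on
    thick dots it is W6, imposed in the full category, divided by [n]!. *)
Lemma isomorphic_presented : isomorphic (presented Pr) (presented Pf).
Proof.
have thin_type d : oftype (S := Sf) [:: Black (thick 0)] [:: Black (thick 0)] (thin_dot d) by [].
have thinV_type d : oftype (S := Sf) [:: Black (thick 0)] [:: Black (thick 0)] (thin_dotV d) by [].
have expandK (y : expr k Sr) (y' : nat -> expr k Sf) n : @eqm k Pf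
  (Comp (Comp (merge1s n) (tens_pow (expand y) n)) (split1s n)) (Scale (qfact q n) (y' n)) ->
    @eqm k Pf (expand (Scale (qfact q n)^-1 (thick_pow y n))) (y' n).
  move=> e; rewrite /= !translate_diagE; apply: eqm_trans (eqm_Scale _ e) _.
  apply: eqm_trans (eqm_scaleA _ _ _) _; rewrite mulVf ?qfact_neq0 //; exact: eqm_scale1.
exists (translate_functor thin_type thinV_type wfR expand_rel).
exists (translate_functor thick_dot_type thick_dotV_type wfF reduce_rel); split.
  apply: translate_left_inverse; case; [exact: reduce_dot1 | exact: reduce_dotV1].
apply: translate_left_inverse => -[[] // n p].
  have -> : exist _ n.+1 p = thick n by apply: val_inj.
  by apply: (expandK x (dot k U) n.+1); apply: eqm_rel; apply: (full_W6 q coef (a := n.+1) isT).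
have -> : exist _ n.+1 p = thick n by apply: val_inj.
by apply: (expandK xV (dotV k U) n.+1); apply: eqm_rel; apply: (full_W6V q coef (a := n.+1) isT).
Qed.
End Reduction.

(** * Quantum integers over the field of rational functions *)

Lemma qvar_neq0 (R : realType) : qvar R != 0.
Proof. by rewrite /qvar tofrac_eq0 polyX_eq0. Qed.

Lemma qvar_exp_neq1 (R : realType) n : qvar R ^+ n.+1 != 1.
Proof.
rewrite /qvar -tofracXn -tofrac1 tofrac_eq; apply/eqP => /(congr1 (fun p : {poly _} => size p)).
by rewrite size_polyXn size_poly1.
Qed.

Lemma qint_neq0 (k : fieldType) (q : k) (q0 : q != 0) (q1 : forall n, q ^+ n.+1 != 1) n :
  qint q n.+1 != 0.
Proof.
have sub_neq0 m : q ^+ m.+1 - q ^- m.+1 != 0.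
  (* If q^(m+1) were its own inverse then q^(2m+2) = 1; the exponent is written as the successor of
     (m+1) + m. *)
  rewrite subr_eq0; apply: contraNneq (q1 (m.+1 + m)%N) => e.
  by rewrite -addnS exprD {1}e mulVf ?expf_neq0.
rewrite /qint mulf_neq0 ?invr_neq0 //; have := sub_neq0 0; by rewrite expr1.
Qed.

Theorem theorem1 (R : realType) :
  isomorphic (Web' (qvar R)) (Web (qvar R)) /\
  isomorphic (Schur' (qvar R)) (Schur (qvar R)).
Proof.
have qn0 := qint_neq0 (qvar_neq0 R) (@qvar_exp_neq1 R).
split; [exact: (isomorphic_presented (qvar_neq0 R) qn0 (of_void _))
       | exact: (isomorphic_presented (qvar_neq0 R) qn0 id)].
Qed.
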